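(* Let $(\mathrm{S},\mathfrak{s})$ be the supergroup of an irreducible real reductive dual pair different from $(\mathrm{O}_1,\mathrm{Sp}_{2n})$ over $\mathbb{R}$ or $\mathbb{C}$. Then the set of almost semisimple elements of $\mathfrak{s}_{\overline 1}$ is dense in $\mathfrak{s}_{\overline 1}$. Moreover, the set of semisimple elements of $\mathfrak{s}_{\overline 1}$ is dense in $\mathfrak{s}_{\overline 1}$ if and only if the dual pair is not isomorphic to one of the following: $(\mathrm{O}_{p,q},\mathrm{Sp}_{2n}(\mathbb{R}))$ with $p+q$ odd and $p+q<2n$; $(\mathrm{O}_p(\mathbb{C}),\mathrm{Sp}_{2n}(\mathbb{C}))$ with $p$ odd and $p<2n$.
   Context: Supergroups. Let $\mathbb{D}\in\{\mathbb{R},\mathbb{C},\mathbb{H}\}$ and let $V=V_{\overline 0}\oplus V_{\overline 1}$ be a finite-dimensional $\mathbb{Z}/2$-graded $\mathbb{D}$-vector space with both parts nonzero; $\sigma\in\mathrm{End}(V)$ is $+1$ on $V_{\overline 0}$ and $-1$ on $V_{\overline 1}$. The supergroup $(\mathrm{S},\mathfrak{s})$ of an irreducible real reductive dual pair $(\mathrm{G},\mathrm{G}')$ is one of the following. Type II: $\mathrm{S}=\mathrm{G}\times\mathrm{G}'=\mathrm{GL}_{\mathbb{D}}(V_{\overline 0})\times\mathrm{GL}_{\mathbb{D}}(V_{\overline 1})$ and $\mathfrak{s}_{\overline 0},\mathfrak{s}_{\overline 1}$ are the even and odd parts of $\mathrm{End}_{\mathbb{D}}(V)$. Type I: $\mathbb{D}$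 has a (possibly trivial) involution, $(\cdot,\cdot)=(\cdot,\cdot)_{\overline 0}\oplus(\cdot,\cdot)_{\overline 1}$ with $(\cdot,\cdot)_{\overline 0}$ nondegenerate (skew-)hermitian or (skew-)symmetric on $V_{\overline 0}$ and $(\cdot,\cdot)_{\overline 1}$ nondegenerate of the opposite symmetry on $V_{\overline 1}$ (say hermitian/symmetric on $V_{\overline 0}$ and skew on $V_{\overline 1}$), $\mathrm{S}=\mathrm{G}\times\mathrm{G}'$ is the product of the isometry groups, $\mathfrak{s}_{\overline 0}$ is its Lie algebra, and $\mathfrak{s}_{\overline 1}$ is the set of odd $x\in\mathrm{End}_{\mathbb{D}}(V)$ with $(xu,v)=(u,\sigma xv)$ for all $u,v\in V$. Thus the type I pairs are $(\mathrm{O}_{p,q},\mathrm{Sp}_{2n}(\mathbb{R}))$, $(\mathrm{O}_p(\mathbb{C}),\mathrm{Sp}_{2n}(\mathbb{C}))$, $(\mathrm{U}_{p,q},\mathrm{U}_{r,s})$, $(\mathrm{Sp}_{p,q},\mathrm{O}^*_{2n})$ (members may be interchanged). $\mathfrak{s}=\mathfrak{s}_{\overline 0}\oplus\mathfrak{s}_{\overline 1}$ is a Lie superalgebra; $[x,y]=xy-yx$ if $x$ or $y$ is even and $\{x,y\}=xy+yx\in\mathfrak{s}_{\overline 0}$ for $x,y\in\mathfrak{s}_{\overline 1}$. $\mathrm{S}$ acts on $\mathfrak{s}$ by conjugation, written $g.x$. Cartan subspaces. An element of $\mathfrak{s}$ is semisimple (nilpotent) if it is so as an endomorphism of $V$ (semisimple: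 diagonalizable over $\mathbb{C}$; if $\mathbb{D}=\mathbb{H}$ view $V$ as a complex space). A semisimple $x\in\mathfrak{s}_{\overline 1}$ is regular if $x\ne0$ and $\dim(\mathrm{S}.x)\ge\dim(\mathrm{S}.y)$ for all semisimple $y\in\mathfrak{s}_{\overline 1}$. The anticommutant of $x$ is $\{y\in\mathfrak{s}_{\overline 1}:\{x,y\}=0\}$; the double anticommutant of $x$ is the set of elements of $\mathfrak{s}_{\overline 1}$ anticommuting with every element of the anticommutant of $x$. A Cartan subspace $\mathfrak{h}_{\overline 1}\subseteq\mathfrak{s}_{\overline 1}$ is the double anticommutant of a regular semisimple element. Almost semisimple elements. For a Cartan subspace $\mathfrak{h}_{\overline 1}$ let $V^0\subseteq V$ be the intersection of the kernels of all elements of $\mathfrak{h}_{\overline 1}$, and $V^+$ the sum of their images, so $V=V^0\oplus V^+$. Let $\mathfrak{s}_{\overline 1}(V^0)$ be the set of $x\in\mathfrak{s}_{\overline 1}$ preserving $V^0$ and vanishing on $V^+$. Put $\tilde{\mathfrak{h}}_{\overline 1}=\mathfrak{s}_{\overline 1}(V^0)\oplus\mathfrak{h}_{\overline 1}$. An element of $\mathfrak{s}_{\overline 1}$ is almost semisimple if it is $\mathrm{S}$-conjugate to an element of $\tilde{\mathfrak{h}}_{\overline 1}$ for some Cartan subspace $\mathfrak{h}_{\overline 1}$. *)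

(* Defs.v *)
(* MathComp / MathComp-Analysis world; R : realType is the field of real
   numbers and R[i] the field of complex numbers.                             *)
From HB Require Import structures.
From mathcomp Require Import all_boot all_order all_algebra.
From mathcomp Require Import complex ring.
From mathcomp Require Import all_classical all_reals all_analysis.

Set Implicit Arguments.
Unset Strict Implicit.
Unset Printing Implicit Defensive.

Import Order.TTheory GRing.Theory Num.Theory.
Import numFieldNormedType.Exports.

Local Open Scope classical_set_scope.
Local Open Scope ring_scope.

(* No compatibility axiom is required: this is only the join needed to have
   both matrix algebra and the entrywise matrix topology.                     *)
#[short(type="topNzRingType")]
HB.structure Definition TopNzRing := {D of GRing.NzRing D & Topological D}.

Definition reals (R : realType) : Type := R.
HB.instance Definition _ (R : realType) := GRing.NzRing.copy (reals R) R.
HB.instance Definition _ (R : realType) := Topological.copy (reals R) R.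

Definition complexes (R : realType) : Type := R[i].
HB.instance Definition _ (R : realType) :=
  GRing.NzRing.copy (complexes R) R[i].
(* R[i]^o carries the topology of the norm of R[i].                           *)
HB.instance Definition _ (R : realType) :=
  Topological.copy (complexes R) (R[i]^o)%type.

(* The pair (a, c) stands for a + c * j, with j * z = z^* * j for z in R[i]
   and j * j = -1; so 1, 'i, j and 'i * j = k are the usual basis.            *)
Definition quaternions (R : realType) : Type := (complexes R * complexes R)%type.

Section Quaternions.
Variable R : realType.
Local Notation H := (quaternions R).

HB.instance Definition _ :=
  GRing.Zmodule.copy H (complexes R * complexes R)%type.
HB.instance Definition _ :=
  Topological.copy H (complexes R * complexes R)%type.

Definition quat_one : H := (1 : R[i], 0 : R[i]).

Definition quat_mul (p q : H) : H :=
  let: (a, c) := (p.1 : R[i], p.2 : R[i]) in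
  let: (a', c') := (q.1 : R[i], q.2 : R[i]) in
  (a * a' - c * (c'^*)%C, a * c' + c * (a'^*)%C).

Definition quat_conj (p : H) : H := ((p.1 : R[i])^*%C, - p.2).

Lemma quat_mulA : associative quat_mul.
Proof.
move=> [a c] [a' c'] [a2 c2]; rewrite /quat_mul /=.
by congr pair; rewrite !(rmorphB, rmorphD, rmorphM) /= conjcK; ring.
Qed.

Lemma quat_mul1 : left_id quat_one quat_mul.
Proof.
by move=> [a c]; rewrite /quat_mul /= !mul1r !mul0r subr0 addr0.
Qed.

Lemma quat_mulr1 : right_id quat_one quat_mul.
Proof.
move=> [a c]; rewrite /quat_mul /=.
by rewrite !oppr0 !mulr0 !mulr1 subr0 add0r.
Qed.

Lemma quat_mulDl : left_distributive quat_mul +%R.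
Proof.
move=> [a c] [a' c'] [a2 c2]; rewrite /quat_mul /=.
by congr pair; rewrite /= !mulrDl ?opprD addrACA.
Qed.

Lemma quat_mulDr : right_distributive quat_mul +%R.
Proof.
move=> [a c] [a' c'] [a2 c2]; rewrite /quat_mul /=.
by congr pair; rewrite /= !rmorphD /= !mulrDr ?opprD addrACA.
Qed.

Lemma quat_one_neq0 : quat_one != 0.
Proof. by apply/eqP => -[] /eqP; rewrite oner_eq0. Qed.

HB.instance Definition _ := GRing.Zmodule_isNzRing.Build H
  quat_mulA quat_mul1 quat_mulr1 quat_mulDl quat_mulDr quat_one_neq0.

End Quaternions.

Variant base := RealD | ComplexD | QuatD.

Definition dring (R : realType) (b : base) : topNzRingType :=
  match b with
  | RealD => reals R
  | ComplexD => complexes R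
  | QuatD => quaternions R
  end.

Definition of_real (R : realType) (b : base) : R -> dring R b :=
  match b with
  | RealD => fun c => c
  | ComplexD => fun c => (c%:C)%C
  | QuatD => fun c => ((c%:C)%C, 0)
  end.
Arguments of_real {R} b c.

(* The identity of the quaternions is not an involution, as it does not reverse
   products. An involution z |-> q * z^* * q^-1 with q purely imaginary gives
   the same pairs as ConjH, by rescaling the forms by q.                      *)
Variant involution : base -> Type :=
  | TrivR : involution RealD
  | TrivC : involution ComplexD
  | ConjC : involution ComplexD
  | ConjH : involution QuatD.

Definition inv_fun (R : realType) (b : base) (t : involution b) :
    dring R b -> dring R b :=
  match t in involution b return dring R b -> dring R b with
  | TrivR => fun z => z
  | TrivC => fun z => z
  | ConjC => fun z : R[i] => (z^*)%C
  | ConjH => @quat_conj R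
  end.

(* V_0 = D^m and V_1 = D^n are right D-vector spaces of column vectors, so
   that End_D(V) = 'M[D]_(m + n) acts on the left.                            *)
Variant pair_datum (R : realType) (b : base) (m n : nat) :=
  | TypeII
  | TypeI of involution b & 'M[dring R b]_m & 'M[dring R b]_n.
Arguments TypeII {R b m n}.
Arguments TypeI {R b m n} t B0 B1 : rename.

Section Forms.
Variables (R : realType) (b : base) (t : involution b) (N : nat).
Local Notation D := (dring R b).
Implicit Types (B : 'M[D]_N) (u v : 'cV[D]_N).

(* Semilinear in u, linear in v, for scalars acting on the right.             *)
Definition form B u v : D :=
  ((map_mx (@inv_fun R b t) u)^T *m B *m v) 0 0.

Definition nondegenerate B :=
  forall u, (forall v, form B u v = 0) -> u = 0.

Definition hermitian B := forall u v, form B v u = inv_fun t (form B u v).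

Definition skew_hermitian B :=
  forall u v, form B v u = - inv_fun t (form B u v).

End Forms.

(* With the trivial involution, (skew-)hermitian means (skew-)symmetric.      *)
Definition dual_pair (R : realType) (b : base) (m n : nat)
    (P : pair_datum R b m n) : Prop :=
  [/\ (0 < m)%N, (0 < n)%N &
    match P with
    | TypeII => True
    | TypeI t B0 B1 => [/\ nondegenerate t B0, hermitian t B0,
                           nondegenerate t B1 & skew_hermitian t B1]
    end].

(* The pairs (O_{p,q}, Sp_n(R)) with p + q = m, and (O_m(C), Sp_n(C)); here n
   is the dimension of the symplectic space, hence even.                      *)
Definition orthosymplectic (R : realType) (b : base) (m n : nat)
    (P : pair_datum R b m n) : bool :=
  match P with
  | TypeI TrivR _ _ | TypeI TrivC _ _ => true
  | _ => false
  end.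

(* Diagonalizability of x, seen as a complex endomorphism: of the
   complexification of R^N for RealD, of C^N for ComplexD, and of H^N with its
   right C-structure for QuatD. In the last case x = A + C j, with A and C
   complex, is written in the basis (e_1, .., e_N, e_1 j, .., e_N j).         *)
Definition semisimple (R : realType) (b : base) (N : nat) :
    'M[dring R b]_N -> Prop :=
  match b return 'M[dring R b]_N -> Prop with
  | RealD => fun x => diagonalizable (map_mx (fun c : R => (c%:C)%C) x)
  | ComplexD => fun x => diagonalizable (x : 'M[R[i]]_N)
  | QuatD => fun x =>
      let A : 'M[R[i]]_N := map_mx fst x in
      let C : 'M[R[i]]_N := map_mx snd x in
      diagonalizable (block_mx A (- C) (map_mx conjc C) (map_mx conjc A))
  end.

Section RealDimension.
Variables (R : realType) (b : base) (N : nat).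
Local Notation D := (dring R b).

(* f is a basis of the real subspace W.                                       *)
Definition real_basis (W : set 'M[D]_N) (k : nat) (f : 'I_k -> 'M[D]_N) :=
  (forall i, W (f i)) /\
  (forall w, W w ->
     exists! c : 'rV[R]_k, w = \sum_(i < k) of_real b (c 0 i) *: f i).

Definition real_dim (W : set 'M[D]_N) (k : nat) :=
  exists f : 'I_k -> 'M[D]_N, real_basis W f.

End RealDimension.

Section Supergroup.
Variables (R : realType) (b : base) (m n : nat) (P : pair_datum R b m n).
Local Notation D := (dring R b).
Local Notation End_V := ('M[D]_(m + n)).
Local Notation V := ('cV[D]_(m + n)).
Implicit Types (x y g h : End_V) (u v : V).

Definition even_mx x := ursubmx x = 0 /\ dlsubmx x = 0.
Definition odd_mx x := ulsubmx x = 0 /\ drsubmx x = 0.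

Definition sigma : End_V := block_mx 1%:M 0 0 (- 1%:M).

Definition inverse_mx g h := g *m h = 1%:M /\ h *m g = 1%:M.

(* Even automorphisms are the pairs of automorphisms of V_0 and V_1, and for
   them preserving the orthogonal sum of the two forms amounts to preserving
   each of them.                                                              *)
Definition group_S : set End_V := [set g |
  [/\ even_mx g, exists h, inverse_mx g h &
    match P with
    | TypeII => True
    | TypeI t B0 B1 => let B := block_mx B0 0 0 B1 in
        forall u v, form t B (g *m u) (g *m v) = form t B u v
    end]].

Definition s_even : set End_V := [set x |
  even_mx x /\
    match P with
    | TypeII => True
    | TypeI t B0 B1 => let B := block_mx B0 0 0 B1 in
        forall u v, form t B (x *m u) v + form t B u (x *m v) = 0
    end].

Definition s_odd : set End_V := [set x |
  odd_mx x /\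
    match P with
    | TypeII => True
    | TypeI t B0 B1 => let B := block_mx B0 0 0 B1 in
        forall u v, form t B (x *m u) v = form t B u (sigma *m x *m v)
    end].

(* y lies in the orbit S.x.                                                   *)
Definition conjugate x y :=
  exists g h, [/\ group_S g, inverse_mx g h & y = g *m x *m h].

(* Tangent space at x of the orbit S.x, i.e. the image of the Lie algebra of S
   under the differential at 1 of g |-> g.x.                                  *)
Definition orbit_tangent x : set End_V :=
  [set z | exists2 y, s_even y & z = y *m x - x *m y].

Definition orbit_dim x (k : nat) := real_dim (orbit_tangent x) k.

Definition odd_semisimple : set End_V := [set x | s_odd x /\ semisimple x].

Definition regular_semisimple : set End_V := [set x |
  [/\ odd_semisimple x, x != 0 &
    forall y, odd_semisimple y ->
      forall k l, orbit_dim x k -> orbit_dim y l -> (l <= k)%N]].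

Definition anticommute x y := x *m y + y *m x = 0.

Definition anticommutant x : set End_V :=
  [set y | s_odd y /\ anticommute x y].

Definition double_anticommutant x : set End_V :=
  [set z | s_odd z /\ forall y, anticommutant x y -> anticommute z y].

Definition Cartan_subspace (h1 : set End_V) :=
  exists2 x, regular_semisimple x & h1 = double_anticommutant x.

Definition V_zero (h1 : set End_V) : set V :=
  [set v | forall x, h1 x -> x *m v = 0].

Definition V_plus (h1 : set End_V) : set V :=
  [set v | exists (k : nat) (x : 'I_k -> End_V) (u : 'I_k -> V),
     (forall i, h1 (x i)) /\ v = \sum_(i < k) x i *m u i].

Definition s_odd_V_zero (h1 : set End_V) : set End_V := [set x |
  [/\ s_odd x, forall v, V_zero h1 v -> V_zero h1 (x *m v) &
    forall v, V_plus h1 v -> x *m v = 0]].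

Definition h_tilde (h1 : set End_V) : set End_V :=
  [set x | exists y z, [/\ s_odd_V_zero h1 y, h1 z & x = y + z]].

Definition almost_semisimple : set End_V := [set x |
  s_odd x /\ exists2 h1, Cartan_subspace h1 &
    exists2 y, h_tilde h1 y & conjugate x y].

(* A subset A of s_odd is dense in s_odd for the topology induced by End_V.   *)
Definition dense_in_s_odd (A : set End_V) :=
  A `<=` s_odd /\ s_odd `<=` closure A.

End Supergroup.

(* Main.v *)
From mathcomp Require Import all_boot all_order all_algebra separable.
From mathcomp Require Import complex ring lra.
From mathcomp Require Import all_classical all_reals all_analysis.
Require Import Defs.

(** Write an odd element as x = (a, b) with a : V_0 -> V_1 and b : V_1 -> V_0, of
    square b a on V_0 and a b on V_1. If b a is invertible with simple spectrum
    and p is its characteristic polynomial, then x is killed by 'X p('X^2), whose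
    roots are simple, so that x is semisimple (odd_diagonalizable_nz); likewise
    for a b.

    Every genericity condition met below says that some polynomial in the entries
    of x is nonzero. On a real line it fails only for finitely many values of the
    parameter as soon as it holds at one point, possibly a complex one, and a set
    containing all but finitely many points of a line through x0 is adherent to x0
    (closure_line). Having an orbit of dimension at least k is such a condition,
    since the dimension is the rank of y |-> [y, x] on the even part.

    Suppose first that the pair is not exceptional. A complex odd element of simple
    nonzero spectrum exists (exists_simple_odd): the complexification of the
    superalgebra is general linear or orthosymplectic, and such an element is
    written in bases of the two spaces, respectively in hyperbolic pairs of the two
    forms. Together with maximality of the rank this makes regular semisimple
    elements dense; they lie in their own double anticommutant, hence are almost
    semisimple.

    In the exceptional pairs m = dim V_0 is odd and m < n = dim V_1, so that m >= 3
    since m = 1 is excluded. The square A = b a is skew-adjoint for the symmetric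
    form, so that its characteristic polynomial is 'X p with p even. Where the
    spectrum of A is simple, p(0) <> 0 and E = p(A) / p(0) is the self-adjoint
    projection on the kernel of A. The elements x_s and x_n given by a (1 - E) and
    a E have sum x and anticommute, and x_s is semisimple. As the kernel of b_s has
    dimension at least n - m + 1 >= 2, the double anticommutant of x_s kills x_n
    (double_anticommutant_kernel), which therefore belongs to s_1(V^0) for
    the Cartan subspace of x_s, provided that x_s is regular.

    Regularity of x_s for generic x is obtained as follows. The multiple p(0) x_s,
    called the core, is polynomial in x, so that its rank is generically at least
    the rank of the core of any given element. A semisimple element y kills an
    anisotropic vector u of V_0 (semisimple_anisotropic_kernel). For the generic
    elements killing u, p(0) <> 0 and the core is p(0) times the element itself
    (core_degenerate), so that the generic rank of the core is at least the rank of
    y (exists_simple_square_rank); choose y of maximal rank.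

    Finally, in the exceptional pairs a semisimple element has a noninjective
    a : V_0 -> V_1, which is a closed condition not satisfied by all elements as
    m < n: semisimple elements are not dense. *)

Set Implicit Arguments.
Unset Strict Implicit.
Unset Printing Implicit Defensive.

Import Order.TTheory GRing.Theory Num.Theory.
Import numFieldNormedType.Exports.

Local Open Scope classical_set_scope.
Local Open Scope ring_scope.

(** * Odd matrices whose square has simple spectrum *)

Definition simple_spectrum (F : fieldType) N (A : 'M[F]_N) :=
  separable_poly (char_poly A).

Lemma block_odd (F : nzRingType) p q (a : 'M[F]_(q, p)) (c : 'M[F]_(p, q)) :
  block_mx 0 c a 0 =
  col_mx 1%:M 0 *m c *m row_mx 0 1%:M + col_mx 0 1%:M *m a *m row_mx 1%:M 0.
Proof.
rewrite !mul_col_mx !mul_mx_row !mul1mx !mul0mx !mulmx1 !mulmx0.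
by rewrite add_col_mx !add_row_mx !addr0 !add0r.
Qed.

Section OddDiag.
Variable C : numClosedFieldType.

(** The square of an odd x = (a, b) acts as b a on the even part and as a b on
    the odd part. The injections I0, I1 and projections P0, P1 of the grading
    are kept abstract: in the complexification of a quaternionic space the
    coordinates come in an order for which x is not block antidiagonal. *)
Lemma odd_horner N N0 N1 (x : 'M[C]_N.+1) (I0 : 'M[C]_(N.+1, N0.+1)) P0
    (I1 : 'M[C]_(N.+1, N1)) P1 a b p :
    P0 *m I0 = 1%:M -> P0 *m I1 = 0 -> P1 *m I0 = 0 -> P1 *m I1 = 1%:M ->
    x = I0 *m b *m P1 + I1 *m a *m P0 ->
  x * horner_mx (x ^+ 2) p =
    I1 *m (a *m horner_mx (b *m a) p) *m P0 +
    I0 *m (horner_mx (b *m a) p *m b) *m P1.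
Proof.
move=> h00 h01 h10 h11 xE.
have P0x : P0 *m x = b *m P1.
  by rewrite xE mulmxDr !mulmxA h00 h01 !mul0mx mul1mx addr0.
have P1x : P1 *m x = a *m P0.
  by rewrite xE mulmxDr !mulmxA h10 h11 !mul0mx mul1mx add0r.
have P0xx : P0 *m (x *m x) = b *m a *m P0 by rewrite mulmxA P0x -mulmxA P1x mulmxA.
have P1xx : P1 *m (x *m x) = a *m b *m P1 by rewrite mulmxA P1x -mulmxA P0x mulmxA.
elim/poly_ind: p => [|p c IH].
  by rewrite !rmorph0 mulr0 mulmx0 mul0mx !mulmx0 !mul0mx addr0.
rewrite !(rmorphD, rmorphM) /= !(horner_mx_X, horner_mx_C) mulrDr mulrA IH.
rewrite -mulmxE expr2 -mulmxE mulmxDl -!(mulmxA _ P0) -!(mulmxA _ P1) P0xx P1xx.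
rewrite mul_mx_scalar !mulmxDl !mulmxDr !mulmxDl mul_mx_scalar mul_scalar_mx.
have -> : c *: x = c *: (I0 *m b *m P1 + I1 *m a *m P0) by rewrite -xE.
rewrite scalerDr -!mulmxE -!scalemxAr -!scalemxAl !mulmxA.
by rewrite [X in _ + X = _]addrC addrACA.
Qed.

(** x is killed by 'X * p('X^2), whose roots 0 and +-sqrt r, for the roots r of
    p, are simple. *)
Lemma odd_diagonalizableS N N0 N1 (x : 'M[C]_N.+1) (I0 : 'M[C]_(N.+1, N0.+1)) P0
    (I1 : 'M[C]_(N.+1, N1)) P1 a b p :
    P0 *m I0 = 1%:M -> P0 *m I1 = 0 -> P1 *m I0 = 0 -> P1 *m I1 = 1%:M ->
    x = I0 *m b *m P1 + I1 *m a *m P0 ->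
    p \is monic -> separable_poly p -> p.[0] != 0 ->
    a *m horner_mx (b *m a) p = 0 -> horner_mx (b *m a) p *m b = 0 ->
  diagonalizable x.
Proof.
move=> h00 h01 h10 h11 xE pmon psep p0 ap pb.
have xp : x * horner_mx (x ^+ 2) p = 0.
  by rewrite (odd_horner _ h00 h01 h10 h11 xE) ap pb !mulmx0 !mul0mx addr0.
have [rs pE] := closed_field_poly_normal p.
rewrite (monicP pmon) scale1r in pE.
have urs : uniq rs by rewrite -separable_prod_XsubC -pE.
have nz r : r \in rs -> r != 0.
  move=> rin; apply: contra_neq p0 => r0.
  by apply/eqP; rewrite -[p.[0] == 0]/(root p 0) pE root_prod_XsubC -r0.
pose ss := flatten [seq [:: sqrtC r; - sqrtC r] | r <- rs].
have ssE s : s \in ss -> s ^+ 2 \in rs.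
  by case/flatten_mapP => r rin; rewrite !inE => /orP[] /eqP ->; rewrite ?sqrrN sqrtCK.
have uss : uniq (0 :: ss).
  rewrite /=; apply/andP; split.
    by apply/negP => /ssE; rewrite expr0n /= => /nz; rewrite eqxx.
  rewrite /ss {pE ss ssE}; elim: rs urs nz => //= r rs IH /andP[rn urs] nz.
  have ssE s : s \in flatten [seq [:: sqrtC r; - sqrtC r] | r <- rs] -> s ^+ 2 \in rs.
    by case/flatten_mapP => q rin; rewrite !inE => /orP[] /eqP ->; rewrite ?sqrrN sqrtCK.
  rewrite IH ?urs // ?andbT; last by move=> q qin; apply: nz; rewrite inE qin orbT.
  have r0 : r != 0 by rewrite nz ?mem_head.
  rewrite in_cons negb_or -andbA; apply/and3P; split => //.
  - by rewrite eq_sym -subr_eq0 -opprD oppr_eq0 -mulr2n mulrn_eq0 sqrtC_eq0.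
  - by apply: contra rn => /ssE; rewrite sqrtCK.
  - by apply: contra rn => /ssE; rewrite sqrrN sqrtCK.
apply/diagonalizableP; exists (0 :: ss) => //.
apply: mxminpoly_min; rewrite big_cons subr0 rmorphM /= horner_mx_X -[RHS]xp.
congr (_ * _); rewrite pE rmorph_prod /ss; elim: (rs) => [|r rs' IH] /=.
  by rewrite !big_nil rmorph1.
rewrite !big_cons mulrA rmorphM /= {}IH; congr (_ * _).
rewrite -rmorphM polyCN opprK -subr_sqr -polyC_exp sqrtCK.
by rewrite !rmorphB rmorphXn /= !horner_mx_C !horner_mx_X.
Qed.

Lemma odd_diagonalizable N N0 N1 (x : 'M[C]_N) (I0 : 'M[C]_(N, N0.+1)) P0
    (I1 : 'M[C]_(N, N1)) P1 a b p :
    P0 *m I0 = 1%:M -> P0 *m I1 = 0 -> P1 *m I0 = 0 -> P1 *m I1 = 1%:M ->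
    x = I0 *m b *m P1 + I1 *m a *m P0 ->
    p \is monic -> separable_poly p -> p.[0] != 0 ->
    a *m horner_mx (b *m a) p = 0 -> horner_mx (b *m a) p *m b = 0 ->
  diagonalizable x.
Proof.
case: N I0 P0 I1 P1 x => [|N] I0 P0 I1 P1 x; last exact: odd_diagonalizableS.
by move=> *; rewrite (flatmx0 x); apply: diagonalizable0.
Qed.

(** Here p is the characteristic polynomial of b a. *)
Lemma odd_diagonalizable_nz N N0 N1 (x : 'M[C]_N) (I0 : 'M[C]_(N, N0)) P0
    (I1 : 'M[C]_(N, N1)) P1 a b : (0 < N0)%N ->
    P0 *m I0 = 1%:M -> P0 *m I1 = 0 -> P1 *m I0 = 0 -> P1 *m I1 = 1%:M ->
    x = I0 *m b *m P1 + I1 *m a *m P0 ->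
    simple_spectrum (b *m a) -> \det (b *m a) != 0 ->
  diagonalizable x.
Proof.
case: N0 I0 P0 a b => // N0 I0 P0 a b _.
move=> h00 h01 h10 h11 xE sep dnz.
apply: (odd_diagonalizable h00 h01 h10 h11 xE (char_poly_monic _) sep).
- by rewrite horner_coef0 char_poly_det mulf_neq0 // signr_eq0.
- by rewrite Cayley_Hamilton mulmx0.
- by rewrite Cayley_Hamilton mul0mx.
Qed.

End OddDiag.

(** * Genericity along polynomial families *)

Section LineMatrix.
Variable K : comNzRingType.

(** The line X + t Y as a matrix with entries polynomial in t. *)
Definition pline k l (X Y : 'M[K]_(k, l)) : 'M[{poly K}]_(k, l) :=
  map_mx polyC X + 'X *: map_mx polyC Y.

Lemma plineE k l (X Y : 'M[K]_(k, l)) t :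
  map_mx (horner_eval t) (pline X Y) = X + t *: Y.
Proof. by apply/matrixP => i j; rewrite !mxE /horner_eval !hornerE. Qed.

Lemma map_horner_polyC k l (X : 'M[K]_(k, l)) t :
  map_mx (horner_eval t) (map_mx polyC X) = X.
Proof. by apply/matrixP => i j; rewrite !mxE /horner_eval hornerC. Qed.

End LineMatrix.

Section Generic.
Variable C : numClosedFieldType.

(** A property that fails only for finitely many t, the elements of some list,
    is used below as a substitute for Zariski genericity: all families that
    occur are polynomial in one parameter. *)
Lemma poly_cofinite (p : {poly C}) s0 : p.[s0] != 0 ->
  exists s : seq C, forall t, t \notin s -> p.[t] != 0.
Proof.
move=> ps0; have [rs pE] := closed_field_poly_normal p.
have pnz : p != 0 by apply: contraNneq ps0 => ->; rewrite horner0.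
exists rs => t tn; rewrite pE hornerZ mulf_neq0 ?lead_coef_eq0 //.
by rewrite -[_ == 0]/(root _ t) root_prod_XsubC.
Qed.

Lemma separable_resultant N (A : 'M[C]_N.+1) :
  simple_spectrum A = (resultant (char_poly A) (char_poly A)^`() != 0).
Proof.
rewrite resultant_eq0 -leqNgt /simple_spectrum unlock coprimep_def.
apply/idP/idP => [/eqP -> //|le1].
by rewrite eqn_leq le1 size_poly_gt0 gcdp_eq0 negb_and monic_neq0 ?char_poly_monic.
Qed.

(** The resultant of the characteristic polynomial and its derivative is a
    polynomial in the parameter; both leading coefficients, 1 and N, are
    constants, so that it specializes well. *)
Lemma separable_cofinite N (A : 'M[{poly C}]_N) s0 : (0 < N)%N ->
  simple_spectrum (map_mx (horner_eval s0) A) ->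
  exists s : seq C, forall t, t \notin s -> simple_spectrum (map_mx (horner_eval t) A).
Proof.
case: N A => // N A _.
have resE t : (resultant (char_poly A) (char_poly A)^`()).[t] =
    resultant (char_poly (map_mx (horner_eval t) A))
              (char_poly (map_mx (horner_eval t) A))^`().
  have mon : char_poly A \is monic by apply: char_poly_monic.
  have cN : (char_poly A)^`()`_N = (N.+1%:R)%:P.
    rewrite coef_deriv -[_`_N.+1]/(_`_(N.+2).-1) -(size_char_poly A).
    by rewrite -lead_coefE (monicP mon) polyC_natr.
  have szd : size (char_poly A)^`() = N.+1.
    apply/eqP; rewrite eqn_leq; apply/andP; split.
      by rewrite -ltnS -(size_char_poly A) lt_size_deriv // monic_neq0.
    by rewrite ltnNge; apply: contraTN isT => /leq_sizeP/(_ N (leqnn N))/eqP;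
      rewrite cN polyC_eq0 pnatr_eq0.
  rewrite -[LHS]/(horner_eval t _) map_resultant.
  - by rewrite -deriv_map /= map_char_poly.
  - by rewrite (monicP mon) /= /horner_eval hornerC oner_eq0.
  - by rewrite lead_coefE szd cN /= /horner_eval hornerC pnatr_eq0.
rewrite separable_resultant -resE => /poly_cofinite [s sP].
by exists s => t /sP; rewrite resE -separable_resultant.
Qed.

Lemma det_cofinite N (A : 'M[{poly C}]_N) s0 :
  \det (map_mx (horner_eval s0) A) != 0 ->
  exists s : seq C, forall t, t \notin s -> \det (map_mx (horner_eval t) A) != 0.
Proof.
rewrite det_map_mx => /poly_cofinite [s sP].
by exists s => t /sP; rewrite det_map_mx.
Qed.

End Generic.

(** * Hyperbolic pairs and complex points with simple spectrum *)

Section Hyperbolic.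
Variable K : fieldType.

(** The k columns of E and of F are the hyperbolic pairs of k pairwise orthogonal
    planes. *)
Definition hyperbolic N (B : 'M[K]_N) k (E F : 'M[K]_(N, k)) :=
  [/\ E^T *m B *m E = 0, F^T *m B *m F = 0 & E^T *m B *m F = 1%:M].

Lemma null_vector p N (M : 'M[K]_(p, N)) : (p < N)%N ->
  exists2 v : 'cV[K]_N, v != 0 & M *m v = 0.
Proof.
move=> pN; have /rowV0Pn[v vin vnz] : kermx M^T != 0.
  rewrite -mxrank_eq0 -lt0n mxrank_ker subn_gt0.
  exact: leq_ltn_trans (rank_leq_col _) pN.
exists v^T; first by rewrite trmx_eq0.
by apply: trmx_inj; rewrite trmx_mul trmxK trmx0; apply/sub_kermxP.
Qed.

Lemma dual_vector N (r : 'rV[K]_N) : r != 0 -> exists w : 'cV[K]_N, r *m w = 1%:M.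
Proof.
move=> rnz; have [i ri] : exists i, r 0 i != 0.
  apply/existsP; apply: contraNT rnz; rewrite negb_exists => /forallP h.
  by apply/eqP/rowP => i; rewrite mxE; apply/eqP; have := h i; rewrite negbK.
exists ((r 0 i)^-1 *: delta_mx i 0); rewrite -scalemxAr -colE.
by apply/matrixP => x y; rewrite !ord1 !mxE mulVf // eqxx.
Qed.

Lemma dual_covector N (v : 'cV[K]_N) : v != 0 -> exists r : 'rV[K]_N, r *m v = 1%:M.
Proof.
rewrite -trmx_eq0 => /dual_vector[w vw]; exists w^T.
by apply: trmx_inj; rewrite trmx_mul trmxK vw trmx1.
Qed.

Lemma form_dual_vector N (B : 'M[K]_N) (v : 'cV[K]_N) : B \in unitmx -> v != 0 ->
  exists w : 'cV[K]_N, v^T *m B *m w = 1%:M.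
Proof.
move=> Bu vnz; apply: dual_vector; apply: contra_neq vnz => /(congr1 (mulmx^~ (invmx B))).
by rewrite mulmxK // mul0mx => /eqP; rewrite trmx_eq0 => /eqP.
Qed.

Lemma singular_vector N (M : 'M[K]_N) : \det M = 0 ->
  exists2 u : 'cV[K]_N, u != 0 & M *m u = 0.
Proof.
rewrite -det_tr => /eqP/det0P[v vnz vM]; exists v^T; first by rewrite trmx_eq0.
by apply: trmx_inj; rewrite trmx_mul trmxK vM trmx0.
Qed.

Lemma det_skew_odd N (S : 'M[K]_N) : 2%:R != 0 :> K -> S^T = - S -> odd N ->
  \det S = 0.
Proof.
move=> nz2 ST oN; apply/eqP; rewrite -[_ == 0]orFb -(negPf nz2) -mulf_eq0 mulr_natl.
by rewrite mulr2n addr_eq0 -{1}det_tr ST -scaleN1r detZ -signr_odd oN expr1 mulN1r.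
Qed.

Lemma bilinear_tr N p q (B : 'M[K]_N) (X : 'M[K]_(N, p)) (Y : 'M[K]_(N, q)) :
  (X^T *m B *m Y)^T = Y^T *m B^T *m X.
Proof. by rewrite !trmx_mul trmxK mulmxA. Qed.

(** Any w0 with (v, w0) = 1 is made orthogonal to the pairs already found, then
    isotropic: subtracting c v changes (w, w) by 2 c in the symmetric case, and
    c vanishes in the skew case. *)
Lemma hyperbolic_step N (B : 'M[K]_N) (e : K) k (E F : 'M[K]_(N, k)) (v : 'cV[K]_N) :
    2%:R != 0 :> K -> e ^+ 2 = 1 -> B^T = e *: B -> B \in unitmx -> hyperbolic B E F ->
    v != 0 -> v^T *m B *m v = 0 -> E^T *m B *m v = 0 -> F^T *m B *m v = 0 ->
  exists w, hyperbolic B (row_mx E v) (row_mx F w).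
Proof.
move=> nz2 ee BT Bu [EE FF EF] vnz vv Ev Fv.
have sym p q (X : 'M[K]_(N, p)) (Y : 'M[K]_(N, q)) : X^T *m B *m Y = e *: (Y^T *m B *m X)^T.
  by rewrite bilinear_tr BT -scalemxAr -scalemxAl scalerA -expr2 ee scale1r.
have [w0 vw0] := form_dual_vector Bu vnz.
have FE : F^T *m B *m E = e%:M by rewrite sym EF trmx1 scalemx1.
have vE : v^T *m B *m E = 0 by rewrite sym Ev trmx0 scaler0.
have vF : v^T *m B *m F = 0 by rewrite sym Fv trmx0 scaler0.
pose w1 := w0 - F *m (E^T *m B *m w0) - e *: (E *m (F^T *m B *m w0)).
have Ew1 : E^T *m B *m w1 = 0.
  rewrite !mulmxBr -scalemxAr !(mulmxA _ F) !(mulmxA _ E) EE EF mul0mx mul1mx.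
  by rewrite scaler0 subr0 subrr.
have Fw1 : F^T *m B *m w1 = 0.
  rewrite !mulmxBr -scalemxAr !(mulmxA _ F) !(mulmxA _ E) FF FE mul0mx subr0.
  by rewrite mul_scalar_mx scalerA -expr2 ee scale1r subrr.
have vw1 : v^T *m B *m w1 = 1%:M.
  rewrite !mulmxBr -scalemxAr !(mulmxA _ F) !(mulmxA _ E) vE vF !mul0mx scaler0.
  by rewrite !subr0.
pose c := (w1^T *m B *m w1) 0 0 / 2%:R.
have ww1 : w1^T *m B *m w1 = (2%:R * c)%:M.
  apply/matrixP => x y; rewrite !ord1 [RHS]mxE eqxx /c mulrC divfK //.
have w1v : w1^T *m B *m v = e%:M by rewrite sym vw1 trmx1 scalemx1.
have ce : c * e = c.
  have := sym _ _ w1 w1; rewrite ww1 tr_scalar_mx scale_scalar_mx.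
  move=> /matrixP/(_ 0 0); rewrite !mxE eqxx !mulr1n => h.
  by apply: (mulfI nz2); rewrite [RHS]h; ring.
pose w := w1 - c *: v; exists w.
have vw : v^T *m B *m w = 1%:M by rewrite mulmxBr -scalemxAr vv vw1 scaler0 subr0.
have Ew : E^T *m B *m w = 0 by rewrite mulmxBr -scalemxAr Ev Ew1 scaler0 subr0.
have Fw : F^T *m B *m w = 0 by rewrite mulmxBr -scalemxAr Fv Fw1 scaler0 subr0.
have wF : w^T *m B *m F = 0 by rewrite sym Fw trmx0 scaler0.
have ww : w^T *m B *m w = 0.
  have wv : w^T *m B *m v = e%:M by rewrite sym vw trmx1 scalemx1.
  have w1w : w1^T *m B *m w = c%:M.
    rewrite mulmxBr -scalemxAr ww1 w1v scale_scalar_mx ce -raddfB /=.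
    by congr (_%:M); ring.
  rewrite mulmxBr -scalemxAr wv (sym _ _ w) w1w tr_scalar_mx !scale_scalar_mx.
  by rewrite [c * e]mulrC subrr.
split; rewrite tr_row_mx mul_col_mx mul_col_row.
- by rewrite EE Ev vE vv /block_mx !row_mx0 col_mx0.
- by rewrite FF Fw wF ww /block_mx !row_mx0 col_mx0.
- by rewrite EF Ew vF vw -scalar_mx_block.
Qed.

(** For a skew form every vector of the orthogonal complement is isotropic. *)
Lemma hyperbolic_skew N (B : 'M[K]_N) k : 2%:R != 0 :> K ->
    B^T = - B -> B \in unitmx -> (k + k <= N)%N ->
  exists E F : 'M[K]_(N, k), hyperbolic B E F.
Proof.
move=> nz2 BT Bu; elim: k => [|k IH] kN.
  by exists 0, 0; split; rewrite ?mulmx0 //; apply/matrixP => -[].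
have kkN : (k + k < N)%N by apply: leq_trans kN; rewrite addSn addnS.
have [E [F hyp]] := IH (ltnW kkN).
have [v vnz] := null_vector (col_mx (E^T *m B) (F^T *m B)) kkN.
rewrite mul_col_mx -col_mx0 => /eq_col_mx[Ev Fv].
rewrite -addn1; suff [w hw] : exists w, hyperbolic B (row_mx E v) (row_mx F w).
  by exists (row_mx E v), (row_mx F w).
apply: (@hyperbolic_step _ _ (-1)) => //; first by rewrite sqrrN expr1n.
  by rewrite scaleN1r.
have : v^T *m B *m v = - (v^T *m B *m v).
  have t : (v^T *m B *m v)^T = v^T *m B *m v by apply/matrixP => i j; rewrite !ord1 mxE.
  by rewrite -{1}t bilinear_tr BT mulmxN mulNmx.
move/eqP; rewrite -addr_eq0 -mulr2n -scaler_nat scaler_eq0 (negPf nz2) /=.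
by move/eqP.
Qed.

End Hyperbolic.

Section ComplexPoints.
Variable C : numClosedFieldType.

(** Over an algebraically closed field a plane of the orthogonal complement
    contains an isotropic vector: solve a quadratic equation. *)
Lemma hyperbolic_sym N (B : 'M[C]_N) k :
    B^T = B -> B \in unitmx -> (k + k <= N)%N ->
  exists E F : 'M[C]_(N, k), hyperbolic B E F.
Proof.
move=> BT Bu; elim: k => [|k IH] kN.
  by exists 0, 0; split; rewrite ?mulmx0 //; apply/matrixP => -[].
have kkN : ((k + k).+1 < N)%N by apply: leq_trans kN; rewrite addSn addnS.
have [E [F hyp]] := IH (ltnW (ltnW kkN)).
pose M := col_mx (E^T *m B) (F^T *m B).
suff [v [vnz vv Mv]] : exists v : 'cV[C]_N, [/\ v != 0, v^T *m B *m v = 0 & M *m v = 0].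
  move: Mv; rewrite mul_col_mx -col_mx0 => /eq_col_mx[Ev Fv].
  rewrite -addn1; suff [w hw] : exists w, hyperbolic B (row_mx E v) (row_mx F w).
    by exists (row_mx E v), (row_mx F w).
  apply: (@hyperbolic_step _ _ _ 1) => //; rewrite ?pnatr_eq0 ?expr1n //.
  by rewrite scale1r.
have [v1 v1nz Mv1] := null_vector M (ltnW kkN).
have [r rv1] := dual_covector v1nz.
(* v2 is orthogonal to r, hence not proportional to v1. *)
have [v2 v2nz] := null_vector (col_mx M r) (etrans (congr1 (fun p => (p < N)%N) (addn1 _)) kkN).
rewrite mul_col_mx -col_mx0 => /eq_col_mx[Mv2 rv2].
have [a aE] : exists a, v1^T *m B *m v1 = a%:M.
  by exists ((v1^T *m B *m v1) 0 0); apply: mx11_scalar.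
have [b bE] : exists b, v1^T *m B *m v2 = b%:M.
  by exists ((v1^T *m B *m v2) 0 0); apply: mx11_scalar.
have [c cE] : exists c, v2^T *m B *m v2 = c%:M.
  by exists ((v2^T *m B *m v2) 0 0); apply: mx11_scalar.
have b'E : v2^T *m B *m v1 = b%:M.
  by rewrite -[LHS]trmxK bilinear_tr BT bE tr_scalar_mx.
have [a0|anz] := eqVneq a 0.
  by exists v1; split => //; rewrite aE a0; apply/matrixP => i j; rewrite !mxE mul0rn.
pose z := (sqrtC (b ^+ 2 - a * c) - b) / a.
have zE : a * z ^+ 2 + 2%:R * b * z + c = 0.
  have e1 : (a * z + b) ^+ 2 = b ^+ 2 - a * c.
    by rewrite /z mulrC divfK // subrK sqrtCK.
  apply: (mulfI anz); rewrite mulr0.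
  have -> : a * (a * z ^+ 2 + 2%:R * b * z + c) = (a * z + b) ^+ 2 - (b ^+ 2 - a * c) by ring.
  by rewrite e1 subrr.
exists (z *: v1 + v2); split.
- apply: contra_neq v2nz => h.
  have := congr1 (mulmx r) h; rewrite mulmxDr -scalemxAr rv1 rv2 addr0 mulmx0.
  rewrite scale_scalar_mx mulr1 => /matrixP/(_ 0 0); rewrite !mxE eqxx mulr1n => z0.
  by rewrite -h z0 scale0r add0r.
- have -> : (z *: v1 + v2)^T = z *: v1^T + v2^T by apply/matrixP => i j; rewrite !mxE.
  rewrite !mulmxDl !mulmxDr -?scalemxAl -?scalemxAr -?scalemxAl.
  rewrite aE bE b'E cE !scale_scalar_mx -!raddfD /=.
  have -> : z * (z * a) + z * b + (z * b + c) = a * z ^+ 2 + 2%:R * b * z + c by ring.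
  by rewrite zE; apply/matrixP => i j; rewrite !mxE mul0rn.
- by rewrite mulmxDr -scalemxAr Mv1 Mv2 scaler0 addr0.
Qed.

(** N distinct eigenvalues exhaust the characteristic polynomial. *)
Lemma separable_eigenvalues N (A : 'M[C]_N) rs :
    uniq rs -> size rs = N -> (forall r, r \in rs -> eigenvalue A r) ->
  simple_spectrum A /\ (0 \notin rs -> \det A != 0).
Proof.
move=> urs srs hrs.
have cE : char_poly A = \prod_(z <- rs) ('X - z%:P).
  rewrite (@all_roots_prod_XsubC _ (char_poly A) rs) ?(monicP (char_poly_monic _)) ?scale1r //.
  - by rewrite size_char_poly srs.
  - by apply/allP => r /hrs; rewrite eigenvalue_root_char.
  - by rewrite uniq_rootsE.
split; first by rewrite /simple_spectrum cE separable_prod_XsubC.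
move=> n0; apply: contraNneq n0 => d0.
rewrite -root_prod_XsubC -cE /root horner_coef0 char_poly_det d0 mulr0 //.
Qed.

Definition signed_range k : seq C :=
  [seq i.+1%:R | i <- iota 0 k] ++ [seq - i.+1%:R | i <- iota 0 k].

Lemma signed_range_uniq k : uniq (0 :: signed_range k).
Proof.
have pos i : 0 < i.+1%:R :> C by rewrite ltr0n.
rewrite /= mem_cat negb_or cat_uniq !map_inj_uniq ?iota_uniq /=; first last.
- by move=> i j /eqP; rewrite eqr_nat => /eqP[].
- by move=> i j /oppr_inj/eqP; rewrite eqr_nat => /eqP[].
rewrite andbT -andbA; apply/and3P; split.
- by apply/mapP => -[i _ /eqP]; rewrite eq_sym pnatr_eq0.
- by apply/mapP => -[i _ /eqP]; rewrite eq_sym oppr_eq0 pnatr_eq0.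
- apply/hasPn => x /mapP[i _ ->]; apply/mapP => -[j _ /eqP].
  by rewrite eq_sym -subr_eq0 opprK -natrD pnatr_eq0 addSn.
Qed.

(** With hyperbolic pairs E0, F0 of B0 and E1, F1 of B1 let a send, up to
    sign, the i-th column of E0 to i+1 times that of E1 and the columns of F0 to
    those of F1, and let b be its adjoint. Then b a is diagonal on E0 and F0, with eigenvalues
    +-(i+1); the proof exhibits the row eigenvectors. *)
Lemma osp_eigenvalues N0 N1 (e : C) (B0 : 'M[C]_N0) (B1 : 'M[C]_N1) k :
    e = 1 \/ e = -1 ->
    B0^T = e *: B0 -> B1^T = - e *: B1 -> B0 \in unitmx -> B1 \in unitmx ->
    (k + k <= N0)%N -> (k + k <= N1)%N ->
  exists a b, B0 *m b = a^T *m B1 /\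
    forall r, r \in signed_range k -> eigenvalue (b *m a) r.
Proof.
move=> e1 B0T B1T B0u B1u k0 k1.
have nz2 : 2%:R != 0 :> C by rewrite pnatr_eq0.
have [E0 [F0 hyp0]] : exists E F : 'M[C]_(N0, k), hyperbolic B0 E F.
  case: e1 => ee; subst e.
    by apply: hyperbolic_sym => //; rewrite B0T scale1r.
  by apply: hyperbolic_skew => //; rewrite B0T scaleN1r.
have [E1 [F1 hyp1]] : exists E F : 'M[C]_(N1, k), hyperbolic B1 E F.
  case: e1 => ee; subst e.
    by apply: hyperbolic_skew => //; rewrite B1T scaleN1r.
  by apply: hyperbolic_sym => //; rewrite B1T opprK scale1r.
have ee : e * e = 1 by case: e1 => ->; rewrite ?mulr1 // mulrNN mulr1.
case: hyp0 => EE0 FF0 EF0; case: hyp1 => EE1 FF1 EF1.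
have FE0 : F0^T *m B0 *m E0 = e%:M.
  by rewrite -[LHS]trmxK bilinear_tr B0T -scalemxAr -scalemxAl EF0
    linearZ /= trmx1 scalemx1.
have FE1 : F1^T *m B1 *m E1 = (- e)%:M.
  by rewrite -[LHS]trmxK bilinear_tr B1T -scalemxAr -scalemxAl EF1
    linearZ /= trmx1 scalemx1.
pose L : 'M[C]_k := diag_mx (\row_i (i.+1%:R : C)).
pose a := E1 *m L *m F0^T *m B0 + F1 *m E0^T *m B0.
pose b := e *: (F0 *m L *m E1^T *m B1 + E0 *m F1^T *m B1).
have LT : L^T = L by rewrite tr_diag_mx.
have rF : F0^T *m B0 *m (b *m a) = - e *: (L *m (F0^T *m B0)).
  have h : F0^T *m B0 *m b = F1^T *m B1.
    rewrite /b -scalemxAr mulmxDr !mulmxA FF0 FE0 !mul0mx add0r mul_scalar_mx.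
    by rewrite -!scalemxAl scalerA ee scale1r.
  rewrite mulmxA h /a mulmxDr !mulmxA FE1 FF1 !mul0mx addr0 mul_scalar_mx.
  by rewrite -!scalemxAl.
have rE : E0^T *m B0 *m (b *m a) = e *: (L *m (E0^T *m B0)).
  have h : E0^T *m B0 *m b = e *: (L *m (E1^T *m B1)).
    by rewrite /b -scalemxAr mulmxDr !mulmxA EE0 EF0 !mul0mx addr0 mul1mx.
  rewrite mulmxA h /a -scalemxAl -mulmxA mulmxDr !mulmxA EE1 EF1 !mul0mx add0r mul1mx.
  by rewrite !mulmxA.
exists a, b; split.
  have aT : a^T = e *: (B0 *m (F0 *m L *m E1^T + E0 *m F1^T)).
    rewrite (_ : a^T = (E1 *m L *m F0^T *m B0)^T + (F1 *m E0^T *m B0)^T); last first.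
      by apply/matrixP => i j; rewrite !mxE.
    by rewrite !trmx_mul !trmxK LT B0T -!scalemxAl mulmxDr scalerDr !mulmxA.
  rewrite aT /b -scalemxAr -scalemxAl; congr (_ *: _).
  by rewrite [in RHS]mulmxDr [in RHS]mulmxDl [in LHS]mulmxDr !mulmxA.
have eigF (i : 'I_k) : eigenvalue (b *m a) (- e * i.+1%:R).
  apply/eigenvalueP; exists (row i (F0^T *m B0)).
    rewrite -row_mul rF linearZ /= row_mul row_diag_mx mxE -scalemxAl -rowE scalerA.
    by [].
  apply/eqP => /(congr1 (mulmx^~ E0)); rewrite -row_mul FE0 mul0mx => /rowP/(_ i).
  by rewrite !mxE eqxx mulr1n => e0; have := ee; rewrite e0 mul0r => /eqP; rewrite eq_sym oner_eq0.
have eigE (i : 'I_k) : eigenvalue (b *m a) (e * i.+1%:R).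
  apply/eigenvalueP; exists (row i (E0^T *m B0)).
    rewrite -row_mul rE linearZ /= row_mul row_diag_mx mxE -scalemxAl -rowE scalerA.
    by [].
  apply/eqP => /(congr1 (mulmx^~ F0)); rewrite -row_mul EF0 mul0mx => /rowP/(_ i).
  by rewrite !mxE eqxx => /eqP; rewrite oner_eq0.
have lt_k i : i \in iota 0 k -> (i < k)%N by rewrite mem_iota add0n.
move=> r; rewrite mem_cat => /orP[] /mapP[i /lt_k ik ->]; case: e1 => ee1.
- by have := eigE (Ordinal ik); rewrite ee1 mul1r.
- by have := eigF (Ordinal ik); rewrite ee1 opprK mul1r.
- by have := eigF (Ordinal ik); rewrite ee1 mulN1r.
- by have := eigE (Ordinal ik); rewrite ee1 mulN1r.
Qed.

Lemma size_signed_range k : size (signed_range k) = (k + k)%N.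
Proof. by rewrite size_cat !size_map !size_iota. Qed.

Lemma osp_point_even N0 N1 (e : C) (B0 : 'M[C]_N0) (B1 : 'M[C]_N1) :
    e = 1 \/ e = -1 ->
    B0^T = e *: B0 -> B1^T = - e *: B1 -> B0 \in unitmx -> B1 \in unitmx ->
    ~~ odd N0 -> (N0 <= N1)%N ->
  exists a b, [/\ B0 *m b = a^T *m B1, simple_spectrum (b *m a) & \det (b *m a) != 0].
Proof.
move=> e1 B0T B1T B0u B1u ev le.
have NE : (N0./2 + N0./2)%N = N0 by rewrite addnn even_halfK.
have [| |a [b [ab eig]]] := @osp_eigenvalues _ _ e B0 B1 N0./2 e1 B0T B1T B0u B1u.
  by rewrite NE. by rewrite NE.
exists a, b; have /andP[n0 un] := signed_range_uniq N0./2.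
have [|h1 h2] := separable_eigenvalues un _ eig; first by rewrite size_signed_range.
by split => //; apply: h2.
Qed.

(** For N0 odd the square b a is skew, whence the missing eigenvalue 0. *)
Lemma osp_point_odd N0 N1 (B0 : 'M[C]_N0) (B1 : 'M[C]_N1) :
    B0^T = B0 -> B1^T = - B1 -> B0 \in unitmx -> B1 \in unitmx ->
    odd N0 -> (N0 <= N1)%N ->
  exists a b, B0 *m b = a^T *m B1 /\ simple_spectrum (b *m a).
Proof.
move=> B0T B1T B0u B1u od le.
have NE : (N0./2 + N0./2).+1 = N0 by rewrite addnn -[RHS]odd_double_half od.
have le0 : (N0./2 + N0./2 <= N0)%N by rewrite -[leqRHS]NE.
have [||a [b [ab eig]]] := osp_eigenvalues (or_introl erefl) _ _ B0u B1u le0 (leq_trans le0 le).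
- by rewrite scale1r.
- by rewrite scaleN1r.
exists a, b; split => //.
have det0 : \det (a^T *m B1 *m a) = 0.
  apply: det_skew_odd; rewrite ?pnatr_eq0 //.
  by rewrite bilinear_tr B1T mulmxN mulNmx.
have un := signed_range_uniq N0./2.
have [||//] := @separable_eigenvalues _ (b *m a) _ un.
  by rewrite /= size_signed_range.
move=> r; rewrite inE => /orP[/eqP->|]; last exact: eig.
rewrite eigenvalue_root_char /root horner_coef0 char_poly_det.
rewrite -ab -mulmxA det_mulmx in det0; move/eqP: det0; rewrite mulf_eq0.
by rewrite -[\det B0 == 0]negbK -unitfE -unitmxE B0u /= => /eqP ->; rewrite mulr0.
Qed.

(** Without a relation between a and b, take b a = diag(1, 2, ..). *)
Lemma gl_point N0 N1 : (N0 <= N1)%N -> exists (a : 'M[C]_(N1, N0)) (b : 'M[C]_(N0, N1)),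
  simple_spectrum (b *m a) /\ \det (b *m a) != 0.
Proof.
move=> le; pose D : 'M[C]_N0 := diag_mx (\row_i (i.+1%:R : C)).
exists (pid_mx N0), (D *m pid_mx N0).
rewrite -mulmxA mul_pid_mx minnn (minn_idPr le) pid_mx_1 mulmx1.
pose rs := [seq (i.+1%:R : C) | i <- iota 0 N0].
have urs : uniq rs.
  by rewrite map_inj_uniq ?iota_uniq // => i j /eqP; rewrite eqr_nat => /eqP[].
have [|r|h1 h2] := @separable_eigenvalues _ D rs urs; first by rewrite size_map size_iota.
  case/mapP => i; rewrite mem_iota add0n => /= iN ->.
  apply/eigenvalueP; exists (delta_mx 0 (Ordinal iN)).
    by rewrite -rowE row_diag_mx mxE.
  by apply/eqP => /rowP/(_ (Ordinal iN)); rewrite !mxE !eqxx => /eqP; rewrite oner_eq0.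
split=> //; apply: h2; apply/mapP => -[i _ /eqP]; by rewrite eq_sym pnatr_eq0.
Qed.

End ComplexPoints.

(** * Orthosymplectic elements with V_0 of odd dimension *)

Section OspDefs.
Variable (K : comNzRingType) (m' n : nat).
Local Notation m := m'.+1.
Variables (Z : 'M[K]_m) (B1 : 'M[K]_n).

(** With Z = B0^-1 this is the adjoint b of a, in the form B0 b = a^T B1. The
    inverse Z is the parameter, rather than B0, so that the constructions of
    this section make sense over rings of polynomials, where a varies on a
    line. *)
Definition osp_adjoint (a : 'M[K]_(n, m)) : 'M[K]_(m, n) := Z *m a^T *m B1.

Definition osp_square a := osp_adjoint a *m a.

(** For A = b a the constant term of the characteristic polynomial vanishes, so
    that this is the cofactor p of 'X in it. *)
Definition reduced_char_poly (A : 'M[K]_m) := drop_poly 1 (char_poly A).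

(** A p(A) = 0: if p(0) is invertible, p(A) / p(0) projects on the kernel of
    A. *)
Definition kernel_proj (A : 'M[K]_m) := horner_mx A (reduced_char_poly A).

(** The multiple by p(0) of the semisimple part a (1 - p(A) / p(0)) defined
    below. Unlike the latter it is polynomial in a, so that genericity
    arguments apply to it. *)
Definition osp_core a :=
  a *m (((reduced_char_poly (osp_square a))`_0)%:M - kernel_proj (osp_square a)).

Definition osp_odd a : 'M[K]_(m + n) := block_mx 0 (osp_adjoint a) a 0.

End OspDefs.

Section Map.
Variables (K L : comNzRingType) (f : {rmorphism K -> L}) (m' n : nat).
Local Notation m := m'.+1.
Variables (Z : 'M[K]_m) (B1 : 'M[K]_n) (a : 'M[K]_(n, m)).

Lemma map_osp_adjoint :
  map_mx f (osp_adjoint Z B1 a) = osp_adjoint (map_mx f Z) (map_mx f B1) (map_mx f a).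
Proof. by rewrite !map_mxM -map_trmx. Qed.

Lemma map_osp_square :
  map_mx f (osp_square Z B1 a) = osp_square (map_mx f Z) (map_mx f B1) (map_mx f a).
Proof. by rewrite map_mxM map_osp_adjoint. Qed.

Lemma map_osp_odd :
  map_mx f (osp_odd Z B1 a) = osp_odd (map_mx f Z) (map_mx f B1) (map_mx f a).
Proof. by rewrite map_block_mx !map_mx0 map_osp_adjoint. Qed.

Lemma map_reduced_char_poly (A : 'M[K]_m) :
  map_poly f (reduced_char_poly A) = reduced_char_poly (map_mx f A).
Proof.
by apply/polyP => i; rewrite coef_map !coef_drop_poly -map_char_poly coef_map.
Qed.

Lemma map_osp_core :
  map_mx f (osp_core Z B1 a) = osp_core (map_mx f Z) (map_mx f B1) (map_mx f a).
Proof.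
rewrite /osp_core /kernel_proj map_mxM map_mxB map_scalar_mx map_horner_mx.
by rewrite -map_osp_square -!map_reduced_char_poly coef_map.
Qed.
End Map.

Section Osp.
Variable (K : fieldType).
Hypothesis nz2 : 2%:R != 0 :> K.
Variables (m' n : nat).
Local Notation m := m'.+1.
Hypothesis ev_m' : ~~ odd m'.
Variables (B0 : 'M[K]_m) (B1 : 'M[K]_n).
Hypothesis B0T : B0^T = B0.
Hypothesis B1T : B1^T = - B1.
Hypothesis B0u : B0 \in unitmx.
Hypothesis B1u : B1 \in unitmx.
Local Notation Z := (invmx B0).
Local Notation star := (osp_adjoint Z B1).
Local Notation gram := (osp_square Z B1).
Local Notation core := (osp_core Z B1).
Local Notation oddm := (osp_odd Z B1).
Implicit Types (a : 'M[K]_(n, m)).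

Lemma form_osp_adjoint a : B0 *m star a = a^T *m B1.
Proof. by rewrite /osp_adjoint !mulmxA mulmxV // mul1mx. Qed.

Lemma form_osp_square a : B0 *m gram a = a^T *m B1 *m a.
Proof. by rewrite mulmxA form_osp_adjoint. Qed.

Lemma osp_square_tr a : (gram a)^T *m B0 = - (B0 *m gram a).
Proof.
have -> : (gram a)^T *m B0 = (B0 *m gram a)^T by rewrite [RHS]trmx_mul B0T.
by rewrite form_osp_square bilinear_tr B1T mulmxN mulNmx.
Qed.

(** B0 A is a skew matrix of odd size. *)
Lemma det_osp_square a : \det (gram a) = 0.
Proof.
have : \det (B0 *m gram a) = 0.
  apply: det_skew_odd; rewrite /= ?ev_m' //.
  by rewrite [(B0 *m _)^T]trmx_mul B0T osp_square_tr.
move/eqP; rewrite det_mulmx mulf_eq0 => /orP[/eqP d0|/eqP //].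
by move: B0u; rewrite unitmxE d0 unitr0.
Qed.

Lemma char_poly_osp_square a : char_poly (gram a) = reduced_char_poly (gram a) * 'X.
Proof.
rewrite -[LHS](poly_take_drop 1) expr1; apply/eqP; rewrite -subr_eq0 addrK; apply/eqP.
apply/polyP => i; rewrite coef_take_poly coef0; case: i => // /=.
by rewrite char_poly_det det_osp_square mulr0.
Qed.

Lemma osp_square_kernel_proj a : gram a *m kernel_proj (gram a) = 0.
Proof.
rewrite -[X in X *m _]horner_mx_X mulmxE -rmorphM /= mulrC -char_poly_osp_square.
exact: Cayley_Hamilton.
Qed.
Lemma kernel_proj_osp_square a : kernel_proj (gram a) *m gram a = 0.
Proof.
rewrite -[X in _ *m X]horner_mx_X mulmxE -rmorphM /= -char_poly_osp_square.
exact: Cayley_Hamilton.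
Qed.

Lemma kernel_proj_ker a p (u : 'M[K]_(m, p)) : gram a *m u = 0 ->
  kernel_proj (gram a) *m u = (reduced_char_poly (gram a))`_0 *: u.
Proof.
move=> Au; rewrite /kernel_proj.
rewrite -[X in horner_mx _ X](poly_take_drop 1) expr1.
rewrite rmorphD rmorphM /= horner_mx_X -mulmxE mulmxDl -mulmxA Au mulmx0 addr0.
have -> : take_poly 1 (reduced_char_poly (gram a)) = ((reduced_char_poly (gram a))`_0)%:P.
  by apply/polyP => -[|i]; rewrite coef_take_poly coefC.
by rewrite horner_mx_C mul_scalar_mx.
Qed.

Lemma kernel_proj_idem a :
  kernel_proj (gram a) *m kernel_proj (gram a) = (reduced_char_poly (gram a))`_0 *: kernel_proj (gram a).
Proof. exact/kernel_proj_ker/osp_square_kernel_proj. Qed.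

Lemma trmx_horner N (A : 'M[K]_N.+1) p : (horner_mx A p)^T = horner_mx A^T p.
Proof.
elim/poly_ind: p => [|p c IH]; first by rewrite !rmorph0 trmx0.
rewrite !rmorphD !rmorphM /= !horner_mx_X !horner_mx_C -!mulmxE.
rewrite linearD /= trmx_mul IH tr_scalar_mx; congr (_ + _).
exact: comm_mx_horner.
Qed.

(** A is conjugate to - A^T by B0, whence chi(- X) = - chi(X) for its
    characteristic polynomial chi = X p. *)
Lemma reduced_char_poly_even a : reduced_char_poly (gram a) \Po - 'X = reduced_char_poly (gram a).
Proof.
suff h : char_poly (gram a) \Po - 'X = - char_poly (gram a).
  have Xnz : ('X : {poly K}) != 0 by rewrite polyX_eq0.
  apply: (mulIf Xnz); apply: oppr_inj.
  rewrite -[in RHS]char_poly_osp_square -h char_poly_osp_square.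
  by rewrite comp_polyM comp_polyX mulrN.
have e : char_poly (gram a) \Po - 'X =
    \det (- ('X%:M + map_mx polyC (gram a))).
  rewrite -[LHS]/(comp_poly (- 'X) (\det _)) -det_map_mx; congr (\det _).
  by apply/matrixP => i j; rewrite !mxE rmorphB rmorphMn /= comp_polyX comp_polyC mulNrn opprD.
rewrite e -scaleN1r detZ -signr_odd /= ev_m' expr1 mulN1r; congr (- _).
have dB : \det (map_mx polyC B0) != 0.
  by rewrite det_map_mx polyC_eq0 -unitfE -unitmxE.
apply: (mulIf dB); rewrite [RHS]mulrC -[\det ('X%:M + _)]det_tr -!det_mulmx; congr (\det _).
rewrite linearD /= tr_scalar_mx map_trmx mulmxDl -map_mxM osp_square_tr mulmxBr.
by rewrite mul_scalar_mx mul_mx_scalar map_mxN map_mxM.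
Qed.

(** The adjoint of p(A) is p(- A) = p(A). *)
Lemma kernel_proj_adjoint a : (kernel_proj (gram a))^T *m B0 = B0 *m kernel_proj (gram a).
Proof.
have gT : (gram a)^T = B0 *m (- gram a) *m Z.
  by rewrite mulmxN -osp_square_tr mulmxK.
have hN : horner_mx (- gram a) (reduced_char_poly (gram a)) = kernel_proj (gram a).
  rewrite /kernel_proj -[in RHS]reduced_char_poly_even.
  elim/poly_ind: (reduced_char_poly (gram a)) => [|p c IH].
    by rewrite comp_poly0 !rmorph0.
  rewrite comp_polyD comp_polyM comp_polyX comp_polyC !rmorphD !rmorphM /= IH.
  by rewrite rmorphN /= !horner_mx_X !horner_mx_C.
by rewrite trmx_horner gT horner_mx_uconj // hN mulmxKV.
Qed.

(** The adjoint of a M is M b for a self-adjoint M. *)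
Lemma osp_adjointMr a (M : 'M[K]_m) : M^T *m B0 = B0 *m M -> star (a *m M) = M *m star a.
Proof.
move=> MT; apply: (can_inj (mulKmx B0u)).
rewrite form_osp_adjoint trmx_mul -mulmxA -form_osp_adjoint.
by rewrite !mulmxA MT.
Qed.

Lemma osp_adjointD a c : star (a + c) = star a + star c.
Proof.
rewrite /osp_adjoint -mulmxDl -mulmxDr; congr (_ *m _ *m _).
by apply/matrixP => i j; rewrite !mxE.
Qed.

Lemma osp_adjointZ k a : star (k *: a) = k *: star a.
Proof.
rewrite /osp_adjoint scalemxAl scalemxAr; congr (_ *m _ *m _).
by apply/matrixP => i j; rewrite !mxE.
Qed.

(** For p(0) <> 0 this is the projection E on the kernel of A along its image;
    x = x_s + x_n, with x_s given by a (1 - E) and x_n by a E, plays the role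
    of a Jordan decomposition. *)
Definition nil_proj (a : 'M[K]_(n, m)) : 'M[K]_m :=
  ((reduced_char_poly (gram a))`_0)^-1 *: kernel_proj (gram a).

Definition semisimple_part a := a *m (1%:M - nil_proj a).

Section Split.
Variable a : 'M[K]_(n, m).
Hypothesis q0 : (reduced_char_poly (gram a))`_0 != 0.
Local Notation E := (nil_proj a).

Lemma osp_coreE : core a = (reduced_char_poly (gram a))`_0 *: semisimple_part a.
Proof.
rewrite /osp_core /semisimple_part /nil_proj scalemxAr; congr (_ *m _).
by rewrite scalerBr scalerA mulfV // scale1r scalemx1.
Qed.

Lemma square_nil_proj : gram a *m E = 0.
Proof. by rewrite -scalemxAr osp_square_kernel_proj scaler0. Qed.
Lemma nil_proj_square : E *m gram a = 0.
Proof. by rewrite -scalemxAl kernel_proj_osp_square scaler0. Qed.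
Lemma nil_proj_idem : E *m E = E.
Proof. by rewrite -scalemxAl -scalemxAr kernel_proj_idem !scalerA -mulrA mulVf // mulr1. Qed.
Lemma nil_proj_adjoint : E^T *m B0 = B0 *m E.
Proof.
rewrite -scalemxAr -kernel_proj_adjoint scalemxAl; congr (_ *m _).
by apply/matrixP => i j; rewrite !mxE.
Qed.
Lemma nil_proj_ker p (u : 'M[K]_(m, p)) : gram a *m u = 0 -> E *m u = u.
Proof. by move=> /kernel_proj_ker h; rewrite -scalemxAl h scalerA mulVf // scale1r. Qed.
Lemma conil_proj_adjoint : (1%:M - E)^T *m B0 = B0 *m (1%:M - E).
Proof.
have -> : (1%:M - E)^T = 1%:M - E^T by apply/matrixP => i j; rewrite !mxE eq_sym.
by rewrite mulmxBl mulmxBr mul1mx mulmx1 nil_proj_adjoint.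
Qed.
Lemma conil_nil_proj : (1%:M - E) *m E = 0.
Proof. by rewrite mulmxBl mul1mx nil_proj_idem subrr. Qed.
Lemma nil_conil_proj : E *m (1%:M - E) = 0.
Proof. by rewrite mulmxBr mulmx1 nil_proj_idem subrr. Qed.
Lemma conil_proj_square : (1%:M - E) *m gram a = gram a.
Proof. by rewrite mulmxBl mul1mx nil_proj_square subr0. Qed.
Lemma square_conil_proj : gram a *m (1%:M - E) = gram a.
Proof. by rewrite mulmxBr mulmx1 square_nil_proj subr0. Qed.
Lemma osp_adjoint_semisimple_part : star (semisimple_part a) = (1%:M - E) *m star a.
Proof. exact: (osp_adjointMr _ conil_proj_adjoint). Qed.
Lemma osp_square_semisimple_part : gram (semisimple_part a) = gram a.
Proof.
by rewrite {1}/osp_square osp_adjoint_semisimple_part mulmxA -(mulmxA _ _ a) conil_proj_square square_conil_proj.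
Qed.
Lemma nil_partE : a - semisimple_part a = a *m E.
Proof. by rewrite /semisimple_part mulmxBr mulmx1 subKr. Qed.
Lemma osp_adjoint_nil : star (a - semisimple_part a) = E *m star a.
Proof. by rewrite nil_partE (osp_adjointMr _ nil_proj_adjoint). Qed.

(** All four products contain E A, A E or E (1 - E). *)
Lemma nil_anticommute :
  oddm (a - semisimple_part a) *m oddm (semisimple_part a) +
  oddm (semisimple_part a) *m oddm (a - semisimple_part a) = 0.
Proof.
rewrite /osp_odd osp_adjoint_nil osp_adjoint_semisimple_part !mulmx_block !mulmx0 !mul0mx !addr0 !add0r.
rewrite nil_partE /semisimple_part.
have h1 : E *m star a *m (a *m (1%:M - E)) = 0.
  by rewrite mulmxA -(mulmxA E) -[star a *m a]/(gram a) nil_proj_square mul0mx.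
have h2 : a *m E *m ((1%:M - E) *m star a) = 0.
  by rewrite mulmxA -(mulmxA a) nil_conil_proj mulmx0 mul0mx.
have h3 : (1%:M - E) *m star a *m (a *m E) = 0.
  by rewrite mulmxA -(mulmxA (1%:M - E)) -[star a *m a]/(gram a) conil_proj_square square_nil_proj.
have h4 : a *m (1%:M - E) *m (E *m star a) = 0.
  by rewrite mulmxA -(mulmxA a) conil_nil_proj mulmx0 mul0mx.
by rewrite h1 h2 h3 h4 block_mx0 addr0.
Qed.

Lemma exists_kernel_vector : exists2 u : 'cV[K]_m, u != 0 & E *m u = u.
Proof.
have [u unz Au] := singular_vector (det_osp_square a).
by exists u => //; exact: nil_proj_ker.
Qed.

(** For E u = u and w in the kernel of b_s, the odd element given by w (u, .)
    anticommutes with x_s; that az anticommutes with all of these forces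
    az E = 0 and star az to vanish on the kernel of b_s. The first of these
    facts needs the kernel of b_s to have dimension at least 2: this is where
    m < n enters, as the rank of b_s is at most m - 1. *)
Lemma double_anticommutant_kernel az : (m < n)%N ->
    (forall al, oddm al *m oddm (semisimple_part a) + oddm (semisimple_part a) *m oddm al = 0 ->
      oddm az *m oddm al + oddm al *m oddm az = 0) ->
  oddm az *m oddm (a - semisimple_part a) = 0.
Proof.
move=> mn anti.
have [u0 u0nz Eu0] := exists_kernel_vector.
pose bs := star (semisimple_part a).
have bsE : bs = (1%:M - E) *m star a by exact: osp_adjoint_semisimple_part.
have anti_uw (u : 'cV[K]_m) (w : 'cV[K]_n) : E *m u = u -> bs *m w = 0 ->
  star az *m w *m (u^T *m B0) + u *m w^T *m B1 *m az = 0 /\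
  az *m u *m w^T *m B1 + w *m (u^T *m B0 *m star az) = 0.
  move=> Eu bsw.
  have sal : star (w *m (u^T *m B0)) = u *m w^T *m B1.
    by rewrite /osp_adjoint trmx_mul trmx_mul trmxK B0T !mulmxA mulVmx // mul1mx.
  have wss : w^T *m B1 *m semisimple_part a = 0.
    apply: trmx_inj; rewrite bilinear_tr B1T mulmxN mulNmx.
    by rewrite -form_osp_adjoint -mulmxA bsw mulmx0 oppr0 trmx0.
  have ubs : u^T *m B0 *m bs = 0.
    have -> : u^T *m B0 = u^T *m E^T *m B0 by rewrite -trmx_mul Eu.
    rewrite -(mulmxA u^T E^T) nil_proj_adjoint bsE !mulmxA -(mulmxA _ E (1%:M - E)).
    by rewrite nil_conil_proj mulmx0 !mul0mx.
  have ssu : semisimple_part a *m u = 0.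
    by rewrite /semisimple_part -mulmxA mulmxBl mul1mx Eu subrr mulmx0.
  have := anti (w *m (u^T *m B0)).
  rewrite /osp_odd !mulmx_block !mul0mx !mulmx0 !addr0 !add0r !add_block_mx !addr0.
  rewrite sal -/bs => h.
  have /h : block_mx (u *m w^T *m B1 *m semisimple_part a + bs *m (w *m (u^T *m B0))) 0 0
      (w *m (u^T *m B0) *m bs + semisimple_part a *m (u *m w^T *m B1)) = 0.
    have e1 : u *m w^T *m B1 *m semisimple_part a = u *m (w^T *m B1 *m semisimple_part a).
      by rewrite !mulmxA.
    have e4 : semisimple_part a *m (u *m w^T *m B1) = (semisimple_part a *m u) *m (w^T *m B1).
      by rewrite !mulmxA.
    rewrite e1 e4 wss ssu mulmx0 mul0mx add0r addr0 -(mulmxA w) ubs mulmx0.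
    by rewrite (mulmxA bs) bsw mul0mx block_mx0.
  move=> /eqP; rewrite block_mx_eq0 => /and4P[/eqP e1 _ _ /eqP e2].
  by split; [apply: etrans e1 | apply: etrans e2]; congr (_ + _); rewrite ?mulmxA.
have azE (v : 'cV[K]_m) : az *m (E *m v) = 0.
  apply/eqP; apply: contraT => nz.
  have [r rE] := dual_covector nz.
  have rkbs : (\rank bs < m)%N.
    rewrite bsE; apply: leq_ltn_trans (mxrankM_maxl _ _) _.
    rewrite ltn_neqAle rank_leq_row andbT -[_ == _]/(row_free _) row_free_unit.
    apply: contra u0nz => un; rewrite -[u0](mulKmx un) mulmxBl mul1mx Eu0 subrr mulmx0 //.
  (* w is found in the intersection of the kernel of bs with that of r. *)
  have [|w wnz] := null_vector (col_mx (row_base bs) r).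
    by apply: leq_ltn_trans mn; rewrite addn1.
  rewrite mul_col_mx -col_mx0 => /eq_col_mx[bw rw].
  have bsw : bs *m w = 0 by rewrite -[bs]mulmx_base -mulmxA bw mulmx0.
  have [_ h] := anti_uw (E *m v) w (etrans (mulmxA _ _ _) (congr1 (mulmx^~ v) nil_proj_idem)) bsw.
  have [w' ww'] := form_dual_vector B1u wnz.
  have := congr1 (fun z => r *m z *m w') h.
  rewrite mulmxDr mulmxDl !mulmxA rw !mul0mx addr0 mulmx0 mul0mx -!(mulmxA r) -!(mulmxA az).
  rewrite !mulmxA -(mulmxA _ w^T) -(mulmxA _ _ w') ww' mulmx1 -!mulmxA rE.
  by move=> /matrixP/(_ 0 0); rewrite !mxE => /eqP; rewrite oner_eq0.
have azE0 : az *m E = 0.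
  apply/matrixP => i j; have := azE (delta_mx j 0); rewrite mulmxA -colE => /matrixP/(_ i 0).
  by rewrite !mxE.
have bzw (w : 'cV[K]_n) : bs *m w = 0 -> star az *m w = 0.
  move=> bsw.
  have [v uv] := form_dual_vector B0u u0nz.
  have [h _] := anti_uw _ _ Eu0 bsw.
  have := congr1 (fun z => z *m (E *m v)) h.
  rewrite mulmxDl mul0mx -(mulmxA _ az) azE mulmx0 addr0 -(mulmxA _ _ (E *m v)).
  have -> : u0^T *m B0 *m (E *m v) = 1%:M.
    by rewrite mulmxA -(mulmxA _ B0) -nil_proj_adjoint mulmxA -trmx_mul Eu0.
  by rewrite mulmx1.
have bzn : star az *m (a *m E) = 0.
  have bsn : bs *m (a *m E) = 0.
    rewrite bsE mulmxA -(mulmxA (1%:M - E)) -[star a *m a]/(gram a).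
    by rewrite conil_proj_square square_nil_proj.
  apply/matrixP => i j; have := bzw (a *m E *m delta_mx j 0).
  rewrite (mulmxA bs) bsn mul0mx (mulmxA (star az)) -colE => /(_ erefl)/matrixP/(_ i 0).
  by rewrite [LHS]mxE => ->; rewrite !mxE.
rewrite /osp_odd osp_adjoint_nil nil_partE mulmx_block !mul0mx !mulmx0 !addr0 !add0r.
by rewrite bzn mulmxA azE0 mul0mx block_mx0.
Qed.

End Split.

End Osp.

(** * Semisimplicity of orthosymplectic elements *)

Section OspSemisimple.
Variables (K : fieldType) (C : numClosedFieldType) (f : {rmorphism K -> C}).
Hypothesis nz2 : 2%:R != 0 :> K.
Variables (m' n : nat).
Local Notation m := m'.+1.
Hypothesis ev_m' : ~~ odd m'.
Variables (B0 : 'M[K]_m) (B1 : 'M[K]_n).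
Hypothesis B0T : B0^T = B0.
Hypothesis B1T : B1^T = - B1.
Hypothesis B0u : B0 \in unitmx.
Hypothesis B1u : B1 \in unitmx.
Local Notation Z := (invmx B0).
Local Notation star := (osp_adjoint Z B1).
Local Notation gram := (osp_square Z B1).
Local Notation core := (osp_core Z B1).
Local Notation oddm := (osp_odd Z B1).
Implicit Types (a : 'M[K]_(n, m)).
Local Notation ss := (semisimple_part B0 B1).

(** K is meant to be the real or the complex field, and f its embedding in C. *)
Definition complex_semisimple N (x : 'M[K]_N) := diagonalizable (map_mx f x).

Lemma simple_osp_square a : simple_spectrum (map_mx f (gram a)) ->
  [/\ (reduced_char_poly (gram a))`_0 != 0,
      separable_poly (map_poly f (reduced_char_poly (gram a))) &
    reduced_char_poly (gram a) \is monic].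
Proof.
rewrite /simple_spectrum -map_char_poly char_poly_osp_square // rmorphM /= map_polyX.
rewrite separable_mul => /and3P[sq _ cop]; split => //.
  by move: cop; rewrite coprimepX /root horner_coef0 coef_map fmorph_eq0.
have := char_poly_monic (gram a); rewrite char_poly_osp_square //.
by rewrite monicMr ?monicX.
Qed.

(** x_s is killed by 'X p('X^2), since a_s p(A) = p(0) a (1 - E) E = 0. *)
Lemma semisimple_partP a : simple_spectrum (map_mx f (gram a)) -> complex_semisimple (oddm (ss a)).
Proof.
move=> /simple_osp_square[q0 sq mq].
rewrite /complex_semisimple map_block_mx !map_mx0 block_odd.
have g : map_mx f (star (ss a)) *m map_mx f (ss a) = map_mx f (gram a).
  by rewrite -map_mxM -[X in map_mx f X]/(gram (ss a)) osp_square_semisimple_part.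
apply: (@odd_diagonalizable _ _ m' n _ (col_mx 1%:M 0) (row_mx 1%:M 0)
  (col_mx 0 1%:M) (row_mx 0 1%:M)
  (map_mx f (ss a)) (map_mx f (star (ss a))) (map_poly f (reduced_char_poly (gram a)))).
- by rewrite mul_row_col mul1mx mul0mx addr0.
- by rewrite mul_row_col mulmx0 mul0mx addr0.
- by rewrite mul_row_col mulmx0 mul0mx addr0.
- by rewrite mul_row_col mul1mx mul0mx add0r.
- by [].
- by rewrite map_monic.
- exact: sq.
- by rewrite horner_coef0 coef_map fmorph_eq0.
- rewrite g -map_horner_mx -map_mxM -[horner_mx _ _]/(kernel_proj (gram a)).
  have -> : kernel_proj (gram a) = (reduced_char_poly (gram a))`_0 *: nil_proj B0 B1 a.
    by rewrite /nil_proj scalerA mulfV // scale1r.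
  by rewrite /semisimple_part -scalemxAr -mulmxA conil_nil_proj // mulmx0 scaler0 map_mx0.
- rewrite g -map_horner_mx -map_mxM -[horner_mx _ _]/(kernel_proj (gram a)).
  have -> : kernel_proj (gram a) = (reduced_char_poly (gram a))`_0 *: nil_proj B0 B1 a.
    by rewrite /nil_proj scalerA mulfV // scale1r.
  by rewrite osp_adjoint_semisimple_part // -scalemxAl mulmxA nil_conil_proj // mul0mx scaler0 map_mx0.
Qed.

Lemma diagonalizable_ker2 N p (X : 'M[C]_N) (w : 'M[C]_(N, p)) :
  diagonalizable X -> X *m (X *m w) = 0 -> X *m w = 0.
Proof.
case=> P Pu /(diagonalizable_forLR Pu)[d XE].
have {XE}-> : X = invmx P *m diag_mx d *m P by rewrite XE; exact: conjVmx.
move=> h.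
have h2 : diag_mx d *m (diag_mx d *m (P *m w)) = 0.
  move: h; rewrite -!mulmxA (mulmxA P (invmx P)) mulmxV // mul1mx => /(congr1 (mulmx P)).
  by rewrite mulKVmx // mulmx0.
rewrite -!mulmxA; have -> : diag_mx d *m (P *m w) = 0; last by rewrite mulmx0.
move: h2; move: (P *m w) => v /matrixP h2; apply/matrixP => i j.
have := h2 i j; rewrite !mul_diag_mx !mxE => /eqP; rewrite !mulf_eq0.
by case/or3P => /eqP ->; rewrite ?mul0r ?mulr0.
Qed.

Lemma semisimple_ker2 N p (x : 'M[K]_N) (w : 'M[K]_(N, p)) :
  complex_semisimple x -> x *m (x *m w) = 0 -> x *m w = 0.
Proof.
move=> sx h; apply/eqP; rewrite -(map_mx_eq0 f) map_mxM; apply/eqP.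
by apply: diagonalizable_ker2 => //; rewrite -!map_mxM h map_mx0.
Qed.

Lemma osp_odd_col a p (v : 'M[K]_(m, p)) (w : 'M[K]_(n, p)) :
  oddm a *m col_mx v w = col_mx (star a *m w) (a *m v).
Proof. by rewrite mul_block_col !mul0mx addr0 add0r. Qed.

Lemma semisimple_kernel a p (v : 'M[K]_(m, p)) :
  complex_semisimple (oddm a) -> gram a *m v = 0 -> a *m v = 0.
Proof.
move=> sx Av; have := @semisimple_ker2 _ _ _ (col_mx v 0) sx.
rewrite !osp_odd_col !mulmx0 mulmxA -[star a *m a]/(gram a) Av col_mx0 => /(_ erefl).
by rewrite -col_mx0 => /eq_col_mx[].
Qed.

Lemma semisimple_square_ker2 a p (v : 'M[K]_(m, p)) : complex_semisimple (oddm a) ->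
  gram a *m (gram a *m v) = 0 -> gram a *m v = 0.
Proof.
move=> sx /(semisimple_kernel sx) h.
have e w : oddm a *m (oddm a *m (col_mx w (0 : 'M[K]_(n, p)))) = col_mx (gram a *m w) 0.
  by rewrite !osp_odd_col !mulmx0 mulmxA.
have h2 : oddm a *m (oddm a *m (oddm a *m col_mx v (0 : 'M[K]_(n, p)))) = 0.
  by rewrite e osp_odd_col h mulmx0 col_mx0.
have := semisimple_ker2 sx h2; rewrite e -col_mx0 => /eq_col_mx[]//.
Qed.

(** If a has no anisotropic vector in its kernel, which is also that of A, then
    a nonzero u in this kernel is orthogonal to it, hence is some A v; but then
    A A v = 0 and semisimplicity gives u = A v = 0. *)
Lemma semisimple_anisotropic_kernel a : complex_semisimple (oddm a) ->
  exists u : 'cV[K]_m, a *m u = 0 /\ u^T *m B0 *m u != 0.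
Proof.
move=> sx.
have [[u [au uu]]|none] :=
  pselect (exists u : 'cV[K]_m, a *m u = 0 /\ u^T *m B0 *m u != 0).
  by exists u.
have iso (u : 'cV[K]_m) : a *m u = 0 -> u^T *m B0 *m u = 0.
  by move=> au; apply/eqP; apply/negPn/negP => h; apply: none; exists u.
have [u unz Au] := singular_vector (det_osp_square nz2 ev_m' B0T B1T B0u a).
(* Without such a vector the form vanishes on the kernel of A, by polarization. *)
have orth (w : 'cV[K]_m) : gram a *m w = 0 -> u^T *m B0 *m w = 0.
  move=> Aw; have au := semisimple_kernel sx Au; have aw := semisimple_kernel sx Aw.
  have := iso (u + w); rewrite mulmxDr au aw addr0 => /(_ erefl).
  have -> : (u + w)^T = u^T + w^T by apply/matrixP => i j; rewrite !mxE.
  rewrite !mulmxDl !mulmxDr (iso u) // (iso w) // addr0 add0r.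
  have -> : w^T *m B0 *m u = u^T *m B0 *m w.
    have t : (u^T *m B0 *m w)^T = u^T *m B0 *m w by apply/matrixP => i j; rewrite !ord1 mxE.
    by rewrite -t bilinear_tr B0T.
  by rewrite -mulr2n -scaler_nat => /eqP; rewrite scaler_eq0 (negPf nz2) => /eqP.
(* The orthogonal of the kernel of A is its image, since A is skew-adjoint. *)
have /submxP[r rE] : (u^T *m B0 <= gram a)%MS.
  rewrite submxE; apply/eqP/matrixP => i j; rewrite ord1.
  have := orth (cokermx (gram a) *m delta_mx j 0).
  rewrite (mulmxA (gram a)) mulmx_coker mul0mx => /(_ erefl).
  rewrite mulmxA -colE => /matrixP/(_ 0 0).
  by rewrite [LHS]mxE => ->; rewrite !mxE.
have uE : u = gram a *m (- (Z *m r^T)).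
  apply: (can_inj (mulKmx B0u)); have := congr1 trmx rE.
  rewrite (trmx_mul r) (trmx_mul u^T) trmxK B0T => ->.
  have -> : (gram a)^T = - (B0 *m gram a *m Z) by rewrite -mulNmx -osp_square_tr // mulmxK.
  by rewrite !mulmxN mulNmx !mulmxA.
have : gram a *m (gram a *m (- (Z *m r^T))) = 0 by rewrite -uE.
by move=> /(semisimple_square_ker2 sx); rewrite -uE => u0; rewrite u0 eqxx in unz.
Qed.

End OspSemisimple.

(** * Elements killing an anisotropic vector *)

Section Similar.
Variable K : fieldType.

Lemma char_poly_similar N (A D M : 'M[K]_N) : M \in unitmx -> A *m M = M *m D ->
  char_poly A = char_poly D.
Proof.
move=> Mu h; have dM : \det (map_mx polyC M) != 0.
  by rewrite det_map_mx polyC_eq0 -unitfE -unitmxE.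
apply: (mulIf dM); rewrite [RHS]mulrC -!det_mulmx; congr (\det _).
rewrite mulmxBl mulmxBr -!map_mxM h; congr (_ - _).
by rewrite mul_scalar_mx mul_mx_scalar.
Qed.

Lemma horner_block_diag p q (A : 'M[K]_p.+1) (B : 'M[K]_q.+1) r :
  horner_mx (block_mx A 0 0 B : 'M[K]_((p + q.+1).+1)) r =
  block_mx (horner_mx A r) 0 0 (horner_mx B r).
Proof.
elim/poly_ind: r => [|r c IH]; first by rewrite !rmorph0 block_mx0.
rewrite !rmorphD !rmorphM /= !horner_mx_X !horner_mx_C IH -!mulmxE.
rewrite [X in _ + X = _](scalar_mx_block p.+1 q.+1 c).
have hM : (block_mx (horner_mx A r) 0 0 (horner_mx B r) : 'M[K]_(p.+1 + q.+1)) *m block_mx A 0 0 B =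
    block_mx (horner_mx A r *m A) 0 0 (horner_mx B r *m B).
  by rewrite mulmx_block !mulmx0 !mul0mx !addr0 !add0r.
transitivity ((block_mx (horner_mx A r *m A) 0 0 (horner_mx B r *m B) : 'M[K]_(p.+1 + q.+1)) +
  block_mx c%:M 0 0 c%:M); first exact: (congr1 (fun z => z + _) hM).
by rewrite add_block_mx !addr0.
Qed.

(** A nondegenerate subspace of prescribed even dimension: columns of hyperbolic
    pairs. *)
Lemma symplectic_frame n (B1 : 'M[K]_n) p : 2%:R != 0 :> K ->
    B1^T = - B1 -> B1 \in unitmx -> ~~ odd p -> (p <= n)%N ->
  exists H : 'M[K]_(n, p), H^T *m B1 *m H \in unitmx.
Proof.
move=> nz2 BT Bu ep; have {ep} -> : p = (p./2 + p./2)%N by rewrite addnn even_halfK.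
move: p./2 => k kn.
have [E [F [EE FF EF]]] := hyperbolic_skew nz2 BT Bu kn.
have FE : F^T *m B1 *m E = - 1%:M.
  by rewrite -[LHS]trmxK bilinear_tr BT mulmxN mulNmx EF linearN /= trmx1.
exists (row_mx E F); rewrite tr_row_mx mul_col_mx mul_col_row EE FF EF FE.
have : block_mx 0 1%:M (- 1%:M) 0 *m block_mx 0 (- 1%:M) 1%:M 0 = 1%:M :> 'M[K]_(k + k).
  rewrite mulmx_block !mul0mx !mulmx0 !mul1mx !addr0 !add0r mulmxN mulmx1 opprK.
  by rewrite -scalar_mx_block.
by case/mulmx1_unit.
Qed.
End Similar.

Section Degenerate.
Variable (K : fieldType).
Hypothesis nz2 : 2%:R != 0 :> K.
Variables (m'' n : nat).
Local Notation m' := m''.+1.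
Local Notation m := m'.+1.
Hypothesis ev_m' : ~~ odd m'.
Hypothesis mn : (m' <= n)%N.
Variables (B0 : 'M[K]_m) (B1 : 'M[K]_n).
Hypothesis B0T : B0^T = B0.
Hypothesis B1T : B1^T = - B1.
Hypothesis B0u : B0 \in unitmx.
Hypothesis B1u : B1 \in unitmx.
Local Notation Z := (invmx B0).
Local Notation star := (osp_adjoint Z B1).
Local Notation gram := (osp_square Z B1).
Local Notation core := (osp_core Z B1).
Variable u : 'cV[K]_m.
Hypothesis nu : u^T *m B0 *m u != 0.

(** The orthogonal of the anisotropic vector u is a complement of its line. *)
Lemma orthogonal_frame : exists P : 'M[K]_(m, m'),
  (row_mx u P : 'M[K]_(m, 1 + m')) \in unitmx /\ u^T *m B0 *m P = 0.
Proof.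
pose r := u^T *m B0.
have rnz : r != 0 by apply: contra_neq nu => r0; rewrite -/r r0 mul0mx.
have [P' [P'f P'r]] : exists P' : 'M[K]_(m', m), row_free P' /\ P' *m r^T = 0.
  have rk : \rank (kermx r^T) = m'.
    by rewrite mxrank_ker mxrank_tr rank_rV rnz subn1.
  have : exists P' : 'M[K]_(\rank (kermx r^T), m), row_free P' /\ P' *m r^T = 0.
    exists (row_base (kermx r^T)); rewrite row_base_free; split => //.
    by apply/sub_kermxP; rewrite eq_row_base.
  by rewrite rk.
exists P'^T; split; last first.
  by apply: trmx_inj; rewrite trmx_mul trmxK P'r trmx0.
have trM : (row_mx u P'^T : 'M[K]_(m, 1 + m'))^T = col_mx u^T P' by rewrite tr_row_mx trmxK.
suff : ((row_mx u P'^T : 'M[K]_(m, 1 + m'))^T : 'M[K]_m) \in unitmx by rewrite unitmx_tr.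
rewrite trM -row_free_unit.
apply: (@inj_row_free _ (1 + m') m) => v; rewrite -[v]hsubmxK mul_row_col => h.
have ru : u^T *m r^T != 0.
  by apply: contra_neq nu => h0; rewrite -/r -[LHS]trmxK trmx_mul h0 trmx0.
have s0 : lsubmx v = 0.
  have := congr1 (mulmx^~ r^T) h; rewrite mulmxDl -!mulmxA P'r mulmx0 addr0 mul0mx.
  rewrite [u^T *m r^T]mx11_scalar mul_mx_scalar => /eqP; rewrite scaler_eq0 => /orP[/eqP z|/eqP //].
  by move: ru; rewrite [u^T *m r^T]mx11_scalar z raddf0 eqxx.
move: h; rewrite s0 mul0mx add0r => h.
suff -> : rsubmx v = 0 by rewrite row_mx0.
by apply: (row_free_inj P'f); rewrite h mul0mx.
Qed.

(** In a frame adapted to the decomposition of V_0 into the line of u and its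
    orthogonal, on which the form has Gram matrix G, the element a amounts to
    its restriction c to the latter, and A to the square of c. *)
Lemma degenerate_conj (P : 'M[K]_(m, m')) (c : 'M[K]_(n, m')) (a : 'M[K]_(n, m)) :
    (row_mx u P : 'M[K]_(m, 1 + m')) \in unitmx -> u^T *m B0 *m P = 0 ->
    a *m (row_mx u P : 'M[K]_(m, 1 + m')) = row_mx 0 c ->
  exists G : 'M[K]_m', G \in unitmx /\
    gram a *m row_mx u P = row_mx u P *m (block_mx 0 0 0 (invmx G *m (c^T *m B1 *m c)) : 'M[K]_(1 + m')).
Proof.
move=> Mu uP ac; pose M : 'M[K]_m := row_mx u P; pose G := P^T *m B0 *m P.
have Pu : P^T *m B0 *m u = 0 by apply: trmx_inj; rewrite bilinear_tr B0T uP trmx0.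
pose Ms : 'M[K]_(m, 1 + m') := row_mx u P.
have MsE : Ms^T *m B0 *m Ms = block_mx (u^T *m B0 *m u) 0 0 G.
  by rewrite /Ms tr_row_mx mul_col_mx mul_col_row uP Pu.
have MM : M^T *m B0 *m M = (block_mx (u^T *m B0 *m u) 0 0 G : 'M[K]_(1 + m')) := MsE.
have Gu : G \in unitmx.
  have : M^T *m B0 *m M \in unitmx by rewrite !unitmx_mul unitmx_tr [M \in _]Mu B0u.
  rewrite MM unitmxE => dG.
  have : \det (u^T *m B0 *m u) * \det G \is a GRing.unit.
    by rewrite -(det_ublock _ 0 G).
  by rewrite unitrM unitmxE => /andP[].
exists G; split => //.
have MB : M^T *m B0 \in unitmx by rewrite unitmx_mul unitmx_tr [M \in _]Mu B0u.
apply: (can_inj (mulKmx MB)); rewrite -[row_mx u P]/M.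
have rhs : (block_mx (u^T *m B0 *m u) 0 0 G : 'M[K]_(1 + m')) *m
    (block_mx 0 0 0 (invmx G *m (c^T *m B1 *m c)) : 'M[K]_(1 + m')) =
    block_mx 0 0 0 (c^T *m B1 *m c).
  by rewrite mulmx_block !mul0mx !mulmx0 !addr0 add0r mulKVmx.
have acs : a *m Ms = row_mx 0 c := ac.
have lhs : M^T *m B0 *m (gram a *m M) = (a *m M)^T *m B1 *m (a *m M).
  by rewrite -mulmxA (mulmxA B0) form_osp_square // trmx_mul !mulmxA.
have lhs2 : (a *m Ms)^T *m B1 *m (a *m Ms) = block_mx 0 0 0 (c^T *m B1 *m c).
  by rewrite acs tr_row_mx trmx0 mul_col_mx mul_col_row !mul0mx !mulmx0.
by rewrite lhs [RHS]mulmxA MM; exact: etrans lhs2 (esym rhs).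
Qed.

Lemma reduced_char_poly_degenerate (A : 'M[K]_m) (A1 : 'M[K]_m') (M : 'M[K]_m) : M \in unitmx ->
  A *m M = M *m (block_mx 0 0 0 A1 : 'M[K]_(1 + m')) -> reduced_char_poly A = char_poly A1.
Proof.
move=> Mu h; rewrite /reduced_char_poly (char_poly_similar Mu h).
have cp : char_poly (block_mx 0 0 0 A1 : 'M[K]_(1 + m')) = char_poly A1 * 'X.
  rewrite {1}/char_poly char_block_diag_mx det_ublock -/(char_poly A1).
  by rewrite det_mx11 !mxE eqxx mulr1n subr0 mulrC.
apply: etrans (congr1 (drop_poly 1) cp) _.
by rewrite -['X]expr1 drop_polyMXn_id.
Qed.

(** By Cayley-Hamilton p(A) is p(0) on the line of u and 0 on its orthogonal, so
    that a p(A) = 0. *)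
Lemma core_degenerate a : a *m u = 0 -> core a = ((reduced_char_poly (gram a))`_0) *: a.
Proof.
move=> au; have [P [Mu uP]] := orthogonal_frame.
have ac : a *m (row_mx u P : 'M[K]_(m, 1 + m')) = row_mx 0 (a *m P) by rewrite mul_mx_row au.
have [G [Gu h]] := degenerate_conj Mu uP ac.
set A1 := invmx G *m _ in h; pose M : 'M[K]_m := row_mx u P.
have qE := reduced_char_poly_degenerate (M := M) Mu h.
rewrite /osp_core mulmxBr mul_mx_scalar; apply/eqP; rewrite -subr_eq0 addrC addKr oppr_eq0.
have gE : gram a = M *m (block_mx 0 0 0 A1 : 'M[K]_(1 + m')) *m invmx M.
  by rewrite -h mulmxK.
pose q0 : 'M[K]_1 := horner_mx (0 : 'M[K]_1) (reduced_char_poly (gram a)).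
have kE : kernel_proj (gram a) = M *m (block_mx q0 0 0 0 : 'M[K]_(1 + m')) *m invmx M.
  rewrite /kernel_proj {1}gE horner_mx_uconj //; congr (_ *m _ *m _).
  by apply: etrans (horner_block_diag (0 : 'M[K]_1) A1 _) _; rewrite -/q0 qE Cayley_Hamilton.
have z : (row_mx 0 (a *m P) : 'M[K]_(n, 1 + m')) *m (block_mx q0 0 0 0 : 'M[K]_(1 + m')) = 0.
  by rewrite mul_row_block !mul0mx !mulmx0 !addr0 row_mx0.
have z' : a *m M *m (block_mx q0 0 0 0 : 'M[K]_(1 + m')) = 0.
  by apply: etrans z; congr (_ *m _).
by rewrite kE !mulmxA z' mul0mx.
Qed.

(** The restriction of a to the orthogonal of u, of even dimension m - 1 <= n, can
    be chosen with a nondegenerate symplectic image; then A is invertible there. *)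
Lemma exists_degenerate_simple : exists a, a *m u = 0 /\ (reduced_char_poly (gram a))`_0 != 0.
Proof.
have [P [Mu uP]] := orthogonal_frame.
have [H Hu] := symplectic_frame nz2 B1T B1u ev_m' mn.
pose M : 'M[K]_m := row_mx u P.
pose a : 'M[K]_(n, m) := (row_mx 0 H : 'M[K]_(n, 1 + m')) *m invmx M.
have aM : a *m M = (row_mx 0 H : 'M[K]_(n, 1 + m')) by apply: mulmxKV.
exists a; split.
  have uE : u = (row_mx u P : 'M[K]_(m, 1 + m')) *m col_mx 1%:M 0.
    by rewrite mul_row_col mulmx1 mulmx0 addr0.
  have z : (row_mx 0 H : 'M[K]_(n, 1 + m')) *m col_mx (1%:M : 'M[K]_1) 0 = 0.
    by rewrite mul_row_col mul0mx mulmx0 addr0.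
  rewrite {1}uE mulmxA; apply: etrans z; congr (_ *m _); exact: aM.
have [G [Gu h]] := degenerate_conj Mu uP aM.
rewrite (reduced_char_poly_degenerate (M := M) Mu h) char_poly_det mulf_neq0 ?signr_eq0 //.
by rewrite -unitfE -unitmxE unitmx_mul unitmx_inv Gu Hu.
Qed.

End Degenerate.

(** * Complexification *)

(** The complex dimension of D^k, or of its complexification when D is real. *)
Definition cdim (b : base) (k : nat) : nat := if b is QuatD then (k + k)%N else k.

(** The complex matrix whose diagonalizability is the semisimplicity of x; in the
    quaternionic case H^k = C^k + C^k j is taken with its right complex
    structure. *)
Definition cplx (R : realType) (b : base) :
    forall k l, 'M[dring R b]_(k, l) -> 'M[R[i]]_(cdim b k, cdim b l) :=
  match b return forall k l, 'M[dring R b]_(k, l) -> 'M[R[i]]_(cdim b k, cdim b l) with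
  | RealD => fun k l x => map_mx (real_complex R) (x : 'M[R]_(k, l))
  | ComplexD => fun k l x => x
  | QuatD => fun k l x =>
      let A : 'M[R[i]]_(k, l) := map_mx fst x in
      let C : 'M[R[i]]_(k, l) := map_mx snd x in
      block_mx A (- C) (map_mx conjc C) (map_mx conjc A)
  end.
Arguments cplx {R b k l} x.

Section Cplx.
Variables (R : realType).
Local Notation C := (R[i]).

Lemma semisimpleE b N (x : 'M[dring R b]_N) : semisimple x = diagonalizable (cplx x).
Proof. by case: b x. Qed.

Section Quat.
Local Notation H := (quaternions R).
Lemma fst_sum I (r : seq I) (F : I -> H) : (\sum_(i <- r) F i).1 = \sum_(i <- r) (F i).1.
Proof. by elim/big_rec2: _ => //= i y1 y2 _ <-. Qed.
Lemma snd_sum I (r : seq I) (F : I -> H) : (\sum_(i <- r) F i).2 = \sum_(i <- r) (F i).2.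
Proof. by elim/big_rec2: _ => //= i y1 y2 _ <-. Qed.
Lemma fst_mulmx k l p (x : 'M[H]_(k, l)) (y : 'M[H]_(l, p)) :
  map_mx fst (x *m y) = (map_mx fst x : 'M[C]_(k, l)) *m (map_mx fst y : 'M[C]_(l, p))
    - (map_mx snd x : 'M[C]_(k, l)) *m map_mx conjc (map_mx snd y : 'M[C]_(l, p)).
Proof.
apply/matrixP => i j; rewrite !mxE fst_sum -sumrB; apply: eq_bigr => s _.
by rewrite !mxE.
Qed.
Lemma snd_mulmx k l p (x : 'M[H]_(k, l)) (y : 'M[H]_(l, p)) :
  map_mx snd (x *m y) = (map_mx fst x : 'M[C]_(k, l)) *m (map_mx snd y : 'M[C]_(l, p))
    + (map_mx snd x : 'M[C]_(k, l)) *m map_mx conjc (map_mx fst y : 'M[C]_(l, p)).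
Proof.
apply/matrixP => i j; rewrite !mxE snd_sum -big_split; apply: eq_bigr => s _.
by rewrite !mxE.
Qed.
End Quat.

Lemma map_conjcK k l (z : 'M[C]_(k, l)) : map_mx conjc (map_mx conjc z) = z.
Proof. by apply/matrixP => i j; rewrite !mxE conjcK. Qed.

Lemma cplxM b k l p (x : 'M[dring R b]_(k, l)) (y : 'M[dring R b]_(l, p)) :
  cplx (x *m y) = cplx x *m cplx y.
Proof.
case: b x y => x y /=.
- exact: map_mxM.
- by [].
- rewrite fst_mulmx snd_mulmx mulmx_block !map_mxB !map_mxD !map_mxM /= !map_conjcK.
  by congr block_mx; rewrite ?mulNmx ?mulmxN ?opprD // addrC.
Qed.

Lemma cplxD b k l (x y : 'M[dring R b]_(k, l)) : cplx (x + y) = cplx x + cplx y.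
Proof.
case: b x y => x y /=.
- exact: map_mxD.
- by [].
- rewrite add_block_mx; congr block_mx; apply/matrixP => i j; rewrite !mxE //=.
  + by rewrite opprD.
  + by rewrite rmorphD.
  + by rewrite rmorphD.
Qed.

Lemma cplx0 b k l : cplx (0 : 'M[dring R b]_(k, l)) = 0.
Proof.
by apply: (addrI (cplx (0 : 'M[dring R b]_(k, l)))); rewrite -cplxD !addr0.
Qed.

Lemma cplxN b k l (x : 'M[dring R b]_(k, l)) : cplx (- x) = - cplx x.
Proof. by apply: (addrI (cplx x)); rewrite -cplxD !subrr cplx0. Qed.

Lemma cplxB b k l (x y : 'M[dring R b]_(k, l)) : cplx (x - y) = cplx x - cplx y.
Proof. by rewrite cplxD cplxN. Qed.

Lemma cplxZ b k l (t : R) (x : 'M[dring R b]_(k, l)) :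
  cplx (of_real b t *: x) = (t%:C)%C *: cplx x.
Proof.
case: b x => x /=.
- exact: map_mxZ.
- by [].
- rewrite scale_block_mx; congr block_mx; apply/matrixP => i j; rewrite !mxE //=.
  + by rewrite mul0r subr0.
  + by rewrite mul0r addr0 mulrN.
  + by rewrite mul0r addr0 rmorphM /= oppr0.
  + by rewrite mul0r subr0 rmorphM /= oppr0.
Qed.

Lemma cplx1 b k : cplx (1%:M : 'M[dring R b]_k) = 1%:M.
Proof.
case: b => /=.
- exact: map_mx1.
- by [].
- rewrite scalar_mx_block; congr block_mx; apply/matrixP => i j; rewrite !mxE /=; case: eqP => //= _;
  by rewrite ?oppr0 ?rmorph1 ?rmorph0.
Qed.

Lemma cplx_inj b k l : injective (@cplx R b k l).
Proof.
case: b => x y /=.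
- exact: map_mx_inj.
- by [].
- case/eq_block_mx => /matrixP h1 /matrixP h2 _ _; apply/matrixP => i j.
  move: (h1 i j) (h2 i j); rewrite !mxE => e1 /oppr_inj e2.
  by case: (x i j) (y i j) e1 e2 => [? ?] [? ?] /= -> ->.
Qed.

(** Over the reals and the quaternions the matrices over D form a real form of the
    complex ones, of which any element is therefore x1 + i x2; over C there is
    nothing to complexify and x2 = 0. *)
Lemma cplx_span b k l (z : 'M[C]_(cdim b k, cdim b l)) :
  exists a1 a2 : 'M[dring R b]_(k, l), z = cplx a1 + 'i%C *: cplx a2.
Proof.
case: b z => z /=.
- exists (map_mx (@complex.Re R) z), (map_mx (@complex.Im R) z).
  by apply/matrixP => i j; rewrite !mxE -complexE.
- by exists z, 0; rewrite scaler0 addr0.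
  (* For entries u and v of two blocks, u = p + i q and v^* = p^* + i q^*. *)
- pose p (u v : C) : C := 2%:R^-1 * (u + v).
  pose q (u v : C) : C := 'i%C * (2%:R^-1 * (v - u)).
  have nz2 : 2%:R != 0 :> C by rewrite pnatr_eq0.
  have c2 : ((2%:R^-1 : C)^*)%C = 2%:R^-1.
    by rewrite -[LHS]/((@conjc R : {rmorphism C -> C}) _) fmorphV rmorph_nat.
  have cM (x y : C) : ((x * y)^*)%C = (x^*)%C * (y^*)%C by exact: (rmorphM conjc).
  have cD (x y : C) : ((x + y)^*)%C = (x^*)%C + (y^*)%C by exact: (rmorphD conjc).
  have cB (x y : C) : ((x - y)^*)%C = (x^*)%C - (y^*)%C by exact: (rmorphB conjc).
  have pq u v : u = p u v + 'i%C * q u v.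
    rewrite /p /q mulrA -expr2 sqr_i; apply: (mulfI nz2).
    by rewrite mulrDr mulN1r mulrN !mulrA mulfV // !mul1r; ring.
  have pqc u v : (v^*)%C = (p u v)^*%C + 'i%C * (q u v)^*%C.
    rewrite /p /q !cM cD cB c2.
    have -> : ('i%C : C)^*%C = - 'i%C by apply/eqP; rewrite eq_complex /= oppr0 !eqxx.
    rewrite mulNr mulrN mulrA -expr2 sqr_i; apply: (mulfI nz2).
    by rewrite mulrDr mulN1r opprK !mulrA mulfV // !mul1r; ring.
  pose z11 := ulsubmx z; pose z12 := ursubmx z; pose z21 := dlsubmx z; pose z22 := drsubmx z.
  pose f (g : C -> C -> C) : 'M[quaternions R]_(k, l) :=
    \matrix_(i, j) (g (z11 i j) (z22 i j)^*%C, g (- z12 i j) (z21 i j)^*%C).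
  exists (f p), (f q).
  rewrite -[LHS](@submxK _ k k l l) scale_block_mx add_block_mx.
  congr block_mx; apply/matrixP => i j; rewrite !mxE /=.
  + exact: pq.
  + by rewrite mulrN -opprD -pq opprK.
  + by rewrite -pqc conjcK.
  + by rewrite -pqc conjcK.
Qed.

End Cplx.

(** * Adjoints and nondegenerate forms *)

(** The conjugate transpose: form t B u v is the entry of dag u *m B *m v. *)
Definition dag (R : realType) (b : base) (t : involution b) k l
    (x : 'M[dring R b]_(k, l)) : 'M[dring R b]_(l, k) := (map_mx (inv_fun t) x)^T.

Section Adjoint.
Variables (R : realType) (b : base) (t : involution b).
Local Notation D := (dring R b).
Local Notation dg := (dag t).

Lemma inv_funD (x y : D) : inv_fun t (x + y) = inv_fun t x + inv_fun t y.
Proof.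
case: t x y => x y //=; first exact: (rmorphD conjc).
rewrite /quat_conj; congr pair; rewrite /= ?opprD //; exact: (rmorphD conjc).
Qed.
Lemma inv_fun0 : inv_fun t (0 : D) = 0.
Proof. by apply: (addrI (inv_fun t (0 : D))); rewrite -inv_funD !addr0. Qed.
Lemma inv_fun_sum I (r : seq I) (F : I -> D) :
  inv_fun t (\sum_(i <- r) F i) = \sum_(i <- r) inv_fun t (F i).
Proof. exact: (big_morph _ inv_funD inv_fun0). Qed.
Lemma inv_funM (x y : D) : inv_fun t (x * y) = inv_fun t y * inv_fun t x.
Proof.
case: t x y => x y /=.
- exact: (@mulrC R).
- exact: (@mulrC R[i]).
- by rewrite [RHS](@mulrC R[i]); exact: (rmorphM conjc).
- case: x => x1 x2; case: y => y1 y2.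
  change (quat_conj (quat_mul (x1, x2) (y1, y2)) =
    quat_mul (quat_conj (y1, y2)) (quat_conj (x1, x2))).
  rewrite /quat_conj /quat_mul /=.
  have cM (u v : R[i]) : ((u * v)^*)%C = (u^*)%C * (v^*)%C by exact: (rmorphM conjc).
  have cB (u v : R[i]) : ((u - v)^*)%C = (u^*)%C - (v^*)%C by exact: (rmorphB conjc).
  have cN (u : R[i]) : ((- u)^*)%C = - (u^*)%C by exact: (rmorphN conjc).
  have k1 (u1 u2 v1 v2 : R[i]) : ((u1 * v1 - u2 * (v2^*)%C)^*)%C =
      (v1^*)%C * (u1^*)%C - - v2 * ((- u2)^*)%C by rewrite cB !cM cN conjcK; ring.
  have k2 (u1 u2 v1 v2 : R[i]) : - (u1 * v2 + u2 * (v1^*)%C) =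
      (v1^*)%C * - u2 + - v2 * ((u1^*)^*)%C by rewrite conjcK; ring.
  by congr pair; [exact: k1 | exact: k2].
Qed.
Lemma inv_funK : involutive (inv_fun t : D -> D).
Proof.
case: t => x //=; first exact: conjcK.
by case: x => x1 x2; rewrite /quat_conj /= conjcK opprK.
Qed.
Lemma inv_fun1 : inv_fun t (1 : D) = 1.
Proof.
by rewrite -[LHS]mulr1 -{2}[1]inv_funK -inv_funM mulr1 inv_funK.
Qed.
Lemma inv_fun_real (c : R) : inv_fun t (of_real b c) = of_real b c.
Proof.
case: t => //=; first by rewrite oppr0.
by rewrite /quat_conj /= !oppr0.
Qed.
Lemma of_realC (c : R) (x : D) : of_real b c * x = x * of_real b c.
Proof.
case: b x => x /=.
- exact: (@mulrC R).
- exact: (@mulrC R[i]).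
- case: x => x1 x2; change (quat_mul ((c%:C)%C, 0) (x1, x2) = quat_mul (x1, x2) ((c%:C)%C, 0)).
  rewrite /quat_mul /=.
  have k1 (u v w : R[i]) : u * v - 0 * w = v * u - x2 * 0 by ring.
  have k2 (u v w : R[i]) : u * v + 0 * w = x1 * 0 + v * u by ring.
  by congr pair; rewrite /= oppr0; [exact: k1 | exact: k2].
Qed.

Lemma dagM k l p (x : 'M[D]_(k, l)) (y : 'M[D]_(l, p)) : dg (x *m y) = (dg y) *m (dg x).
Proof.
apply/matrixP => i j; rewrite !mxE inv_fun_sum; apply: eq_bigr => s _.
by rewrite !mxE inv_funM.
Qed.
Lemma dagK k l (x : 'M[D]_(k, l)) : dg (dg x) = x.
Proof. by apply/matrixP => i j; rewrite !mxE inv_funK. Qed.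
Lemma dagD k l (x y : 'M[D]_(k, l)) : dg (x + y) = (dg x) + (dg y).
Proof. by apply/matrixP => i j; rewrite !mxE inv_funD. Qed.
Lemma dag0 k l : dg (0 : 'M[D]_(k, l)) = 0.
Proof. by apply/matrixP => i j; rewrite !mxE inv_fun0. Qed.
Lemma dagZ k l c (x : 'M[D]_(k, l)) : dg (of_real b c *: x) = of_real b c *: (dg x).
Proof. by apply/matrixP => i j; rewrite !mxE inv_funM inv_fun_real -of_realC. Qed.
Lemma dag_block k l p q (x : 'M[D]_(k, l)) (y : 'M[D]_(k, q)) (z : 'M[D]_(p, l)) (w : 'M[D]_(p, q)) :
  dg (block_mx x y z w) = block_mx (dg x) (dg z) (dg y) (dg w).
Proof. by rewrite /dag map_block_mx tr_block_mx. Qed.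

Lemma form_ext N (M M' : 'M[D]_N) :
  (forall u v : 'cV[D]_N, ((dg u) *m M *m v) 0 0 = ((dg u) *m M' *m v) 0 0) -> M = M'.
Proof.
move=> h; apply/matrixP => i j; have := h (delta_mx i 0) (delta_mx j 0).
have dd : dg (delta_mx i 0 : 'cV[D]_N) = delta_mx 0 i.
  apply/matrixP => x y; rewrite !mxE andbC.
  by case: (_ && _); rewrite ?inv_fun1 ?inv_fun0.
by rewrite dd -!rowE -!colE !mxE.
Qed.

Lemma dag_hermitian N (B : 'M[D]_N) : hermitian t B -> (dg B) = B.
Proof.
move=> h; apply: form_ext => v u.
have /= := h u v; rewrite /form -![(map_mx _ _)^T]/(dag t _) => ->.
have -> : inv_fun t (((dg u) *m B *m v) 0 0) = (dg (dg u *m B *m v)) 0 0 by rewrite !mxE.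
by rewrite !dagM dagK mulmxA.
Qed.
Lemma dag_skew_hermitian N (B : 'M[D]_N) : skew_hermitian t B -> (dg B) = - B.
Proof.
move=> h; apply: form_ext => v u.
have /= := h u v; rewrite /form -![(map_mx _ _)^T]/(dag t _) => h'.
rewrite mulmxN mulNmx [RHS]mxE h' opprK.
have -> : inv_fun t (((dg u) *m B *m v) 0 0) = (dg (dg u *m B *m v)) 0 0 by rewrite !mxE.
by rewrite !dagM dagK mulmxA.
Qed.

Lemma nondegenerate_row N (B : 'M[D]_N) : nondegenerate t B ->
  forall r : 'rV[D]_N, r *m B = 0 -> r = 0.
Proof.
move=> nd r rB; rewrite -[r]dagK; have -> : dg r = 0; last by rewrite dag0.
by apply: nd => v; rewrite /form -[(map_mx _ _)^T]/(dag t _) dagK rB mul0mx mxE.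
Qed.

End Adjoint.

Section Inverse.
Variable (R : realType).
Local Notation C := R[i].

(** Together with cplx_span: a real form and i times it are in direct sum. *)
Lemma cplx_indep b k l (a1 a2 : 'M[dring R b]_(k, l)) : b <> ComplexD ->
  cplx a1 + 'i%C *: cplx a2 = 0 -> a1 = 0 /\ a2 = 0.
Proof.
have ri (z w : C) : z + 'i%C * w = 0 -> (z^*)%C + 'i%C * (w^*)%C = 0 -> z = 0 /\ w = 0.
  case: z => z1 z2; case: w => w1 w2 /eqP + /eqP.
  rewrite !eq_complex /= !(mul0r, mul1r, add0r, addr0, sub0r) opprK.
  move=> /andP[/eqP h1 /eqP h2] /andP[/eqP h3 /eqP h4].
  have e1 : z1 = 0 by lra.
  have e2 : z2 = 0 by lra.
  have e3 : w1 = 0 by lra.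
  have e4 : w2 = 0 by lra.
  by rewrite e1 e2 e3 e4.
case: b a1 a2 => a1 a2 // _ /=.
- move=> /matrixP h; split; apply/matrixP => i j; move: (h i j); rewrite !mxE => /eqP;
  by rewrite eq_complex /= !(mul0r, mul1r, add0r, addr0, sub0r, subr0) => /andP[/eqP ? /eqP ?].
- rewrite scale_block_mx add_block_mx => /eqP; rewrite block_mx_eq0.
  move=> /and4P[/eqP/matrixP h1 /eqP/matrixP h2 /eqP/matrixP h3 /eqP/matrixP h4].
  split; apply/matrixP => i j; move: (h1 i j) (h2 i j) (h3 i j) (h4 i j);
  rewrite !mxE mulrN -opprD => e1 /eqP; rewrite oppr_eq0 => /eqP e2 e3 e4;
  have [f1 f2] := ri _ _ e1 e4; have [f3 f4] := ri _ _ e2 e3.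
  + by rewrite [a1 i j]surjective_pairing f1 f3.
  + by rewrite [a2 i j]surjective_pairing f2 f4.
Qed.

(** A complex matrix killed by cplx B is r1 + i r2 with r1 and r2 killed by B. In
    the quaternionic case a row over D is a pair of complex rows, so that a single
    complex row is first completed by zero. *)
Lemma nondegenerate_cplx b (t : involution b) N (B : 'M[dring R b]_N) :
  nondegenerate t B -> cplx B \in unitmx.
Proof.
move=> /nondegenerate_row nd.
have key (Z : 'M[C]_(cdim b 1, cdim b N)) : Z *m cplx B = 0 -> Z = 0.
  have [bE|bE] := pselect (b = ComplexD); first by subst b; exact: nd.
  have [a1 [a2 ->]] := cplx_span Z.
  rewrite mulmxDl -scalemxAl -!cplxM => /(cplx_indep bE)[/nd -> /nd ->].
  by rewrite !cplx0 scaler0 addr0.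
rewrite -row_free_unit -kermx_eq0; apply/eqP/row_matrixP => i; rewrite row0.
have := sub_kermxP (row_sub i (kermx (cplx B))).
move: (row i (kermx (cplx B))) => {i} r rB.
case: b t B {nd} key r rB => t B key r rB; [exact: key|exact: key|].
have : col_mx r (0 : 'rV_ _) = 0; last by rewrite -col_mx0 => /eq_col_mx[].
by apply: key; rewrite mul_col_mx rB mul0mx col_mx0.
Qed.

(** The component of (cplx B)^-1 in the real form is an inverse of B. *)
Lemma nondegenerate_inv b (t : involution b) N (B : 'M[dring R b]_N) :
  nondegenerate t B -> exists Z, B *m Z = 1%:M /\ Z *m B = 1%:M.
Proof.
move=> nd; have Bu := nondegenerate_cplx nd.
suff [Z BZ] : exists Z, B *m Z = 1%:M.
  exists Z; split => //; apply: cplx_inj; rewrite cplxM cplx1; apply: mulmx1C.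
  by rewrite -cplxM BZ cplx1.
have [bE|bE] := pselect (b = ComplexD).
  by subst b; exists (invmx (B : 'M[C]_N)); exact: (mulmxV Bu).
have [a1 [a2 aE]] := cplx_span (invmx (cplx B)); exists a1.
have := mulmxV Bu; rewrite aE mulmxDr -scalemxAr -!cplxM => /eqP.
rewrite -subr_eq0 addrAC -(cplx1 R b) -cplxB => /eqP/(cplx_indep bE)[/eqP + _].
by rewrite subr_eq0 => /eqP.
Qed.

End Inverse.

(** * Odd elements of simple nonzero spectrum *)

(** In type I the relation makes c the adjoint of a, which determines it. *)
Definition adjoint_rel (R : realType) (b : base) m n (P : pair_datum R b m n)
    (a : 'M[dring R b]_(n, m)) (c : 'M[dring R b]_(m, n)) : Prop :=
  match P with
  | TypeII => True
  | TypeI t B0 B1 => B0 *m c = dag t a *m B1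
  end.

Section OddPart.
Variables (R : realType) (b : base) (m n : nat) (P : pair_datum R b m n).
Local Notation D := (dring R b).
Local Notation C := R[i].
Hypothesis hP : dual_pair P.

Lemma form_dag t N (B : 'M[D]_N) (u v : 'cV[D]_N) : form t B u v = (dag t u *m B *m v) 0 0.
Proof. by []. Qed.

(** The condition (x u, v) = (u, sigma x v) has two antidiagonal blocks, exchanged
    by the adjoint since one form is hermitian and the other skew. *)
Lemma s_odd_block (a : 'M[D]_(n, m)) (c : 'M[D]_(m, n)) :
  s_odd P (block_mx 0 c a 0) <-> adjoint_rel P a c.
Proof.
case: P hP => [|t B0 B1] /=.
  by split => // _; split => //; split; rewrite (block_mxKul, block_mxKdr).
case=> _ _ [_ /dag_hermitian B0d _ /dag_skew_hermitian B1d].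
have lhs : dag t (block_mx 0 c a 0 : 'M[D]_(m + n)) *m block_mx B0 0 0 B1 =
    block_mx 0 (dag t a *m B1) (dag t c *m B0) 0.
  by rewrite dag_block !dag0 mulmx_block !mul0mx !mulmx0 !addr0 !add0r.
have rhs : block_mx B0 0 0 B1 *m (sigma R b m n *m block_mx 0 c a 0) =
    block_mx 0 (B0 *m c) (- (B1 *m a)) 0.
  rewrite /sigma !mulmx_block !mul0mx !mulmx0 !addr0 !add0r !mul1mx mulNmx mul1mx.
  by rewrite mulmxN ?mulmx0 ?mulNmx ?mul0mx ?oppr0 ?mulmx0.
split.
- case=> _ h; have : dag t (block_mx 0 c a 0 : 'M[D]_(m + n)) *m block_mx B0 0 0 B1 =
      block_mx B0 0 0 B1 *m (sigma R b m n *m block_mx 0 c a 0).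
    apply: (@form_ext _ _ t) => u v; have := h u v.
    by rewrite !form_dag dagM !mulmxA.
  by rewrite lhs rhs => /eq_block_mx[].
- move=> h; split; first by split; rewrite (block_mxKul, block_mxKdr).
  have h2 : dag t c *m B0 = - (B1 *m a).
    have := congr1 (fun z => dag t z) h; rewrite !dagM dagK B0d B1d => ->.
    by rewrite mulNmx.
  move=> /= u v; rewrite !form_dag dagM -[_ *m block_mx B0 _ _ _]mulmxA lhs h2 -h -rhs.
  by rewrite !mulmxA.
Qed.

Lemma s_oddP x : s_odd P x <-> exists a c, x = block_mx 0 c a 0 /\ adjoint_rel P a c.
Proof.
split; last by case=> a [c [-> /s_odd_block]].
move=> xs; have [[x0 x1] _] := xs; exists (dlsubmx x), (ursubmx x).
have xE : x = block_mx 0 (ursubmx x) (dlsubmx x) 0 by rewrite -x0 -[X in block_mx _ _ _ X]x1 submxK.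
by split => //; apply/s_odd_block; rewrite -xE.
Qed.

Lemma s_odd_line x y (r : R) : s_odd P x -> s_odd P y -> s_odd P (x + of_real b r *: y).
Proof.
move=> /s_oddP[a [c [-> h]]] /s_oddP[a' [c' [-> h']]]; apply/s_oddP.
exists (a + of_real b r *: a'), (c + of_real b r *: c'); split.
  by rewrite scale_block_mx add_block_mx !scaler0 !addr0.
case: P h h' => //= t B0 B1 h h'.
rewrite dagD dagZ mulmxDl mulmxDr -scalemxAl h -h'; congr (_ + _).
apply/matrixP => i j; rewrite !mxE mulr_sumr; apply: eq_bigr => k _.
by rewrite !mxE !mulrA of_realC.
Qed.

Lemma s_odd0 : s_odd P 0.
Proof.
apply/s_oddP; exists 0, 0; split; first by rewrite block_mx0.
by case: P => //= t B0 B1; rewrite dag0 mulmx0 mul0mx.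
Qed.

(** For quaternions the complexification of a block antidiagonal matrix is no
    longer so; its blocks are recovered with the complexified injections and
    projections of the grading. *)
Definition incl0 : 'M[D]_(m + n, m) := col_mx 1%:M 0.
Definition incl1 : 'M[D]_(m + n, n) := col_mx 0 1%:M.
Definition proj0 : 'M[D]_(m, m + n) := row_mx 1%:M 0.
Definition proj1 : 'M[D]_(n, m + n) := row_mx 0 1%:M.
Local Notation I0 := (cplx incl0).
Local Notation I1 := (cplx incl1).
Local Notation P0 := (cplx proj0).
Local Notation P1 := (cplx proj1).

Lemma proj0_incl0 : P0 *m I0 = 1%:M.
Proof. by rewrite -cplxM mul_row_col mul1mx mul0mx addr0 cplx1. Qed.
Lemma proj0_incl1 : P0 *m I1 = 0.
Proof. by rewrite -cplxM mul_row_col mulmx0 mul0mx addr0 cplx0. Qed.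
Lemma proj1_incl0 : P1 *m I0 = 0.
Proof. by rewrite -cplxM mul_row_col mulmx0 mul0mx addr0 cplx0. Qed.
Lemma proj1_incl1 : P1 *m I1 = 1%:M.
Proof. by rewrite -cplxM mul_row_col mul1mx mul0mx add0r cplx1. Qed.

Lemma cplx_block (a : 'M[D]_(n, m)) (c : 'M[D]_(m, n)) :
  cplx (block_mx 0 c a 0) = I0 *m cplx c *m P1 + I1 *m cplx a *m P0.
Proof.
by rewrite -!cplxM -cplxD block_odd.
Qed.

Definition lower_block (X : 'M[C]_(cdim b (m + n))) := P1 *m X *m I0.
Definition upper_block (X : 'M[C]_(cdim b (m + n))) := P0 *m X *m I1.

Lemma lower_blockE a c : lower_block (I0 *m c *m P1 + I1 *m a *m P0) = a.
Proof.
rewrite /lower_block mulmxDr !mulmxA proj1_incl0 proj1_incl1 !mul0mx mul1mx add0r.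
by rewrite -mulmxA proj0_incl0 mulmx1.
Qed.
Lemma upper_blockE a c : upper_block (I0 *m c *m P1 + I1 *m a *m P0) = c.
Proof.
rewrite /upper_block mulmxDr !mulmxA proj0_incl0 proj0_incl1 !mul0mx mul1mx addr0.
by rewrite -mulmxA proj1_incl1 mulmx1.
Qed.

Definition simple_nonzero_spectrum N (A : 'M[C]_N) := simple_spectrum A /\ \det A != 0.

(** The square b a on V_0 can be invertible only for dim V_0 <= dim V_1, and a b on
    V_1 only in the opposite case: the one on the smaller space is used. *)
Definition simple_odd (X : 'M[C]_(cdim b (m + n))) :=
  simple_nonzero_spectrum (upper_block X *m lower_block X) \/
  simple_nonzero_spectrum (lower_block X *m upper_block X).

Lemma cdim_gt0 k : (0 < k)%N -> (0 < cdim b k)%N.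
Proof. by case: b => //= k0; rewrite addn_gt0 k0. Qed.

Lemma simple_odd_semisimple x : s_odd P x -> simple_odd (cplx x) -> semisimple x.
Proof.
have [m0 n0 _] := hP.
move=> /s_oddP[a [c [-> _]]]; rewrite semisimpleE cplx_block /simple_odd lower_blockE upper_blockE.
case=> -[h1 h2].
- by apply: (odd_diagonalizable_nz _ proj0_incl0 proj0_incl1 proj1_incl0 proj1_incl1 erefl h1 h2);
    apply: cdim_gt0.
- rewrite addrC.
  by apply: (odd_diagonalizable_nz _ proj1_incl1 proj1_incl0 proj0_incl1 proj0_incl0 erefl h1 h2);
    apply: cdim_gt0.
Qed.

Lemma simple_nonzero_spectrum_cofinite N (A : 'M[{poly C}]_N) s0 : (0 < N)%N ->
  simple_nonzero_spectrum (map_mx (horner_eval s0) A) ->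
  exists s : seq C, forall t, t \notin s -> simple_nonzero_spectrum (map_mx (horner_eval t) A).
Proof.
move=> N0 [/(separable_cofinite N0)[s1 h1] /det_cofinite[s2 h2]].
by exists (s1 ++ s2) => t; rewrite mem_cat negb_or => /andP[/h1 ? /h2].
Qed.

Lemma simple_odd_cofinite X Y s0 : simple_odd (X + s0 *: Y) ->
  exists s : seq C, forall t, t \notin s -> simple_odd (X + t *: Y).
Proof.
have [m0 n0 _] := hP.
pose lo := map_mx polyC P1 *m pline X Y *m map_mx polyC I0.
pose up := map_mx polyC P0 *m pline X Y *m map_mx polyC I1.
have loE t : map_mx (horner_eval t) lo = lower_block (X + t *: Y).
  by rewrite !map_mxM /= !map_horner_polyC plineE.
have upE t : map_mx (horner_eval t) up = upper_block (X + t *: Y).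
  by rewrite !map_mxM /= !map_horner_polyC plineE.
rewrite /simple_odd -loE -upE -!map_mxM; case=> h.
- have [s sP] := simple_nonzero_spectrum_cofinite (cdim_gt0 m0) h.
  by exists s => t /sP; left; rewrite -loE -upE -map_mxM.
- have [s sP] := simple_nonzero_spectrum_cofinite (cdim_gt0 n0) h.
  by exists s => t /sP; right; rewrite -loE -upE -map_mxM.
Qed.

End OddPart.

Section ComplexModel.
Variable (R : realType).
Local Notation C := R[i].

(** cplx (dag ConjH a) is the conjugate transpose of cplx a; since conjugation by J
    is complex conjugation on the image of cplx, J converts it into a transpose. *)
Definition Jmx k : 'M[C]_(k + k) := block_mx 0 1%:M (- 1%:M) 0.

Lemma Jmx_tr k : (Jmx k)^T = - Jmx k.
Proof. by rewrite tr_block_mx !trmx0 linearN /= trmx1 opp_block_mx oppr0 opprK. Qed.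

Lemma Jmx_unit k : Jmx k \in unitmx.
Proof.
have : Jmx k *m (- Jmx k) = 1%:M.
  rewrite opp_block_mx oppr0 opprK mulmx_block !mul0mx !mulmx0 !addr0 !add0r.
  by rewrite mulmxN !mulmx1 opprK -scalar_mx_block.
by case/mulmx1_unit.
Qed.

Lemma cplx_dagH k l (a : 'M[dring R QuatD]_(k, l)) :
  Jmx l *m cplx (dag ConjH a) = (cplx a)^T *m Jmx k.
Proof.
rewrite /Jmx /cplx tr_block_mx !mulmx_block !mul0mx !mul1mx !mulmx0 !mulmx1.
rewrite !add0r !addr0 !mulNmx !mul1mx !mulmxN !mulmx1.
congr block_mx; apply/matrixP => i j; rewrite !mxE //= ?opprK ?conjcK //.
exact: (rmorphN conjc).
Qed.

Lemma cplx_dagT b (t : involution b) k l (a : 'M[dring R b]_(k, l)) :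
  (match t with TrivR | TrivC => True | _ => False end) -> cplx (dag t a) = (cplx a)^T.
Proof. by case: t a => a // _; apply/matrixP => i j; rewrite !mxE. Qed.

Lemma skew_unit_even N (B : 'M[C]_N) : B^T = - B -> B \in unitmx -> ~~ odd N.
Proof.
move=> BT; rewrite unitmxE unitfE; apply: contra => oN.
by apply/eqP; apply: det_skew_odd => //; rewrite pnatr_eq0.
Qed.

(** For all involutions but the complex conjugation, the relation between a and its
    adjoint becomes complex bilinear, up to multiplying the forms by J for
    quaternions; as J is skew this exchanges the symmetries, whence e = -1: the
    complexification of (Sp(p, q), O*(2n)) is a symplectic-orthogonal pair in
    this order. *)
Lemma bilinear_model b (t : involution b) m n (B0 : 'M[dring R b]_m) (B1 : 'M[dring R b]_n) :
    dual_pair (TypeI t B0 B1) -> (match t with ConjC => False | _ => True end) ->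
  exists (e : C) (B0' : 'M[C]_(cdim b m)) (B1' : 'M[C]_(cdim b n)),
    [/\ e = 1 /\ b <> QuatD /\ orthosymplectic (TypeI t B0 B1) \/
       e = -1 /\ b = QuatD,
      B0'^T = e *: B0', B1'^T = - e *: B1',
      B0' \in unitmx /\ B1' \in unitmx &
      forall a c, B0 *m c = dag t a *m B1 -> B0' *m cplx c = (cplx a)^T *m B1'].
Proof.
case=> _ _ [nd0 /dag_hermitian h0 nd1 /dag_skew_hermitian h1].
have u0 := nondegenerate_cplx nd0; have u1 := nondegenerate_cplx nd1.
have triv : (match t with TrivR | TrivC => True | _ => False end) ->
  exists (e : C) (B0' : 'M[C]_(cdim b m)) (B1' : 'M[C]_(cdim b n)),
    [/\ e = 1 /\ b <> QuatD /\ orthosymplectic (TypeI t B0 B1) \/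
       e = -1 /\ b = QuatD,
      B0'^T = e *: B0', B1'^T = - e *: B1',
      B0' \in unitmx /\ B1' \in unitmx &
      forall a c, B0 *m c = dag t a *m B1 -> B0' *m cplx c = (cplx a)^T *m B1'].
  move=> tt; exists 1, (cplx B0), (cplx B1); split => //.
  - by left; case: (t) tt B0 B1 {nd0 h0 nd1 h1 u0 u1}.
  - by rewrite -(@cplx_dagT _ t) // h0 scale1r.
  - by rewrite -(@cplx_dagT _ t) // h1 cplxN scaleN1r.
  - by move=> a c h; rewrite -(@cplx_dagT _ t) // -!cplxM h.
case: t B0 B1 nd0 h0 nd1 h1 u0 u1 triv => // B0 B1 nd0 h0 nd1 h1 u0 u1 triv _.
exists (-1), (Jmx m *m cplx B0), (Jmx n *m cplx B1); split.
- by right.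
- by rewrite trmx_mul Jmx_tr mulmxN -cplx_dagH h0 scaleN1r.
- by rewrite trmx_mul Jmx_tr mulmxN -cplx_dagH h1 cplxN mulmxN !opprK scale1r.
- by rewrite !unitmx_mul !Jmx_unit u0 u1.
- move=> a c h; have h' : cplx B0 *m cplx c = cplx (dag ConjH a) *m cplx B1.
    by rewrite -!cplxM h.
  by rewrite -mulmxA h' mulmxA cplx_dagH -mulmxA.
Qed.

Lemma adjoint_exists b m n (P : pair_datum R b m n) a : dual_pair P ->
  exists c, adjoint_rel P a c.
Proof.
case: P => [|t B0 B1] /=; first by exists 0.
case=> _ _ [/nondegenerate_inv[Z [BZ _]] _ _ _]; exists (Z *m (dag t a *m B1)).
by rewrite mulmxA BZ mul1mx.
Qed.

(** A complex point x1 + i x2 will serve as well as a real one: x1 + t x2 has the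
    property for all but finitely many complex t, hence for some real t. *)
Lemma simple_odd_combination b m n (P : pair_datum R b m n)
    (a1 a2 : 'M[dring R b]_(n, m)) (c1 c2 : 'M[dring R b]_(m, n)) a c :
    dual_pair P -> adjoint_rel P a1 c1 -> adjoint_rel P a2 c2 ->
    cplx a1 + 'i%C *: cplx a2 = a -> cplx c1 + 'i%C *: cplx c2 = c ->
    simple_nonzero_spectrum (c *m a) \/ simple_nonzero_spectrum (a *m c) ->
  exists x1 x2, [/\ s_odd P x1, s_odd P x2 & simple_odd (cplx x1 + 'i%C *: cplx x2)].
Proof.
move=> hP h1 h2 aE cE g; exists (block_mx 0 c1 a1 0), (block_mx 0 c2 a2 0).
split; try exact/(s_odd_block hP).
have -> : cplx (block_mx 0 c1 a1 0) + 'i%C *: cplx (block_mx 0 c2 a2 0) =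
    cplx (incl0 R b m n) *m c *m cplx (proj1 R b m n) +
    cplx (incl1 R b m n) *m a *m cplx (proj0 R b m n).
  rewrite !cplx_block -aE -cE !mulmxDr !mulmxDl -!scalemxAr -!scalemxAl scalerDr.
  by rewrite addrACA.
by rewrite /simple_odd lower_blockE upper_blockE.
Qed.

(** The complexification of a unitary pair is a general linear one: a and c can be
    prescribed independently. Writing the adjoint of c as e, the equations
    a1 + i a2 = a and a1 - i a2 = e have the solution below. *)
Lemma conj_point m n (B0 : 'M[dring R ComplexD]_m) (B1 : 'M[dring R ComplexD]_n)
    (a : 'M[C]_(n, m)) (c : 'M[C]_(m, n)) :
    let P := TypeI ConjC B0 B1 in dual_pair P ->
  exists a1 a2 c1 c2, [/\ adjoint_rel P a1 c1, adjoint_rel P a2 c2,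
    cplx a1 + 'i%C *: cplx a2 = a & cplx c1 + 'i%C *: cplx c2 = c].
Proof.
move=> P hP; have [_ _ [nd0 _ nd1 _]] := hP.
have u0 : (B0 : 'M[C]_m) \in unitmx := nondegenerate_cplx nd0.
have u1 : (B1 : 'M[C]_n) \in unitmx := nondegenerate_cplx nd1.
pose h (z : 'M[C]_(n, m)) : 'M[C]_(m, n) := (map_mx conjc z)^T.
pose h' (z : 'M[C]_(m, n)) : 'M[C]_(n, m) := (map_mx conjc z)^T.
have hh' z : h (h' z) = z by apply/matrixP => i j; rewrite !mxE conjcK.
pose e := h' ((B0 : 'M[C]_m) *m c *m invmx (B1 : 'M[C]_n)).
have eE : h e = (B0 : 'M[C]_m) *m c *m invmx (B1 : 'M[C]_n) by exact: hh'.
clearbody e.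
pose a1 : 'M[C]_(n, m) := 2%:R^-1 *: (a + e).
pose a2 : 'M[C]_(n, m) := ('i%C * 2%:R^-1) *: (e - a).
have [c1 c1E] := adjoint_exists (a1 : 'M[dring R ComplexD]_(n, m)) hP.
have [c2 c2E] := adjoint_exists (a2 : 'M[dring R ComplexD]_(n, m)) hP.
have nz2 : 2%:R != 0 :> C by rewrite pnatr_eq0.
exists a1, a2, c1, c2; split => //.
- apply/matrixP => i j; rewrite !mxE.
  have key (u v : C) : 2%:R^-1 * (u + v) + 'i%C * ('i%C * 2%:R^-1 * (v - u)) = u.
    by rewrite !mulrA -expr2 sqr_i; field.
  exact: key.
- rewrite /=; have inj (z w : 'M[C]_(m, n)) : (B0 : 'M[C]_m) *m z = (B0 : 'M[C]_m) *m w -> z = w.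
    by move=> /(congr1 (mulmx (invmx (B0 : 'M[C]_m)))); rewrite !mulKmx.
  apply: inj; rewrite mulmxDr -scalemxAr.
  have c1E' : (B0 : 'M[C]_m) *m c1 = h a1 *m B1 := c1E.
  have c2E' : (B0 : 'M[C]_m) *m c2 = h a2 *m B1 := c2E.
  rewrite c1E' c2E' scalemxAl -mulmxDl.
  have -> : h a1 + 'i%C *: h a2 = h e.
    rewrite /h /a1 /a2; apply/matrixP => i j; rewrite !mxE.
    have cM (x y : C) : ((x * y)^*)%C = (x^*)%C * (y^*)%C by exact: (rmorphM conjc).
    have cD (x y : C) : ((x + y)^*)%C = (x^*)%C + (y^*)%C by exact: (rmorphD conjc).
    have cB (x y : C) : ((x - y)^*)%C = (x^*)%C - (y^*)%C by exact: (rmorphB conjc).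
    have c2c : ((2%:R^-1 : C)^*)%C = 2%:R^-1.
      by rewrite -[LHS]/((@conjc R : {rmorphism C -> C}) _) fmorphV rmorph_nat.
    have ci : (('i%C : C)^*)%C = - 'i%C by apply/eqP; rewrite eq_complex /= oppr0 !eqxx.
    have key (u v : C) : ((2%:R^-1 * (u + v))^*)%C +
        'i%C * (('i%C * 2%:R^-1 * (v - u))^*)%C = (v^*)%C.
      rewrite !cM cD cB c2c ci !(mulNr, mulrN) !mulrA -expr2 sqr_i; by field.
    exact: key.
  by rewrite eE mulmxKV.
Qed.

(** The complexification is general linear (type II, unitary) or orthosymplectic
    with forms B0', B1' of opposite symmetries. In the latter case the skew space
    has even dimension, so that osp_point_even applies unless the symmetric one is
    smaller and odd-dimensional; the quaternionic dimensions are all even. *)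
Lemma exists_simple_odd b m n (P : pair_datum R b m n) : dual_pair P ->
    ~ [/\ orthosymplectic P, odd m & (m < n)%N] ->
  exists x1 x2, [/\ s_odd P x1, s_odd P x2 & simple_odd (cplx x1 + 'i%C *: cplx x2)].
Proof.
move=> hP nex.
have gl : exists (a : 'M[C]_(cdim b n, cdim b m)) (c : 'M[C]_(cdim b m, cdim b n)),
    simple_nonzero_spectrum (c *m a) \/ simple_nonzero_spectrum (a *m c).
  have [le|/ltnW le] := leqP (cdim b m) (cdim b n).
    by have [a [c ac]] := gl_point C le; exists a, c; left.
  by have [c [a ac]] := gl_point C le; exists a, c; right.
case: P hP nex => [|t B0 B1] hP nex.
  have [a [c g]] := gl.
  have [a1 [a2 aE]] := cplx_span a; have [c1 [c2 cE]] := cplx_span c.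
  by apply: (simple_odd_combination hP _ _ (esym aE) (esym cE) g).
have [tC|tnC] : (if t is ConjC then true else false) \/
    (match t with ConjC => False | _ => True end).
- by case: (t); [right|right|left|right].
- move: gl B0 B1 hP {nex}; case: t tC => // _ [a [c g]] B0 B1 hP.
  have [a1 [a2 [c1 [c2 [h1 h2 aE cE]]]]] := conj_point a c hP.
  exact: (simple_odd_combination hP h1 h2 aE cE g).
have [e [B0' [B1' [e1 T0 T1 [u0 u1] rel]]]] := bilinear_model hP tnC.
have e1' : e = 1 \/ e = -1 by case: e1 => -[]; [left|right].
have n_even : ~~ odd (cdim b n).
  case: e1 => -[ee]; last by move=> bE; subst b; rewrite /= addnn odd_double.
  by move=> _; apply: (@skew_unit_even _ B1') => //; rewrite T1 ee scaleN1r.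
have m_even : (cdim b m <= cdim b n)%N -> ~~ odd (cdim b m).
  move=> le; case: e1 => -[ee]; last by move=> bE; subst b; rewrite /= addnn odd_double.
  have cE k : b <> QuatD -> cdim b k = k by case: (b).
  move=> [/cE bE os]; move: le n_even; rewrite !bE leq_eqVlt => /orP[/eqP -> //|lt _].
  by apply/negP => om; apply: nex; split.
have NT : (- B0')^T = - (e *: B0').
  by rewrite -T0; apply/matrixP => i j; rewrite !mxE.
have [a [c [ac g]]] : exists a c, B0' *m c = a^T *m B1' /\
    (simple_nonzero_spectrum (c *m a) \/ simple_nonzero_spectrum (a *m c)).
  have [le|/ltnW le] := leqP (cdim b m) (cdim b n).
    have [a [c [h1 h2 h3]]] := osp_point_even e1' T0 T1 u0 u1 (m_even le) le.
    by exists a, c; split => //; left.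
  have [||||c [a [h1 h2 h3]]] := @osp_point_even C _ _ (- e) B1' (- B0') _ _ _ u1 _ n_even le.
  - by case: e1' => ->; [right|left; rewrite opprK].
  - by [].
  - by rewrite NT opprK scalerN.
  - by rewrite -scaleN1r unitmxZ ?unitrN1.
  exists a, c; split; last by right.
  have := congr1 (fun z => z^T) h1; rewrite !trmx_mul trmxK T1 NT.
  rewrite -scalemxAr mulNmx -scalemxAl scaleNr => /oppr_inj h.
  have ee : e * e = 1 by case: e1' => ->; rewrite ?mulr1 // mulrNN mulr1.
  by rewrite -[LHS]scale1r -ee -scalerA -h scalerA ee scale1r.
have [a1 [a2 aE]] := cplx_span a.
have [c1 h1] := adjoint_exists a1 hP; have [c2 h2] := adjoint_exists a2 hP.
apply: (simple_odd_combination hP h1 h2 (esym aE) _ g).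
apply: (can_inj (mulKmx u0)); rewrite mulmxDr -scalemxAr (rel _ _ h1) (rel _ _ h2) ac aE.
have -> : (cplx a1 + 'i%C *: cplx a2)^T = (cplx a1)^T + 'i%C *: (cplx a2)^T.
  by apply/matrixP => i j; rewrite !mxE.
by rewrite mulmxDl -scalemxAl.
Qed.

End ComplexModel.

(** * Real dimension of orbits *)

Section Realify.
Variable R : realType.
Local Notation C := R[i].
Local Notation Re := (@complex.Re R).
Local Notation Im := (@complex.Im R).

Lemma cofinite_real (Q : C -> Prop) :
  (exists s : seq C, forall t, t \notin s -> Q t) ->
  exists s : seq R, forall t : R, t \notin s -> Q (t%:C)%C.
Proof.
case=> s sP; exists (map Re s) => t ts; apply: sP.
by apply: contra ts => ts; apply/mapP; exists (t%:C)%C.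
Qed.

Lemma cofinite_and (Q1 Q2 : R -> Prop) :
  (exists s : seq R, forall t, t \notin s -> Q1 t) ->
  (exists s : seq R, forall t, t \notin s -> Q2 t) ->
  exists s : seq R, forall t, t \notin s -> Q1 t /\ Q2 t.
Proof.
move=> [s1 h1] [s2 h2]; exists (s1 ++ s2) => t.
by rewrite mem_cat negb_or => /andP[/h1 ? /h2].
Qed.

Lemma cofinite_ex (Q : R -> Prop) :
  (exists s : seq R, forall t, t \notin s -> Q t) -> exists t, Q t.
Proof.
case=> s sP; pose t := \sum_(r <- s) `|r| + 1; exists t; apply: sP.
apply/negP => ts; have : `|t| <= \sum_(r <- s) `|r|.
  rewrite (big_rem t) //= lerDl; apply: sumr_ge0 => *; exact: normr_ge0.
have : 0 <= \sum_(r <- s) `|r| by apply: sumr_ge0 => *; exact: normr_ge0.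
rewrite /t => s0; rewrite ger0_norm ?addr_ge0 // => h.
by move: h; rewrite gerDl ler10.
Qed.

Lemma Re_scale (z : C) (r : R) : Re ((r%:C)%C * z) = r * Re z.
Proof. by case: z => a b /=; rewrite mul0r subr0. Qed.
Lemma Im_scale (z : C) (r : R) : Im ((r%:C)%C * z) = r * Im z.
Proof. by case: z => a b /=; rewrite mul0r addr0. Qed.

(** Ranks over the reals of families of complex matrices are computed on these row
    vectors. *)
Definition realify k l (z : 'M[C]_(k, l)) : 'rV[R]_(k * l + k * l) :=
  row_mx (map_mx Re (mxvec z)) (map_mx Im (mxvec z)).

Lemma realifyD k l (z w : 'M[C]_(k, l)) : realify (z + w) = realify z + realify w.
Proof.
rewrite /realify linearD /= add_row_mx; congr row_mx; apply/rowP => i; rewrite !mxE;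
by case: (_ 0 i) => ? ?; case: (_ 0 i).
Qed.

Lemma realifyZ k l (r : R) (z : 'M[C]_(k, l)) : realify ((r%:C)%C *: z) = r *: realify z.
Proof.
rewrite /realify linearZ /= scale_row_mx; congr row_mx; apply/rowP => i;
by rewrite !mxE (Re_scale, Im_scale).
Qed.

Lemma realify0 k l : realify (0 : 'M[C]_(k, l)) = 0.
Proof. by apply: (addrI (realify (0 : 'M[C]_(k, l)))); rewrite -realifyD !addr0. Qed.

Lemma realify_inj k l : injective (@realify k l).
Proof.
move=> z w /eq_row_mx[/rowP h1 /rowP h2]; apply: (can_inj mxvecK); apply/rowP => i.
have := h1 i; have := h2 i; rewrite !mxE.
by case: (_ 0 i) => ? ?; case: (_ 0 i) => ? ? /= -> ->.
Qed.

Lemma Re_horner (p : {poly C}) (t : R) : Re p.[(t%:C)%C] = (map_poly Re p).[t].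
Proof.
rewrite horner_coef (@horner_coef_wide _ (size p)) ?size_poly //.
have ReD (x y : C) : Re (x + y) = Re x + Re y by case: x; case: y.
rewrite (big_morph Re ReD (erefl : Re 0 = 0)); apply: eq_bigr => i _.
by rewrite -rmorphXn /= mulrC Re_scale coef_map_id0 // mulrC.
Qed.
Lemma Im_horner (p : {poly C}) (t : R) : Im p.[(t%:C)%C] = (map_poly Im p).[t].
Proof.
rewrite horner_coef (@horner_coef_wide _ (size p)) ?size_poly //.
have ImD (x y : C) : Im (x + y) = Im x + Im y by case: x; case: y.
rewrite (big_morph Im ImD (erefl : Im 0 = 0)); apply: eq_bigr => i _.
by rewrite -rmorphXn /= mulrC Im_scale coef_map_id0 // mulrC.
Qed.

(** With N a right inverse at t0, the determinant of M N is a polynomial in t that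
    is 1 at t0. *)
Lemma row_free_cofinite k d (M : 'M[{poly R}]_(k, d)) t0 :
  row_free (map_mx (horner_eval t0) M) ->
  exists s : seq R, forall t, t \notin s -> row_free (map_mx (horner_eval t) M).
Proof.
move=> /row_freeP[N MN].
pose p := \det (M *m map_mx polyC N).
have pE t : p.[t] = \det (map_mx (horner_eval t) M *m N).
  rewrite -[LHS]/(horner_eval t p) -det_map_mx map_mxM; congr (\det (_ *m _)).
  by apply/matrixP => i j; rewrite !mxE /= /horner_eval hornerC.
have pC t : (map_poly (real_complex R) p).[(t%:C)%C] = ((p.[t])%:C)%C by rewrite horner_map.
have [|s sP] := @poly_cofinite _ (map_poly (real_complex R) p) (t0%:C)%C.
  by rewrite pC pE MN det1 oner_eq0.
have [s' s'P] := cofinite_real (ex_intro _ s sP).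
exists s' => t /s'P; rewrite pC pE => nz; apply/row_freeP.
have u : map_mx (horner_eval t) M *m N \in unitmx.
  by rewrite unitmxE unitfE; apply: contraNneq nz => ->.
by exists (N *m invmx (map_mx (horner_eval t) M *m N)); rewrite mulmxA mulmxV.
Qed.

Definition bracket_mx N k (y : 'I_k -> 'M[C]_N) (X : 'M[C]_N) :=
  \matrix_i realify (y i *m X - X *m y i).

Lemma eq_bracket_mx N k (y y' : 'I_k -> 'M[C]_N) (X X' : 'M[C]_N) :
  (forall i, y i *m X - X *m y i = y' i *m X' - X' *m y' i) ->
  bracket_mx y X = bracket_mx y' X'.
Proof. by move=> h; apply/matrixP => i j; rewrite [LHS]mxE [RHS]mxE h. Qed.

(** Re and Im of a polynomial in a real parameter are real polynomials in it. *)
Lemma bracket_cofinite N k (y : 'I_k -> 'M[C]_N) (X : 'M[{poly C}]_N) (t0 : R) :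
  row_free (bracket_mx y (map_mx (horner_eval (t0%:C)%C) X)) ->
  exists s : seq R, forall t, t \notin s ->
    row_free (bracket_mx y (map_mx (horner_eval (t%:C)%C) X)).
Proof.
pose Y i := map_mx polyC (y i) *m X - X *m map_mx polyC (y i).
pose M : 'M[{poly R}]_(k, N * N + N * N) := \matrix_i
  row_mx (map_mx (map_poly Re) (mxvec (Y i))) (map_mx (map_poly Im) (mxvec (Y i))).
suff ME t : bracket_mx y (map_mx (horner_eval (t%:C)%C) X) = map_mx (horner_eval t) M.
  by rewrite ME => /row_free_cofinite[s sP]; exists s => t /sP; rewrite ME.
have YE i : map_mx (horner_eval (t%:C)%C) (Y i) = y i *m map_mx (horner_eval (t%:C)%C) X -
    map_mx (horner_eval (t%:C)%C) X *m y i.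
  by rewrite map_mxB !map_mxM /= !map_horner_polyC.
apply/row_matrixP => i; rewrite -map_row !rowK -YE map_row_mx /realify.
congr row_mx; apply/rowP => j; rewrite !mxE; case/mxvec_indexP: j => u v.
  by rewrite !mxvecE !mxE /horner_eval Re_horner.
by rewrite !mxvecE !mxE /horner_eval Im_horner.
Qed.

End Realify.

Section Orbits.
Variables (R : realType) (b : base) (m n : nat) (P : pair_datum R b m n).
Local Notation D := (dring R b).
Local Notation C := R[i].
Hypothesis hP : dual_pair P.

Lemma of_real1 : of_real b 1 = 1 :> D. Proof. by case: b. Qed.
Lemma of_real0 : of_real b 0 = 0 :> D. Proof. by case: b. Qed.

(** The tangent space of the orbit of x has dimension at least k. Unlike
    an exact dimension, this is a generic condition on x. *)
Definition orbit_rank_ge (x : 'M[D]_(m + n)) k :=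
  exists y : 'I_k -> 'M[D]_(m + n), (forall i, s_even P (y i)) /\
    row_free (bracket_mx (fun i => cplx (y i)) (cplx x)).

Lemma cplx_sum k N (f : 'I_k -> 'M[D]_N) (c : 'rV[R]_k) :
  realify (cplx (\sum_(i < k) of_real b (c 0 i) *: f i)) =
  c *m \matrix_i realify (cplx (f i)).
Proof.
rewrite mulmx_sum_row (big_morph (fun z => realify (cplx z)) (id1 := 0) (op1 := +%R)).
- by apply: eq_bigr => i _; rewrite cplxZ realifyZ rowK.
- by move=> x y; rewrite cplxD realifyD.
- by rewrite cplx0 realify0.
Qed.

Lemma s_even0 : s_even P 0.
Proof.
split; first by split; apply/matrixP => i j; rewrite !mxE.
case: P => // t B0 B1 /= u v; rewrite !mul0mx !form_dag dag0 !mul0mx !mulmx0.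
by rewrite !mxE addr0.
Qed.

Lemma orbit_dim_rank x k : orbit_dim P x k -> orbit_rank_ge x k.
Proof.
case=> f [fT fB].
have /choice[y yP] : forall i, exists y, s_even P y /\ f i = y *m x - x *m y.
  by move=> i; have [y ys yE] := fT i; exists y.
exists y; split; first by move=> i; have [] := yP i.
have -> : bracket_mx (fun i => cplx (y i)) (cplx x) = \matrix_i realify (cplx (f i)).
  by apply/row_matrixP => i; rewrite !rowK -!cplxM -cplxB; have [_ <-] := yP i.
apply: inj_row_free => c c0.
have [|c' [_ c'U]] := fB 0.
  by exists 0; [exact: s_even0 | rewrite mul0mx mulmx0 subr0].
rewrite -(c'U c) ?(c'U 0) //.
- by rewrite big1 // => i _; rewrite mxE of_real0 scale0r.
- by apply/cplx_inj/realify_inj; rewrite cplx_sum c0 cplx0 realify0.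
Qed.

Lemma orbit_rank_le_dim x k l : orbit_rank_ge x l -> orbit_dim P x k -> (l <= k)%N.
Proof.
move=> [y [ys yfree]] [f [fT fB]].
have /choice[c cP] : forall i : 'I_l, exists c : 'rV[R]_k,
    y i *m x - x *m y i = \sum_(j < k) of_real b (c 0 j) *: f j.
  move=> i; have [|c [cE _]] := fB (y i *m x - x *m y i); last by exists c.
  by exists (y i).
have : bracket_mx (fun i => cplx (y i)) (cplx x) =
    (\matrix_i c i) *m \matrix_j realify (cplx (f j)).
  apply/row_matrixP => i; rewrite row_mul !rowK -!cplxM -cplxB cP cplx_sum //.
move=> E; move: yfree; rewrite /row_free E => /eqP <-.
exact: leq_trans (mxrankM_maxl _ _) (rank_leq_col _).
Qed.

(** Ranks are bounded, so the maximum over any nonempty family is attained. *)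
Lemma max_orbit_rank (Q : 'M[D]_(m + n) -> Prop) x0 : Q x0 ->
  exists K x, [/\ Q x, orbit_rank_ge x K & forall y l, Q y -> orbit_rank_ge y l -> (l <= K)%N].
Proof.
move=> Qx0; pose p k := `[< exists x, Q x /\ orbit_rank_ge x k >].
have p0 : exists k, p k.
  exists 0%N; apply/asboolP; exists x0; split => //; exists (fun=> 0).
  split=> [[]//|]; by rewrite /row_free flatmx0 mxrank0.
have pb k : p k -> (k <= cdim b (m + n) * cdim b (m + n) + cdim b (m + n) * cdim b (m + n))%N.
  by move=> /asboolP[x [_ [y [_ /eqP <-]]]]; apply: rank_leq_col.
case: (ex_maxnP p0 pb) => K /asboolP[x [Qx xK]] Kmax; exists K, x; split => // y l Qy yl.
by apply: Kmax; apply/asboolP; exists y.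
Qed.

Lemma regular_of_rank x K : odd_semisimple P x -> x != 0 -> orbit_rank_ge x K ->
  (forall y l, odd_semisimple P y -> orbit_rank_ge y l -> (l <= K)%N) ->
  regular_semisimple P x.
Proof.
move=> xs xnz xK Kmax; split => // y ys k l xk yl.
apply: leq_trans (Kmax _ _ ys (orbit_dim_rank yl)) _.
exact: orbit_rank_le_dim xK xk.
Qed.

Lemma conjugate_refl x : conjugate P x x.
Proof.
exists 1%:M, 1%:M; split; last by rewrite mul1mx mulmx1.
  split.
  - by split; rewrite scalar_mx_block (block_mxKur, block_mxKdl).
  - by exists 1%:M; split; rewrite mul1mx.
  - by case: P => //= t B0 B1 u v; rewrite !mul1mx.
by split; rewrite mul1mx.
Qed.

(** Take for h_1 the double anticommutant of xs. It kills the nilpotent part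
    x - xs, whose image is therefore contained in V^0; and x - xs vanishes on V^+,
    as it anticommutes with h_1. *)
Lemma almost_semisimple_split x xs : s_odd P x -> s_odd P (x - xs) ->
    regular_semisimple P xs -> anticommute xs (x - xs) ->
    (forall z, double_anticommutant P xs z -> z *m (x - xs) = 0) ->
  almost_semisimple P x.
Proof.
move=> xo no xr anti kill; split => //.
exists (double_anticommutant P xs); first by exists xs.
exists x; last exact: conjugate_refl.
exists (x - xs), xs; split; last by rewrite subrK.
- split => //.
    by move=> v _ z /kill zn; rewrite mulmxA zn mul0mx.
  move=> v [k [z [u [zh ->]]]]; rewrite mulmx_sumr big1 // => i _.
  have [_ /(_ (x - xs))] := zh i; rewrite /anticommute (kill _ (zh i)) add0r => e.
  by rewrite mulmxA e ?mul0mx.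
- have [[xso _] _ _] := xr; split => // y [_ yx]; exact: yx.
Qed.

Lemma regular_almost_semisimple x : regular_semisimple P x -> almost_semisimple P x.
Proof.
move=> xr; have [[xs _] _ _] := xr.
apply: (almost_semisimple_split xs _ xr); rewrite subrr; first exact: s_odd0.
  by rewrite /anticommute mulmx0 mul0mx addr0.
by move=> z _; rewrite mulmx0.
Qed.

Lemma orbit_rank_line_cofinite x y K (t0 : R) :
  orbit_rank_ge (x + of_real b t0 *: y) K ->
  exists s : seq R, forall t, t \notin s -> orbit_rank_ge (x + of_real b t *: y) K.
Proof.
case=> z [zs]; rewrite cplxD cplxZ -plineE => /bracket_cofinite[s sP].
by exists s => t /sP h; exists z; split => //; rewrite cplxD cplxZ -plineE.
Qed.

Lemma simple_odd_line_cofinite x y (t0 : R) : @simple_odd R b m n (cplx (x + of_real b t0 *: y)) ->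
  exists s : seq R, forall t, t \notin s -> @simple_odd R b m n (cplx (x + of_real b t *: y)).
Proof.
rewrite cplxD cplxZ => /(simple_odd_cofinite hP)/cofinite_real[s sP].
by exists s => t /sP; rewrite cplxD cplxZ.
Qed.

End Orbits.

(** * Density of regular semisimple elements outside the exceptional pairs *)

Section Closure.
Variable R : realType.
Local Notation C := R[i].

Lemma complex_of_real_cvg : (fun t : R => (t%:C)%C : (C^o)%type) @ (0 : R)^' --> (0 : (C^o)%type).
Proof.
apply/cvgr0Pnorm_lt => e e0.
have [r r0 er] : exists2 r : R, 0 < r & e = (r%:C)%C.
  exists (complex.Re e); case: e e0 => a c; rewrite ltcE /= => /andP[/eqP c0 a0] //.
  by rewrite c0.
near=> t.
have -> : `|(t%:C)%C : (C^o)%type| = (`|t|%:C)%C.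
  by rewrite normc_def /= expr0n addr0 sqrtr_sqr.
rewrite er ltcR; near: t; apply: dnbhs0_lt => //.
Unshelve. all: by end_near. Qed.

Lemma of_real_line_cvg b (u v : dring R b) :
  (fun t : R => u + of_real b t * v) @ (0 : R)^' --> u.
Proof.
have cC (u0 v0 : C) : (fun t : R => u0 + (t%:C)%C * v0 : (C^o)%type) @ (0 : R)^' --> (u0 : (C^o)%type).
  rewrite -[X in _ --> X]addr0; apply: cvgD; first exact: cvg_cst.
  rewrite -[X in _ --> X](mul0r v0); apply: cvgM; [exact: complex_of_real_cvg|exact: cvg_cst].
case: b u v => u v /=.
- have : (fun t : R => (u : R) + t * (v : R)) @ (0 : R)^' --> (u : R).
    rewrite -[X in _ --> X]addr0; apply: cvgD; first exact: cvg_cst.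
    rewrite -[X in _ --> X](mul0r (v : R)); apply: cvgM; last exact: cvg_cst.
    exact: cvg_within_filter.
  exact.
- exact: cC.
- case: u v => u1 u2 [v1 v2].
  have E (t : R) : ((u1, u2) : quaternions R) +
        (((t%:C)%C, 0) : quaternions R) * ((v1, v2) : quaternions R) =
      (u1 + (t%:C)%C * v1, u2 + (t%:C)%C * v2) :> quaternions R.
    change (((u1, u2) : quaternions R) + quat_mul ((t%:C)%C, 0) (v1, v2) =
      (u1 + (t%:C)%C * v1, u2 + (t%:C)%C * v2) :> quaternions R).
    rewrite /quat_mul /=.
    have k1 (p q w z : C) : p + (q * w - 0 * z) = p + q * w by ring.
    have k2 (p q w z : C) : p + (q * w + 0 * z) = p + q * w by ring.
    by congr pair; [exact: k1 | exact: k2].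
  under eq_fun do rewrite E.
  have := @cvg_pair R (C^o)%type (C^o)%type (0 : R)^' (nbhs (u1 : (C^o)%type))
    (nbhs (u2 : (C^o)%type)) _ _ _ _ _ (cC u1 v1) (cC u2 v2).
  exact.
Qed.

(** The points of the line through x close to x, except x itself and finitely many
    others, all lie in A. *)
Lemma closure_line b k l (A : set 'M[dring R b]_(k, l)) x y :
  (exists s : seq R, forall t, t \notin s -> A (x + of_real b t *: y)) -> closure A x.
Proof.
case=> s sP B [Q Qx QB].
have near_s : \forall t \near (0 : R)^', t \notin s.
  elim: s {sP} => [|r s IH]; first by near=> t.
  have near_r : \forall t \near (0 : R)^', t != r.
    have [->|rn] := eqVneq r 0; first exact: nbhs_dnbhs_neq.
    have r0 : 0 < `|r| by rewrite normr_gt0.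
    near=> t; have : `|t| < `|r| by near: t; exact: dnbhs0_lt.
    by apply: contraTneq => ->; rewrite ltxx.
  near=> t; rewrite inE negb_or; apply/andP; split; by near: t.
have nearQ : \forall t \near (0 : R)^', forall i j, Q i j ((x + of_real b t *: y) i j).
  apply: filter_forall => i; apply: filter_forall => j.
  have := @of_real_line_cvg b (x i j) (y i j) _ (Qx i j).
  rewrite /= !nbhs_simpl /=; apply: filterS => t; by rewrite !mxE.
have [t [ts tQ]] : exists t : R, t \notin s /\ forall i j, Q i j ((x + of_real b t *: y) i j).
  apply: (@filter_ex _ (0 : R)^'); near=> t; split; by near: t.
by exists (x + of_real b t *: y); split; [exact: sP | exact: QB].
Unshelve. all: by end_near. Qed.

End Closure.

Section NonExceptional.
Variables (R : realType) (b : base) (m n : nat) (P : pair_datum R b m n).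
Hypothesis hP : dual_pair P.
Hypothesis nex : ~ [/\ orthosymplectic P, odd m & (m < n)%N].

Lemma line_at1 (x y : 'M[dring R b]_(m + n)) : x + of_real b 1 *: (y - x) = y.
Proof. by rewrite of_real1 scale1r addrC subrK. Qed.

Lemma line_at0 (x y : 'M[dring R b]_(m + n)) : x + of_real b 0 *: y = x.
Proof. by rewrite of_real0 scale0r addr0. Qed.

Lemma s_odd_sub x y : s_odd P x -> s_odd P y -> s_odd P (x - y).
Proof.
move=> xs ys; have := s_odd_line hP (-1) xs ys.
have -> : of_real b (-1) = -1 :> dring R b.
  case: (b) => //=; rewrite -?[LHS]/(real_complex R (-1)) ?rmorphN1 //.
  by congr pair; rewrite ?oppr0 // rmorphN1.
by rewrite scaleN1r.
Qed.

Lemma simple_odd_nz x : @simple_odd R b m n (cplx x) -> x != 0.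
Proof.
have [m0 n0 _] := hP.
apply: contraPneq => ->; rewrite cplx0 /simple_odd /lower_block /upper_block !mulmx0 !mul0mx.
have det0' N : (0 < N)%N -> \det (0 : 'M[R[i]]_N) = 0.
  by case: N => // N _; rewrite det0.
by case=> -[_]; rewrite det0' ?eqxx //; apply: cdim_gt0.
Qed.

(** Both conditions, simplicity of the spectrum and maximality of the rank, are
    generic on the line joining two points at which one of them holds. *)
Lemma exists_maximal_simple_odd : exists x K, [/\ s_odd P x, @simple_odd R b m n (cplx x),
  orbit_rank_ge P x K & forall y l, s_odd P y -> orbit_rank_ge P y l -> (l <= K)%N].
Proof.
have [x1 [x2 [x1s x2s g]]] := exists_simple_odd hP nex.
have [t1 g1] : exists t : R, @simple_odd R b m n (cplx (x1 + of_real b t *: x2)).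
  have /cofinite_real/cofinite_ex[t tP] := simple_odd_cofinite hP g.
  by exists t; rewrite cplxD cplxZ.
pose xg := x1 + of_real b t1 *: x2; have xgs : s_odd P xg := s_odd_line hP t1 x1s x2s.
have [K [xr [xrs xrK Kmax]]] := @max_orbit_rank _ _ _ _ P (s_odd P) _ xgs.
have dxs := s_odd_sub xgs xrs.
have [|s1 s1P] := @orbit_rank_line_cofinite _ _ _ _ P xr (xg - xr) K 0.
  by rewrite line_at0.
have [|s2 s2P] := @simple_odd_line_cofinite _ _ _ _ P hP xr (xg - xr) 1.
  by rewrite line_at1.
have [t [h1 h2]] := cofinite_ex (cofinite_and (ex_intro _ s1 s1P) (ex_intro _ s2 s2P)).
by exists (xr + of_real b t *: (xg - xr)), K; split => //; exact: s_odd_line.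
Qed.

Lemma regular_semisimple_dense x0 : s_odd P x0 -> closure (regular_semisimple P) x0.
Proof.
move=> x0s; have [x [K [xs gx xK Kmax]]] := exists_maximal_simple_odd.
have dxs := s_odd_sub xs x0s.
apply: (closure_line (y := x - x0)).
have [|s1 s1P] := @orbit_rank_line_cofinite _ _ _ _ P x0 (x - x0) K 1.
  by rewrite line_at1.
have [|s2 s2P] := @simple_odd_line_cofinite _ _ _ _ P hP x0 (x - x0) 1.
  by rewrite line_at1.
have [s sP] := cofinite_and (ex_intro _ s1 s1P) (ex_intro _ s2 s2P).
exists s => t /sP[rk g]; have ts := s_odd_line hP t x0s dxs.
apply: (regular_of_rank _ (simple_odd_nz g) rk).
  by split => //; exact: (simple_odd_semisimple hP ts g).
by move=> y l [ys _]; exact: Kmax.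
Qed.

End NonExceptional.

(** * Genericity of the semisimple part *)

Section BracketRank.
Variables (R : realType) (K : fieldType) (f : {rmorphism K -> R[i]}) (N : nat).
Variable Ev : 'M[K]_N -> Prop.
Hypothesis EvZ : forall c y, Ev y -> Ev (c *: y).

(** The analogue over K of orbit_rank_ge, for a subspace Ev of even elements. *)
Definition bracket_rank_ge (x : 'M[K]_N) k :=
  exists y : 'I_k -> 'M[K]_N, (forall i, Ev (y i)) /\
    row_free (bracket_mx (fun i => map_mx f (y i)) (map_mx f x)).

Lemma bracket_rank_geZ c x k : bracket_rank_ge (c *: x) k -> bracket_rank_ge x k.
Proof.
move=> [y [ys yf]]; exists (fun i => c *: y i); split; first by move=> i; exact: EvZ.
rewrite (eq_bracket_mx (y' := fun i => map_mx f (y i)) (X' := map_mx f (c *: x))) // => i.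
rewrite -!map_mxM -!map_mxB; congr map_mx.
by rewrite -!scalemxAl -!scalemxAr.
Qed.
End BracketRank.

Section GenericCore.
Variable R : realType.
Local Notation C := R[i].
Variables (K : fieldType) (f : {rmorphism K -> C}) (g : {rmorphism R -> K}).
Hypothesis fg : forall t, f (g t) = (t%:C)%C.
Hypothesis span : forall k l (z : 'M[C]_(k, l)), exists a1 a2 : 'M[K]_(k, l),
  z = map_mx f a1 + 'i%C *: map_mx f a2.
Variables (m'' n : nat).
Local Notation m' := m''.+1.
Local Notation m := m'.+1.
Hypothesis ev_m' : ~~ odd m'.
Hypothesis mn : (m < n)%N.
Variables (B0 : 'M[K]_m) (B1 : 'M[K]_n).
Hypothesis B0T : B0^T = B0.
Hypothesis B1T : B1^T = - B1.
Hypothesis B0u : B0 \in unitmx.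
Hypothesis B1u : B1 \in unitmx.
Local Notation Z := (invmx B0).
Local Notation star := (osp_adjoint Z B1).
Local Notation gram := (osp_square Z B1).
Local Notation core := (osp_core Z B1).
Local Notation oddm := (osp_odd Z B1).
Local Notation ss := (semisimple_part B0 B1).
Implicit Types (a : 'M[K]_(n, m)).

Variable Ev : 'M[K]_(m + n) -> Prop.
Hypothesis EvZ : forall c y, Ev y -> Ev (c *: y).
Local Notation bracket_rank_ge := (bracket_rank_ge f Ev).

Lemma oddmZ c a : oddm (c *: a) = c *: oddm a.
Proof. by rewrite /osp_odd osp_adjointZ scale_block_mx !scaler0. Qed.

(* pl a d is the line a + t d over the polynomials in t, to which the constructions
   on a are applied as they stand. *)
Let fZ := map_mx f Z.
Let fB1 := map_mx f B1.
Let pZ : 'M[{poly C}]_m := map_mx polyC fZ.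
Let pB1 : 'M[{poly C}]_n := map_mx polyC fB1.
Let pl a d : 'M[{poly C}]_(n, m) := pline (map_mx f a) (map_mx f d).

Lemma pl_eval a d (t : R) :
  map_mx (horner_eval (t%:C)%C) (pl a d) = map_mx f (a + g t *: d).
Proof. by rewrite plineE map_mxD map_mxZ /= fg. Qed.

Lemma oddm_eval a d t : map_mx (horner_eval (t%:C)%C) (osp_odd pZ pB1 (pl a d)) =
  map_mx f (oddm (a + g t *: d)).
Proof. by rewrite !map_osp_odd /= !map_horner_polyC pl_eval. Qed.

Lemma core_eval a d t : map_mx (horner_eval (t%:C)%C) (osp_odd pZ pB1 (osp_core pZ pB1 (pl a d))) =
  map_mx f (oddm (core (a + g t *: d))).
Proof. by rewrite !map_osp_odd !map_osp_core /= !map_horner_polyC pl_eval. Qed.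

Lemma gram_eval a d t : map_mx (horner_eval (t%:C)%C) (osp_square pZ pB1 (pl a d)) =
  map_mx f (gram (a + g t *: d)).
Proof. by rewrite !map_osp_square /= !map_horner_polyC pl_eval. Qed.

Lemma rank_line_cofinite a d k (t0 : R) : bracket_rank_ge (oddm (a + g t0 *: d)) k ->
  exists s : seq R, forall t, t \notin s -> bracket_rank_ge (oddm (a + g t *: d)) k.
Proof.
case=> y [ys]; rewrite -oddm_eval => /bracket_cofinite[s sP].
by exists s => t /sP h; exists y; rewrite -oddm_eval.
Qed.

Lemma rank_core_cofinite a d k (t0 : R) : bracket_rank_ge (oddm (core (a + g t0 *: d))) k ->
  exists s : seq R, forall t, t \notin s -> bracket_rank_ge (oddm (core (a + g t *: d))) k.
Proof.
case=> y [ys]; rewrite -core_eval => /bracket_cofinite[s sP].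
by exists s => t /sP h; exists y; rewrite -core_eval.
Qed.

Definition simple_square a := simple_spectrum (map_mx f (gram a)).

Lemma simple_square_cofinite a d (t0 : R) : simple_square (a + g t0 *: d) ->
  exists s : seq R, forall t, t \notin s -> simple_square (a + g t *: d).
Proof.
rewrite /simple_square -gram_eval => /separable_cofinite[//|s sP].
have [s' s'P] := cofinite_real (ex_intro _ s sP).
by exists s' => t /s'P; rewrite gram_eval.
Qed.

Lemma q0_cofinite a d (t0 : R) : (reduced_char_poly (gram (a + g t0 *: d)))`_0 != 0 ->
  exists s : seq R, forall t, t \notin s -> (reduced_char_poly (gram (a + g t *: d)))`_0 != 0.
Proof.
have e t : f (reduced_char_poly (gram (a + g t *: d)))`_0 =
    ((reduced_char_poly (osp_square pZ pB1 (pl a d)))`_0).[(t%:C)%C].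
  rewrite -[RHS]/(horner_eval _ _) -!coef_map !map_reduced_char_poly -gram_eval //.
have fe (q : K) : (q != 0) = (f q != 0) by rewrite fmorph_eq0.
move/(etrans (esym (fe _))); rewrite e.
move: e; move: ((reduced_char_poly (osp_square pZ pB1 (pl a d)))`_0) => p e /poly_cofinite[s sP].
have [s' s'P] := cofinite_real (ex_intro _ s sP).
by exists s' => t /s'P; rewrite -e fmorph_eq0.
Qed.

Lemma line1 (x y : 'M[K]_(n, m)) : x + g 1 *: (y - x) = y.
Proof. by rewrite rmorph1 scale1r addrC subrK. Qed.
Lemma line0 (x y : 'M[K]_(n, m)) : x + g 0 *: y = x.
Proof. by rewrite rmorph0 scale0r addr0. Qed.

Lemma nz2K : 2%:R != 0 :> K.
Proof. by rewrite -(fmorph_eq0 f) rmorph_nat pnatr_eq0. Qed.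

(** From a1 + i a2, given by osp_point_odd, to a1 + t a2 for a generic real t. *)
Lemma exists_simple_square : exists a, simple_square a.
Proof.
have [||||||aC [c [ac s]]] := @osp_point_odd C m n (map_mx f B0) fB1.
- by rewrite map_trmx B0T.
- by rewrite map_trmx B1T map_mxN.
- by rewrite map_unitmx.
- by rewrite map_unitmx.
- by rewrite /= ev_m'.
- exact: ltnW.
have cE : c = osp_adjoint fZ fB1 aC.
  rewrite /osp_adjoint -mulmxA -ac mulmxA /fZ map_invmx mulVmx ?mul1mx //.
  by rewrite map_unitmx.
have [a1 [a2 aE]] := span aC.
have : simple_spectrum (map_mx (horner_eval 'i%C) (osp_square pZ pB1 (pl a1 a2))).
  by rewrite map_osp_square !map_horner_polyC plineE -aE /osp_square -cE.
move=> /separable_cofinite[//|s' /(ex_intro _ s')/cofinite_real/cofinite_ex[t]].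
by rewrite gram_eval => h; exists (a1 + g t *: a2).
Qed.

(** A semisimple element kills an anisotropic vector u. Moving it, within the
    elements killing u, to a generic one a1 does not decrease the rank and makes
    p(0) nonzero; there the core is p(0) a1, of the same rank. Moving a1 to a
    generic a2 then keeps the rank of the core and makes the spectrum of A
    simple. *)
Lemma exists_simple_square_rank a k : complex_semisimple f (oddm a) -> bracket_rank_ge (oddm a) k ->
  exists a2, simple_square a2 /\ bracket_rank_ge (oddm (core a2)) k.
Proof.
move=> sa ra; have [u [au uu]] := semisimple_anisotropic_kernel nz2K ev_m' B0T B1T B0u sa.
have m'n : (m' <= n)%N by apply: leq_trans (ltnW mn).
have [a' [a'u q0]] := exists_degenerate_simple nz2K ev_m' m'n B0T B1T B0u B1u uu.
have [|s1 s1P] := @q0_cofinite a (a' - a) 1; first by rewrite line1.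
have [|s2 s2P] := @rank_line_cofinite a (a' - a) k 0; first by rewrite line0.
have [t [h1 h2]] := cofinite_ex (cofinite_and (ex_intro _ s1 s1P) (ex_intro _ s2 s2P)).
set a1 := a + g t *: (a' - a) in h1 h2.
have a1u : a1 *m u = 0 by rewrite mulmxDl -scalemxAl mulmxBl au a'u subrr scaler0 addr0.
have r1 : bracket_rank_ge (oddm (core a1)) k.
  rewrite (core_degenerate B1 B0T B0u uu a1u) oddmZ.
  move: h1; move: ((reduced_char_poly (gram a1))`_0) => q qnz.
  apply: (bracket_rank_geZ EvZ (c := q^-1)).
  have -> : q^-1 *: (q *: oddm a1) = oddm a1 by rewrite scalerA (mulVf qnz) scale1r.
  exact: h2.
have [ag sg] := exists_simple_square.
have [|s3 s3P] := @simple_square_cofinite a1 (ag - a1) 1; first by rewrite line1.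
have [|s4 s4P] := @rank_core_cofinite a1 (ag - a1) k 0; first by rewrite line0.
have [t' [h3 h4]] := cofinite_ex (cofinite_and (ex_intro _ s3 s3P) (ex_intro _ s4 s4P)).
by exists (a1 + g t' *: (ag - a1)).
Qed.

(** x_s has the same square A as x; if it were 0 then p = 'X^(m - 1) and p(0) = 0. *)
Lemma simple_semisimple_part_nz a : simple_square a -> ss a != 0.
Proof.
move=> sa; have [q0 _ _] := simple_osp_square nz2K ev_m' B0T B1T B0u sa.
apply/eqP => ss0; have := osp_square_semisimple_part nz2K ev_m' B0T B1T B0u a.
rewrite ss0 {1}/osp_square mulmx0 => g0; move: q0; rewrite -g0 /reduced_char_poly.
have -> : char_poly (0 : 'M[K]_m) = 'X^m.
  by rewrite /char_poly /char_poly_mx map_mx0 subr0 det_scalar.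
by rewrite coef_drop_poly coefXn eqxx.
Qed.

End GenericCore.

(** * Almost semisimple elements of the exceptional pairs *)

Section Split.
Variables (R : realType) (b : base) (m n : nat) (P : pair_datum R b m n).
Hypothesis hP : dual_pair P.

(** A generic x admits a decomposition as in almost_semisimple_split, in which the
    orbit of xs is at least as large as that of a given semisimple y0. *)
Definition generic_split := forall y0 k, odd_semisimple P y0 -> orbit_rank_ge P y0 k ->
  exists x2, s_odd P x2 /\ forall x0, s_odd P x0 -> exists s : seq R, forall t, t \notin s ->
    let x := x0 + of_real b t *: (x2 - x0) in
    exists xs, [/\ odd_semisimple P xs /\ xs != 0, orbit_rank_ge P xs k, s_odd P (x - xs),
      anticommute xs (x - xs) & forall z, double_anticommutant P xs z -> z *m (x - xs) = 0].

(** Applied to y0 of maximal rank, the decomposition has a regular xs. *)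
Lemma almost_semisimple_dense x0 : generic_split -> s_odd P x0 ->
  closure (almost_semisimple P) x0.
Proof.
move=> gs x0s.
have ss0 : odd_semisimple P 0.
  split; first exact: s_odd0.
  by rewrite semisimpleE cplx0; exact: diagonalizable0.
have [K [y0 [y0s y0K Kmax]]] := @max_orbit_rank _ _ _ _ P (odd_semisimple P) _ ss0.
have [x2 [x2s h]] := gs _ _ y0s y0K.
have [s sP] := h _ x0s; apply: (closure_line (y := x2 - x0)).
exists s => t /sP[xs [[xss xsnz] xsK no anti kill]].
have xo := s_odd_line hP t x0s (s_odd_sub hP x2s x0s).
by apply: (almost_semisimple_split xo no (regular_of_rank xss xsnz xsK Kmax) anti kill).
Qed.

End Split.

Section Topology.

Lemma mx_entry_cvg (T : topologicalType) k l (x0 : 'M[T]_(k, l)) i j :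
  (fun x : 'M[T]_(k, l) => x i j) @ x0 --> x0 i j.
Proof.
move=> B Bx.
exists (fun i' j' => if (i' == i) && (j' == j) then B else setT).
  by move=> i' j'; case: ifP => [/andP[/eqP -> /eqP ->] //|_]; exact: filterT.
by move=> N /(_ i j); rewrite !eqxx.
Qed.

Lemma det_cvg (K : numFieldType) (T : Type) (F : set_system T) (FF : Filter F) k
    (M : T -> 'M[K]_k) (M0 : 'M[K]_k) :
  (forall i j, (fun x => M x i j : (K^o)%type) @ F --> (M0 i j : (K^o)%type)) ->
  (fun x => \det (M x) : (K^o)%type) @ F --> (\det M0 : (K^o)%type).
Proof.
move=> h.
have hs I (r : seq I) (G : I -> T -> (K^o)%type) (L : I -> (K^o)%type) :
    (forall i, G i @ F --> L i) -> (fun x => \sum_(i <- r) G i x) @ F --> \sum_(i <- r) L i.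
  move=> hG; elim: r => [|i r IH].
    rewrite big_nil; under eq_fun do rewrite big_nil; exact: cvg_cst.
  rewrite big_cons; under eq_fun do rewrite big_cons; exact: cvgD.
have hp I (r : seq I) (G : I -> T -> (K^o)%type) (L : I -> (K^o)%type) :
    (forall i, G i @ F --> L i) -> (fun x => \prod_(i <- r) (G i x : K) : (K^o)%type) @ F -->
      (\prod_(i <- r) (L i : K) : (K^o)%type).
  move=> hG; elim: r => [|i r IH].
    rewrite big_nil; under eq_fun do rewrite big_nil; exact: cvg_cst.
  rewrite big_cons; under eq_fun do rewrite big_cons; exact: cvgM.
rewrite /determinant; apply: hs => s; apply: cvgM; first exact: cvg_cst.
by apply: hp => i; exact: h.
Qed.

Lemma real_complex_cvg (R : realType) (r0 : R) :
  (fun r : R => (r%:C)%C : (R[i]^o)%type) @ r0 --> ((r0%:C)%C : (R[i]^o)%type).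
Proof.
apply/cvgrPdist_lt => e e0.
have [r rp er] : exists2 r : R, 0 < r & e = (r%:C)%C.
  exists (complex.Re e); case: e e0 => a c; rewrite ltcE /= => /andP[/eqP c0 a0] //.
  by rewrite c0.
near=> t.
have -> : `|((r0%:C)%C - (t%:C)%C) : (R[i]^o)%type| = (`|r0 - t|%:C)%C.
  by rewrite -rmorphB normc_def /= expr0n addr0 sqrtr_sqr.
rewrite er ltcR; near: t; exact: cvgr_dist_lt.
Unshelve. all: by end_near. Qed.

End Topology.

(** In the exceptional pairs D is R or C. To deal with both at once, D is identified
    by toK with an abstract field K, over which the results on orthosymplectic
    elements apply, with g and f for the inclusions of R in K and of K in C. *)
Section Transport.
Variables (R : realType) (b : base) (t : involution b) (m'' n : nat).
Local Notation C := R[i].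
Local Notation D := (dring R b).
Local Notation m' := m''.+1.
Local Notation m := m'.+1.
Variables (B0 : 'M[D]_m) (B1 : 'M[D]_n).
Local Notation P := (TypeI t B0 B1).
Hypothesis hP : dual_pair P.
Hypothesis ev_m' : ~~ odd m'.
Hypothesis mn : (m < n)%N.
Variables (K : fieldType) (f : {rmorphism K -> C}) (g : {rmorphism R -> K}).
Hypothesis fg : forall r, f (g r) = (r%:C)%C.
Variable toK : forall k l, 'M[D]_(k, l) -> 'M[K]_(k, l).
Variable ofK : forall k l, 'M[K]_(k, l) -> 'M[D]_(k, l).
Arguments toK {k l}.
Arguments ofK {k l}.
Hypothesis toKK : forall k l, cancel (@toK k l) ofK.
Hypothesis ofKK : forall k l, cancel (@ofK k l) toK.
Hypothesis toKD : forall k l, {morph (@toK k l) : x y / x + y}.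
Hypothesis toKM : forall k l p (x : 'M[D]_(k, l)) (y : 'M[D]_(l, p)), toK (x *m y) = toK x *m toK y.
Hypothesis toKZ : forall k l r (x : 'M[D]_(k, l)), toK (of_real b r *: x) = g r *: toK x.
Hypothesis toK_block : forall k l p q (x : 'M[D]_(k, l)) (y : 'M[D]_(k, q)) (z : 'M[D]_(p, l)) w,
  toK (block_mx x y z w) = block_mx (toK x) (toK y) (toK z) (toK w).
Hypothesis toK_dag : forall k l (x : 'M[D]_(k, l)), toK (dag t x) = (toK x)^T.
Hypothesis semiE : forall N (x : 'M[D]_N), semisimple x = diagonalizable (map_mx f (toK x)).
Hypothesis bracketE : forall k N (y : 'I_k -> 'M[D]_N) (x : 'M[D]_N),
  row_free (bracket_mx (fun i => cplx (y i)) (cplx x)) =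
  row_free (bracket_mx (fun i => map_mx f (toK (y i))) (map_mx f (toK x))).
Hypothesis unitK : forall N (B : 'M[D]_N), cplx B \in unitmx -> toK B \in unitmx.
Hypothesis span : forall k l (z : 'M[C]_(k, l)), exists a1 a2 : 'M[K]_(k, l),
  z = map_mx f a1 + 'i%C *: map_mx f a2.
Hypothesis entry_cvg : forall k l (x0 : 'M[D]_(k, l)) i j,
  (fun x : 'M[D]_(k, l) => f (toK x i j) : (C^o)%type) @ x0 --> (f (toK x0 i j) : (C^o)%type).

Let A0 := toK B0.
Let A1 := toK B1.
Local Notation Z := (invmx A0).
Local Notation oddm := (osp_odd Z A1).
Local Notation ss := (semisimple_part A0 A1).

Lemma toK0 k l : toK (0 : 'M[D]_(k, l)) = 0.
Proof. by apply: (addrI (toK (0 : 'M[D]_(k, l)))); rewrite -toKD !addr0. Qed.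
Lemma toKN k l (x : 'M[D]_(k, l)) : toK (- x) = - toK x.
Proof. by apply: (addrI (toK x)); rewrite -toKD !subrr toK0. Qed.
Lemma toKB k l (x y : 'M[D]_(k, l)) : toK (x - y) = toK x - toK y.
Proof. by rewrite toKD toKN. Qed.

Lemma A0T : A0^T = A0.
Proof. by have [_ _ [_ /dag_hermitian h _ _]] := hP; rewrite -toK_dag h. Qed.
Lemma A1T : A1^T = - A1.
Proof. by have [_ _ [_ _ _ /dag_skew_hermitian h]] := hP; rewrite -toK_dag h toKN. Qed.
Lemma A0u : A0 \in unitmx.
Proof. by have [_ _ [/nondegenerate_cplx h _ _ _]] := hP; exact: unitK. Qed.
Lemma A1u : A1 \in unitmx.
Proof. by have [_ _ [_ _ /nondegenerate_cplx h _]] := hP; exact: unitK. Qed.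

Lemma s_odd_toK x : s_odd P x <-> exists a, toK x = oddm a.
Proof.
split.
  move=> /(s_oddP hP)[a [c [-> rel]]]; exists (toK a).
  rewrite toK_block !toK0 /osp_odd /osp_adjoint -mulmxA -toK_dag -toKM -rel toKM.
  by rewrite mulKmx // A0u.
move=> [a xE]; apply/(s_oddP hP); exists (ofK a), (ofK (osp_adjoint Z A1 a)); split.
  by apply: (can_inj (@toKK _ _)); rewrite xE toK_block !toK0 !ofKK.
apply: (can_inj (@toKK _ _)); rewrite !toKM toK_dag !ofKK.
by rewrite /osp_adjoint -mulmxA mulKVmx // A0u.
Qed.

Lemma s_even_toK y : s_even P y <-> exists p q, toK y = block_mx p 0 0 q /\
  (toK y)^T *m block_mx A0 0 0 A1 + block_mx A0 0 0 A1 *m toK y = 0.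
Proof.
have formE : (forall u v : 'cV[D]_(m + n), form t (block_mx B0 0 0 B1) (y *m u) v +
      form t (block_mx B0 0 0 B1) u (y *m v) = 0) <->
    dag t y *m block_mx B0 0 0 B1 + block_mx B0 0 0 B1 *m y = 0.
  split=> [h|h u v].
    apply: (@form_ext _ _ t) => u v; rewrite mulmx0 mul0mx [RHS]mxE -(h u v) !form_dag.
    by rewrite mulmxDr mulmxDl [LHS]mxE dagM !mulmxA.
  have -> : form t (block_mx B0 0 0 B1) (y *m u) v + form t (block_mx B0 0 0 B1) u (y *m v) =
      (dag t u *m (dag t y *m block_mx B0 0 0 B1 + block_mx B0 0 0 B1 *m y) *m v) 0 0.
    by rewrite mulmxDr mulmxDl [RHS]mxE !form_dag dagM !mulmxA.
  by rewrite h mulmx0 mul0mx mxE.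
have eqE : dag t y *m block_mx B0 0 0 B1 + block_mx B0 0 0 B1 *m y = 0 <->
    (toK y)^T *m block_mx A0 0 0 A1 + block_mx A0 0 0 A1 *m toK y = 0.
  have tB : toK (block_mx B0 0 0 B1) = block_mx A0 0 0 A1 by rewrite toK_block !toK0.
  rewrite -tB -toK_dag -!toKM -toKD; split=> [->|]; first by rewrite toK0.
  by rewrite -(toK0 (m + n) (m + n)) => /(can_inj (@toKK _ _)).
split.
  case=> -[y0 y1] /formE/eqE h; exists (toK (ulsubmx y)), (toK (drsubmx y)); split => //.
  by rewrite -{1}[y]submxK y0 y1 toK_block !toK0.
case=> p [q [yE /eqE/formE h]]; split => //.
have -> : y = block_mx (ofK p) 0 0 (ofK q).
  by apply: (can_inj (@toKK _ _)); rewrite yE toK_block !toK0 !ofKK.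
by split; rewrite (block_mxKur, block_mxKdl).
Qed.

Lemma s_evenZ c y : s_even P (ofK y) -> s_even P (ofK (c *: y)).
Proof.
move=> /s_even_toK[p [q []]]; rewrite ofKK => yE h; apply/s_even_toK.
exists (c *: p), (c *: q); rewrite ofKK; split.
  by rewrite yE scale_block_mx !scaler0.
have -> : (c *: y)^T = c *: y^T by apply/matrixP => i j; rewrite !mxE.
by rewrite -scalemxAl -scalemxAr -scalerDr h scaler0.
Qed.

Lemma s_odd_of a : s_odd P (ofK (oddm a)).
Proof. by apply/s_odd_toK; exists a; rewrite ofKK. Qed.

Lemma orbit_rank_toK x k : orbit_rank_ge P x k <->
  bracket_rank_ge f (fun y => s_even P (ofK y)) (toK x) k.
Proof.
split=> -[y [ys yf]].
  exists (fun i => toK (y i)); split; first by move=> i; rewrite toKK.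
  by rewrite -bracketE.
exists (fun i => ofK (y i)); split => //; rewrite bracketE.
rewrite (eq_bracket_mx (y' := fun i => map_mx f (y i)) (X' := map_mx f (toK x))) //.
by move=> i; rewrite ofKK.
Qed.

Lemma toK_anticommute (x y : 'M[D]_(m + n)) : anticommute x y <->
  toK x *m toK y + toK y *m toK x = 0.
Proof.
rewrite /anticommute; split=> [h|h]; first by rewrite -!toKM -toKD h toK0.
by apply: (can_inj (@toKK _ _)); rewrite toKD !toKM h toK0.
Qed.

Lemma oddmD a c : oddm (a + c) = oddm a + oddm c.
Proof. by rewrite /osp_odd osp_adjointD add_block_mx !addr0. Qed.
Lemma oddm_scale c a : oddm (c *: a) = c *: oddm a.
Proof. by rewrite /osp_odd osp_adjointZ scale_block_mx !scaler0. Qed.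
Lemma oddmB a c : oddm (a - c) = oddm a - oddm c.
Proof. by rewrite -scaleN1r oddmD oddm_scale scaleN1r. Qed.
Lemma oddm_nz a : a != 0 -> oddm a != 0.
Proof. by apply: contra_neq => /eqP; rewrite block_mx_eq0 => /and4P[_ _ /eqP]. Qed.

Let nz2 := nz2K f.

(** The decomposition is x = x_s + x_n, and x_s is up to the scalar p(0) the core. *)
Lemma generic_split_exceptional : generic_split P.
Proof.
move=> y0 k [/s_odd_toK[a y0E]]; rewrite semiE y0E => sa /orbit_rank_toK; rewrite y0E => ra.
have [a2 [s2 r2]] := exists_simple_square_rank fg span ev_m' mn A0T A1T A0u A1u s_evenZ sa ra.
exists (ofK (oddm a2)); split; first exact: s_odd_of.
move=> x0 /s_odd_toK[a0 x0E].
have [|s1 s1P] := @simple_square_cofinite _ _ f g fg _ _ A0 A1 a0 (a2 - a0) 1.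
  by rewrite line1.
have [|s3 s3P] := @rank_core_cofinite _ _ f g fg _ _ A0 A1 
    (fun y => s_even P (ofK y)) a0 (a2 - a0) k 1.
  by rewrite line1.
have [s sP] := cofinite_and (ex_intro _ s1 s1P) (ex_intro _ s3 s3P).
exists s => r /sP[]; set a1 := a0 + _ => sep1 rk1 x.
have xE : toK x = oddm a1.
  by rewrite /x toKD toKZ toKB x0E ofKK oddmD oddm_scale oddmB.
have [q0 _ _] := simple_osp_square nz2 ev_m' A0T A1T A0u sep1.
pose xs : 'M[D]_(m + n) := ofK (oddm (ss a1)).
have xsE : toK xs = oddm (ss a1) by exact: ofKK.
have dE : toK (x - xs) = oddm (a1 - ss a1) by rewrite toKB xE xsE oddmB.
exists xs; split.
- split.
    split; first exact: s_odd_of.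
    rewrite semiE xsE; exact: (semisimple_partP nz2 ev_m' A0T A1T A0u sep1).
  have := oddm_nz (simple_semisimple_part_nz ev_m' A0T A1T A0u sep1).
  by apply: contra_neq => xs0; rewrite -xsE xs0 toK0.
- apply/orbit_rank_toK; rewrite xsE.
  apply: (bracket_rank_geZ s_evenZ (c := (reduced_char_poly (osp_square Z A1 a1))`_0)).
  by rewrite -oddm_scale -(osp_coreE q0).
- by apply/s_odd_toK; exists (a1 - ss a1).
- apply/toK_anticommute; rewrite xsE dE addrC.
  exact: (nil_anticommute nz2 ev_m' A0T A1T A0u q0).
- move=> z [/s_odd_toK[az zE] zd]; apply: (can_inj (@toKK _ _)).
  rewrite toKM toK0 zE dE.
  apply: (double_anticommutant_kernel nz2 ev_m' A0T A1T A0u A1u q0 mn) => al anti.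
  have := zd (ofK (oddm al)); rewrite toK_anticommute zE ofKK; apply.
  split; first exact: s_odd_of.
  by apply/toK_anticommute; rewrite xsE ofKK addrC.
Qed.

Definition top_minor (x : 'M[D]_(m + n)) : 'M[C]_m :=
  \matrix_(i, j) f (toK x (rshift m (widen_ord (ltnW mn) i)) (lshift n j)).

Lemma top_minor_semisimple x : odd_semisimple P x -> \det (top_minor x) = 0.
Proof.
move=> [/s_odd_toK[a xE]]; rewrite semiE xE => sa.
have [u [au uu]] := semisimple_anisotropic_kernel nz2 ev_m' A0T A1T A0u sa.
have unz : u != 0 by apply: contra_neq uu => ->; rewrite mulmx0.
apply/eqP; rewrite -det_tr; apply/det0P; exists (map_mx f u^T).
  by rewrite map_mx_eq0 trmx_eq0.
rewrite -map_trmx -trmx_mul; apply: trmx_inj; rewrite trmxK trmx0.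
apply/matrixP => i j; rewrite ord1 [RHS]mxE.
have := congr1 (fun z : 'M[K]_(n, 1) => f (z (widen_ord (ltnW mn) i) 0)) au.
rewrite !mxE rmorph0 rmorph_sum.
move=> e; rewrite -[RHS]e; apply: eq_bigr => k _.
by rewrite !mxE rmorphM /= xE block_mxEdl.
Qed.

(** For semisimple elements a is not injective, so that its maximal minors vanish;
    this closed condition fails for a coordinate injection of V_0 in V_1. *)
Lemma semisimple_not_dense : ~ (s_odd P `<=` closure (odd_semisimple P)).
Proof.
move=> dns; pose xf : 'M[D]_(m + n) := ofK (oddm (pid_mx m)).
have detf : \det (top_minor xf) = 1.
  have -> : top_minor xf = 1%:M; last by rewrite det1.
  apply/matrixP => i j; rewrite !mxE ofKK block_mxEdl mxE /= ltn_ord andbT.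
  by rewrite rmorph_nat.
have FF : Filter (nbhs xf) by apply: nbhs_filter.
have cv : (fun x => \det (top_minor x) : (C^o)%type) @ xf --> (\det (top_minor xf) : (C^o)%type).
  apply: (det_cvg FF) => i j.
  have := @entry_cvg _ _ xf (rshift m (widen_ord (ltnW mn) i)) (lshift n j).
  rewrite [X in _ --> X -> _](_ : _ = top_minor xf i j) ?mxE //.
  by under [in X in _ -> X]eq_fun do rewrite mxE.
have nz : nbhs xf [set x | \det (top_minor x) != 0].
  have : \forall x \near xf, (\det (top_minor x) : (C^o)%type) != 0; last by [].
  by apply: (cvgr_neq0 _ cv); rewrite detf oner_neq0.
have [x [xs]] := dns _ (s_odd_of _) _ nz.
by rewrite /= top_minor_semisimple // eqxx.
Qed.

End Transport.

Section Instances.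
Variable R : realType.
Local Notation C := R[i].

Lemma complex_bracketE k N (y : 'I_k -> 'M[C]_N) (x : 'M[C]_N) :
  row_free (bracket_mx y x) =
  row_free (bracket_mx (fun i => map_mx idfun (y i)) (map_mx idfun x)).
Proof. by congr row_free; apply: eq_bracket_mx => i; rewrite !map_mx_id. Qed.

Lemma complex_span k l (z : 'M[C]_(k, l)) : exists a1 a2 : 'M[C]_(k, l),
  z = map_mx idfun a1 + 'i%C *: map_mx idfun a2.
Proof. by exists z, 0; rewrite !map_mx_id // scaler0 addr0. Qed.

Section RealInstance.
Variables (m'' n : nat) (B0 : 'M[dring R RealD]_m''.+2) (B1 : 'M[dring R RealD]_n).
Hypothesis hP : dual_pair (TypeI TrivR B0 B1).
Hypothesis ev_m' : ~~ odd m''.+1.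
Hypothesis mn : (m''.+2 < n)%N.

Lemma real_entry_cvg k l (x0 : 'M[dring R RealD]_(k, l)) i j :
  (fun x : 'M[dring R RealD]_(k, l) => ((x i j : R)%:C)%C : (C^o)%type) @ x0 -->
  (((x0 i j : R)%:C)%C : (C^o)%type).
Proof.
have h := @mx_entry_cvg (reals R) k l x0 i j.
exact: (cvg_comp _ _ h (@real_complex_cvg R (x0 i j))).
Qed.

Lemma real_dag k l (x : 'M[dring R RealD]_(k, l)) : dag TrivR x = (x : 'M[R]_(k, l))^T.
Proof. by apply/matrixP => i j; rewrite !mxE. Qed.

Lemma real_generic_split : generic_split (TypeI TrivR B0 B1).
Proof.
apply: (@generic_split_exceptional R RealD TrivR m'' n B0 B1 hP ev_m' mn R (real_complex R) idfun
  (fun r => erefl) (fun k l => id) (fun k l => id)) => //.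
- exact: real_dag.
- by move=> N B; rewrite map_unitmx.
- exact: (@cplx_span R RealD).
Qed.

Lemma real_semisimple_not_dense :
  ~ (s_odd (TypeI TrivR B0 B1) `<=` closure (odd_semisimple (TypeI TrivR B0 B1))).
Proof.
apply: (@semisimple_not_dense R RealD TrivR m'' n B0 B1 hP ev_m' mn R (real_complex R)
  (fun k l => id) (fun k l => id)) => //.
- exact: real_dag.
- by move=> N B; rewrite map_unitmx.
- exact: real_entry_cvg.
Qed.

End RealInstance.

Section ComplexInstance.
Variables (m'' n : nat) (B0 : 'M[dring R ComplexD]_m''.+2) (B1 : 'M[dring R ComplexD]_n).
Hypothesis hP : dual_pair (TypeI TrivC B0 B1).
Hypothesis ev_m' : ~~ odd m''.+1.
Hypothesis mn : (m''.+2 < n)%N.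

Lemma complex_dag k l (x : 'M[dring R ComplexD]_(k, l)) : dag TrivC x = (x : 'M[C]_(k, l))^T.
Proof. by apply/matrixP => i j; rewrite !mxE. Qed.

Lemma complex_generic_split : generic_split (TypeI TrivC B0 B1).
Proof.
apply: (@generic_split_exceptional R ComplexD TrivC m'' n B0 B1 hP ev_m' mn C idfun (real_complex R)
  (fun r => erefl) (fun k l => id) (fun k l => id)).
- by [].
- by [].
- by [].
- by [].
- by [].
- by [].
- exact: complex_dag.
- by move=> N x; rewrite map_mx_id.
- exact: complex_bracketE.
- by [].
- exact: complex_span.
Qed.

Lemma complex_semisimple_not_dense :
  ~ (s_odd (TypeI TrivC B0 B1) `<=` closure (odd_semisimple (TypeI TrivC B0 B1))).
Proof.
apply: (@semisimple_not_dense R ComplexD TrivC m'' n B0 B1 hP ev_m' mn C idfun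
  (fun k l => id) (fun k l => id)).
- by [].
- by [].
- by [].
- by [].
- by [].
- exact: complex_dag.
- by move=> N x; rewrite map_mx_id.
- by [].
- by move=> k l x0 i j; exact: (@mx_entry_cvg (complexes R) k l x0 i j).
Qed.

End ComplexInstance.
End Instances.

Theorem theorem20 (R : realType) (b : base) (m n : nat)
    (P : pair_datum R b m n) (hP : dual_pair P)
    (hO1 : ~ (orthosymplectic P /\ m = 1%N)) :
  dense_in_s_odd P (almost_semisimple P) /\
  (dense_in_s_odd P (odd_semisimple P) <->
   ~ [/\ orthosymplectic P, odd m & (m < n)%N]).
Proof.
have subA : almost_semisimple P `<=` s_odd P by move=> x [].
have subS : odd_semisimple P `<=` s_odd P by move=> x [].
have [ex|nex] := pselect [/\ orthosymplectic P, odd m & (m < n)%N]; last first.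
  have dense x0 : s_odd P x0 -> closure (regular_semisimple P) x0.
    by exact: regular_semisimple_dense.
  split; last split=> // _; split=> // x0 /dense; apply: closure_subset.
    by move=> x; exact: regular_almost_semisimple.
  by move=> x [].
suff [h1 h2] : (forall x0, s_odd P x0 -> closure (almost_semisimple P) x0) /\
    ~ (s_odd P `<=` closure (odd_semisimple P)).
  by split; [split | split=> [[_ /h2]|/(_ ex)]].
have [os om mn] := ex.
have m1 : m <> 1%N by move=> e; exact: hO1.
have [m'' mE] : exists m'', m = m''.+2.
  by case: (m) om m1 => [|[|m'']] // _ _; exists m''.
clear hO1 subA subS ex m1; subst m.
have ev : ~~ odd m''.+1 by move: om; rewrite oddS.
case: P hP os => [//|t B0 B1]; case: t B0 B1 => // B0 B1 hP _.
- split; last exact: (real_semisimple_not_dense hP ev mn).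
  by move=> x0; apply: almost_semisimple_dense => //; exact: real_generic_split.
- split; last exact: (complex_semisimple_not_dense hP ev mn).
  by move=> x0; apply: almost_semisimple_dense => //; exact: complex_generic_split.
Qed.
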